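(* For every integer $b\geq 2$, the quotient $|L_{3,b}|/\mathrm{Aut}(\mathbb{F}_1)$ of the complete linear system $|L_{3,b}|$ on the Hirzebruch surface $\mathbb{F}_1$ is rational, i.e. birational over $\mathbb{C}$ to a projective space.
   Context: We work over $\mathbb{C}$. $\mathbb{F}_1=\mathbb{P}(\mathcal{O}_{\mathbb{P}^1}\oplus\mathcal{O}_{\mathbb{P}^1}(1))$ is the Hirzebruch surface, with natural projection $\pi:\mathbb{F}_1\to\mathbb{P}^1$; it is the blow-up of $\mathbb{P}^2$ at one point. $\mathcal{O}_\pi(1)$ denotes the pullback of $\mathcal{O}_{\mathbb{P}^2}(1)$ by the blow-down $\mathbb{F}_1\to\mathbb{P}^2$, and $L_{a,b}=\mathcal{O}_\pi(a)\otimes\pi^*\mathcal{O}_{\mathbb{P}^1}(b)$. The algebraic group $\mathrm{Aut}(\mathbb{F}_1)$ acts on the projective space $|L_{a,b}|$ of effective divisors in the class of $L_{a,b}$. For an algebraic group $G$ acting on an irreducible variety $X$, $X/G$ denotes a rational quotient, i.e. a variety (defined up to birational equivalence) whose function field is the invariant field $\mathbb{C}(X)^G$. *)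

(* Defs.v *)
From HB Require Import structures.
From mathcomp Require Import all_boot all_order all_algebra.
From mathcomp Require Import boolp reals complex mpoly.
From mathcomp Require Import ring zify.

Set Implicit Arguments.
Unset Strict Implicit.
Unset Printing Implicit Defensive.

Import GRing.Theory.
Local Open Scope ring_scope.
Local Open Scope quotient_scope.

(* The Hirzebruch surface F_1 = P(O + O(1)) is the quotient of
     { (s, t, u, z) | (s, t) <> 0, (u, z) <> 0 }
   by the torus action
     (l, m) . (s, t, u, z) = (l s, l t, l^-1 m u, m z).
   The projection pi is [s : t], the blow-down to P^2 is [s u : t u : z], and
   the exceptional curve is u = 0.  Hence s and t are sections of
   pi^* O(1) = L_{0,1}, z is a section of L_{1,0}, and u is a section of
   L_{1,-1}. *)
Definition vs : 'I_4 := @Ordinal 4 0 isT.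
Definition vt : 'I_4 := @Ordinal 4 1 isT.
Definition vu : 'I_4 := @Ordinal 4 2 isT.
Definition vz : 'I_4 := @Ordinal 4 3 isT.

Definition semistable (K : closedFieldType) : pred {ffun 'I_4 -> K} :=
  fun v => ((v vs != 0) || (v vt != 0)) && ((v vu != 0) || (v vz != 0)).

Definition cone (K : closedFieldType) : Type :=
  {v : {ffun 'I_4 -> K} | semistable v}.
HB.instance Definition _ (K : closedFieldType) := Choice.on (cone K).

Definition torus (K : closedFieldType) (l m : K) (v : {ffun 'I_4 -> K}) :
    {ffun 'I_4 -> K} :=
  [ffun i : 'I_4 => [:: l; l; l^-1 * m; m]`_i * v i].

Definition same_orbit (K : closedFieldType) : rel (cone K) :=
  fun v w => `[< exists l m : K, [/\ l != 0, m != 0 & val w = torus l m (val v)] >].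

Lemma torus1 (K : closedFieldType) (v : {ffun 'I_4 -> K}) : torus 1 1 v = v.
Proof.
apply/ffunP => i; rewrite ffunE invr1 mulr1.
by case: i => [[|[|[|[|//]]]] Hi]; rewrite /= mul1r.
Qed.

Lemma torusM (K : closedFieldType) (l m l' m' : K) (v : {ffun 'I_4 -> K}) :
  torus l' m' (torus l m v) = torus (l' * l) (m' * m) v.
Proof.
apply/ffunP => i; rewrite !ffunE mulrA; congr (_ * _).
case: i => [[|[|[|[|//]]]] Hi] //=.
by rewrite invfM mulrACA.
Qed.

Lemma same_orbit_refl (K : closedFieldType) : reflexive (@same_orbit K).
Proof. by move=> v; apply/asboolP; exists 1, 1; rewrite torus1 oner_eq0. Qed.

Lemma same_orbit_sym (K : closedFieldType) : ssrbool.symmetric (@same_orbit K).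
Proof.
have H v w : same_orbit v w -> same_orbit w v.
  move=> /asboolP[l [m [l0 m0 e]]]; apply/asboolP; exists l^-1, m^-1.
  by rewrite e torusM !mulVf // torus1 !invr_eq0.
by move=> v w; apply/idP/idP; exact: H.
Qed.

Lemma same_orbit_trans (K : closedFieldType) : transitive (@same_orbit K).
Proof.
move=> w v x /asboolP[l [m [l0 m0 e]]] /asboolP[l' [m' [l0' m0' e']]].
apply/asboolP; exists (l' * l), (m' * m).
by rewrite e' e torusM !mulf_neq0.
Qed.

Canonical same_orbit_equiv (K : closedFieldType) : equiv_rel (cone K) :=
  EquivRel (@same_orbit K) (@same_orbit_refl K) (@same_orbit_sym K)
    (@same_orbit_trans K).

Definition F1 (K : closedFieldType) : Type := {eq_quot (same_orbit_equiv K)}.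
HB.instance Definition _ (K : closedFieldType) :=
  EqQuotient.on (F1 K).

(* [bihomog a b A]: the polynomial A in s, t, u, z is a section of L_{a,b},
   with weights s, t : (0,1), u : (1,-1), z : (1,0). *)
Definition bidegree (a : nat) (b : int) (m : 'X_{1..4}) : bool :=
  (m vu + m vz == a)%N && ((m vs)%:Z + (m vt)%:Z - (m vu)%:Z == b).

Definition bihomog (K : closedFieldType) (a : nat) (b : int)
    (A : {mpoly K[4]}) : Prop :=
  forall m : 'X_{1..4}, m \in msupp A -> bidegree a b m.

(* Only the vanishing of [evalF1 A p], and quotients of such values for two
   polynomials of the same bidegree, are independent of the representative
   (see [bihomog_torus]); nothing else is used below. *)
Definition evalF1 (K : closedFieldType) (A : {mpoly K[4]}) (p : F1 K) : K :=
  A.@[val (repr p)].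

Lemma bihomog_torus (K : closedFieldType) (a : nat) (b : int)
    (A : {mpoly K[4]}) (l m : K) (v : {ffun 'I_4 -> K}) :
  l != 0 -> bihomog a b A -> A.@[torus l m v] = m ^+ a * l ^ b * A.@[v].
Proof.
move=> l0 hA; rewrite !mevalE mulr_sumr; apply: eq_big_seq => e /hA.
case/andP => /eqP <- /eqP <-.
rewrite mulrCA; congr (_ * _).
rewrite !big_ord_recr !big_ord0 /= !mul1r !ffunE /=.
have -> : widen_ord (leqnSn 3) (widen_ord (leqnSn 2) (widen_ord (leqnSn 1) ord_max)) = vs.
  exact: val_inj.
have -> : widen_ord (leqnSn 3) (widen_ord (leqnSn 2) ord_max) = vt by exact: val_inj.
have -> : widen_ord (leqnSn 3) ord_max = vu by exact: val_inj.
have -> : ord_max = vz by exact: val_inj.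
rewrite !exprMn exprVn !expfzDr // -exprnN exprD.
rewrite -!exprnP.
move: (l ^- _) (l ^+ _) (l ^+ _) (m ^+ _) (m ^+ _) => x1 x2 x3 x4 x5.
move: (v _ ^+ _) (v _ ^+ _) (v _ ^+ _) (v _ ^+ _) => y1 y2 y3 y4.
ring.
Qed.

(* F_1 as a variety: the sets {B <> 0} form a basis of the Zariski topology. *)
Definition near_pt (K : closedFieldType) (p : F1 K) (P : F1 K -> Prop) : Prop :=
  exists (a : nat) (b : int) (B : {mpoly K[4]}),
    [/\ bihomog a b B, evalF1 B p != 0 & forall q, evalF1 B q != 0 -> P q].

Definition regular_at (K : closedFieldType) (p : F1 K) (f : F1 K -> K) : Prop :=
  exists (a : nat) (b : int) (A B : {mpoly K[4]}),
    [/\ bihomog a b A, bihomog a b B, evalF1 B p != 0 &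
        near_pt p (fun q => f q = evalF1 A q / evalF1 B q)].

(* Continuity is automatic: apply the condition to the indicator function of an
   open neighbourhood of [phi p], which is regular at [phi p]. *)
Definition F1_morphism (K : closedFieldType) (phi : F1 K -> F1 K) : Prop :=
  forall (p : F1 K) (f : F1 K -> K),
    regular_at (phi p) f -> regular_at p (f \o phi).

Definition F1_automorphism (K : closedFieldType) (phi : F1 K -> F1 K) : Prop :=
  F1_morphism phi /\
  exists psi : F1 K -> F1 K, [/\ F1_morphism psi, cancel phi psi & cancel psi phi].

(* The monomial basis of H^0(F_1, L_{a,b}) for a, b >= 0. *)
Definition sect_mons (a b : nat) : seq 'X_{1..4} :=
  [seq [multinom [tuple i; (b + k - i)%N; k; (a - k)%N]] |
     k <- iota 0 a.+1, i <- iota 0 (b + k).+1].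

Definition h0 (a b : nat) : nat := size (sect_mons a b).

Lemma mem_sect_mons (a b : nat) (m : 'X_{1..4}) :
  (m \in sect_mons a b) = bidegree a b%:Z m.
Proof.
apply/allpairsPdep/idP => [[k [i [+ + ->]]]|].
  rewrite !mem_iota /bidegree !multinomE !(tnth_nth 0%N) /=; lia.
rewrite /bidegree => hm; exists (m vu), (m vs); rewrite !mem_iota.
split; [lia|lia|apply/mnmP => i; rewrite !multinomE (tnth_nth 0%N)].
case: i => [[|[|[|[|//]]]] Hi] /=; rewrite (bool_irrelevance Hi isT) -/vs -/vt -/vu -/vz; lia.
Qed.

Lemma sect_mons_uniq (a b : nat) : uniq (sect_mons a b).
Proof.
apply: allpairs_uniq_dep => [|k _|]; [exact: iota_uniq|exact: iota_uniq|].
move=> [k i] [k' i'] _ _ /= /(congr1 (fun m : 'X_{1..4} => (m vu, m vs))).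
by rewrite !multinomE !(tnth_nth 0%N) /= => -[-> ->].
Qed.

Definition sect (K : closedFieldType) (a b : nat) (c : 'I_(h0 a b) -> K) :
    {mpoly K[4]} :=
  \sum_i c i *: 'X_[tnth (in_tuple (sect_mons a b)) i].

(* [is_pullback_div phi a b F F']: div F = phi^* (div F') for sections F, F' of
   L_{a,b}, as Cartier divisors.  A section G of L_{a,b} with G(p) <> 0, which
   exists at every p when a, b >= 0, trivializes L_{a,b} near p, so that F / G
   is a local equation of div F at p; local equations must agree up to a
   unit. *)
Definition is_pullback_div (K : closedFieldType) (phi : F1 K -> F1 K)
    (a b : nat) (F F' : {mpoly K[4]}) : Prop :=
  forall (p : F1 K) (G G' : {mpoly K[4]}),
    bihomog a b%:Z G -> bihomog a b%:Z G' ->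
    evalF1 G p != 0 -> evalF1 G' (phi p) != 0 ->
    exists e : F1 K -> K,
      [/\ regular_at p e, e p != 0 &
          near_pt p (fun q => evalF1 F' (phi q) / evalF1 G' (phi q)
                              = e q * (evalF1 F q / evalF1 G q))].

(* Points of P^(n-1) are nonzero vectors c in K^n up to scaling; |L_{a,b}| is
   P^(h0 a b - 1), the point c being the divisor of [sect c]. *)
Definition nonzero_vec (K : closedFieldType) (n : nat) (c : 'I_n -> K) : Prop :=
  exists i, c i != 0.

(* The points of |L_{a,b}| given by c and c' lie in one Aut(F_1)-orbit. *)
Definition linsys_Aut (K : closedFieldType) (a b : nat)
    (c c' : 'I_(h0 a b) -> K) : Prop :=
  exists phi : F1 K -> F1 K,
    F1_automorphism phi /\ is_pullback_div phi a b (sect c) (sect c').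

(* The function field of P^(n-1), with homogeneous coordinates 'X_0 ... 'X_(n-1). *)
Definition proj_funfield (K : closedFieldType) (n : nat)
    (x : {fraction {mpoly K[n]}}) : Prop :=
  exists (d : nat) (P Q : {mpoly K[n]}),
    [/\ P \is d.-homog, Q \is d.-homog, Q != 0 & x = tofrac P / tofrac Q].

(* The invariants in the function field of P^(n-1) for a group action with orbit
   relation [orb]: the values of x at two points of an orbit agree whenever
   both are defined. *)
Definition inv_funfield (K : closedFieldType) (n : nat)
    (orb : ('I_n -> K) -> ('I_n -> K) -> Prop)
    (x : {fraction {mpoly K[n]}}) : Prop :=
  proj_funfield x /\
  forall (d : nat) (P Q : {mpoly K[n]}),
    P \is d.-homog -> Q \is d.-homog -> x = tofrac P / tofrac Q ->
    forall c c' : 'I_n -> K, nonzero_vec c -> nonzero_vec c' -> orb c c' ->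
      Q.@[c] != 0 -> Q.@[c'] != 0 -> P.@[c] / Q.@[c] = P.@[c'] / Q.@[c'].

(* K-isomorphism between a subfield E of K(X_1, ..., X_n) and a subfield E' of
   K(X_1, ..., X_n'); values of [f] outside E are irrelevant. *)
Definition subfield_iso (K : closedFieldType) (n n' : nat)
    (E : {fraction {mpoly K[n]}} -> Prop)
    (E' : {fraction {mpoly K[n']}} -> Prop) : Prop :=
  exists f : {fraction {mpoly K[n]}} -> {fraction {mpoly K[n']}},
    [/\ forall x, E x -> E' (f x),
        forall y, E' y -> exists2 x, E x & f x = y,
        forall x y, E x -> E y -> f x = f y -> x = y,
        forall x y, E x -> E y -> f (x + y) = f x + f y /\ f (x * y) = f x * f y &
        forall k : K, f (tofrac k%:MP_[n]) = tofrac k%:MP_[n']].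

(* P^(n-1) / G, with function field the invariant field, is birational to some
   projective space. *)
Definition rational_quotient (K : closedFieldType) (n : nat)
    (orb : ('I_n -> K) -> ('I_n -> K) -> Prop) : Prop :=
  exists r : nat,
    subfield_iso (@proj_funfield K r.+1) (inv_funfield orb).

(* Main.v *)
(* Write a section as F = sum_k F_k(s, t) u^k z^(3-k), with F_k a binary form of
   degree b + k.  In homogeneous coordinates an automorphism of F_1 is
     (s, t, u, z) |-> (g (s, t), mu u, nu z + l(s, t) u)
   with g in GL_2 and l a linear form: the local representatives of a morphism
   glue because C[s, t, u, z] is factorial, and comparing degrees with the
   inverse morphism leaves no other polynomials.

   The generic orbit is brought into a normal form with the help of the
   GL_2-invariant pairing of binary forms of equal degree.  The covariant
   functional T_k(m) = <m F_k, F_(k+1)> on linear forms m is killed for k = 0 by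
   a unique choice of l; then T_1 and T_2 fix g up to the torus, if T_1 vanishes
   at t and T_2 at s; finally the torus and the scalars normalize one
   coefficient in each of F_0, F_1, F_2.  This slice meets the generic orbit in
   exactly one point, and its equations can be solved one by one, each being
   linear in a new coefficient; so the slice is birational to an affine space,
   and it is birational to the quotient. *)

Require Import Defs.
From mathcomp Require Import all_boot all_order all_algebra.
From mathcomp Require Import reals complex.
From HB Require Import structures.
From mathcomp Require Import boolp mpoly.
From mathcomp Require Import ring zify.

Set Implicit Arguments.
Unset Strict Implicit.
Unset Printing Implicit Defensive.

Import GRing.Theory.
Local Open Scope ring_scope.
Local Open Scope quotient_scope.

(** * Factoriality of polynomial rings *)

(** Two obstacles shape the proof. The orbit relation is stated for set-theoretic automorphisms and
    local equations of divisors; these are globalized by reduction to lowest terms among polynomials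
    in s, t, u, z, together with the fact that a bihomogeneous polynomial without zeros on F_1 is
    constant. Invariance is demanded at all orbit pairs, generic or not; a special pair is joined by
    an invertible linear map of the coefficients, along which generic identities extend by density.
    The normal form must be rational in the coefficients, so no roots may be extracted. Since l
    changes F_1 by a multiple of l F_0, it comes from Cramer's rule for the form (m, l) |-> <m F_0,
    l F_0>. The matrix is read off from the values of T_1 and T_2. The normalized coefficients
    belong to s^b z^3, s^(b+1) u z^2 and s^(b+1) t u^2 z, whose successive ratios s u / z and t u /
    z are independent characters, so that division suffices. Seven coefficients get determined: 8
    parameters of coordinate maps and one scalar, minus the 2-dimensional torus defining F_1, which
    acts on sections by scalars. *)

Definition rdvd (R : idomainType) (a b : R) : Prop := exists c, b = a * c.

(* Units are admitted, so that a factorization needs no separate unit. *)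
Definition prime_or_unit (R : idomainType) (p : R) : Prop :=
  p != 0 /\ forall a b, rdvd p (a * b) -> rdvd p a \/ rdvd p b.

(** For a domain this is factoriality: primality of the factors already forces uniqueness up to
    units. *)
Definition prods_of_primes (R : idomainType) : Prop :=
  forall a : R, a != 0 -> exists s : seq R,
    a = \prod_(p <- s) p /\ forall p, p \in s -> prime_or_unit p.

(** Coprimality in the form of its consequence, Euclid's lemma, because it is applied to show that a
    ratio in lowest terms divides every other representation. *)
Definition rcoprime (R : idomainType) (a b : R) : Prop :=
  forall c, rdvd a (b * c) -> rdvd a c.

Section Divisibility.
Variable R : idomainType.
Implicit Types a b c p : R.

Lemma rdvd_refl a : rdvd a a. Proof. by exists 1; rewrite mulr1. Qed.

Lemma rdvd_trans b a c : rdvd a b -> rdvd b c -> rdvd a c.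
Proof. by move=> [x ->] [y ->]; exists (x * y); rewrite mulrA. Qed.

Lemma rdvd_mulr a b c : rdvd a b -> rdvd a (b * c).
Proof. by move=> [x ->]; exists (x * c); rewrite mulrA. Qed.

Lemma rdvd_mull a b c : rdvd a c -> rdvd a (b * c).
Proof. by rewrite mulrC; exact: rdvd_mulr. Qed.

(* The prime factors of [a] that divide [b] are cancelled one by one. *)
Lemma lowest_terms a b : prods_of_primes R -> a != 0 ->
  exists g a' b', [/\ a = g * a', b = g * b' & rcoprime a' b'].
Proof.
move=> ufd a0; have [s [-> ps]] := ufd a a0.
move: b ps; have [n] := ubnP (size s); elim: n s => // n IH s sn b ps.
have [[p [ips [b' eb]]]|nop] := pselect (exists p, p \in s /\ rdvd p b).
  have [||g [a' [b'' [ea eb' cop]]]] := IH (rem p s) _ b'.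
  - by rewrite size_rem //; case: s ips sn {ps}.
  - by move=> q /mem_rem; exact: ps.
  exists (p * g), a', b''; split=> //; last by rewrite eb eb' mulrA.
  by rewrite (perm_big _ (perm_to_rem ips)) big_cons ea /= mulrA.
exists 1, (\prod_(p <- s) p), b; split; rewrite ?mul1r //.
have {IH sn} : forall p, p \in s -> prime_or_unit p /\ ~ rdvd p b.
  by move=> p ips; split; [exact: ps|move=> pb; apply: nop; exists p].
elim: s {ps nop} => [|p s IH] ps c.
  by move=> _; rewrite big_nil; exists c; rewrite mul1r.
rewrite big_cons => -[d e].
have [pp pb] := ps p (mem_head _ _).
have : rdvd p (b * c) by rewrite e -mulrA; exists (\prod_(j <- s) j * d).
case/pp.2 => // -[c' ec]; rewrite ec in e *.
have [||c'' ->] := IH _ c'; last by exists c''; rewrite mulrA.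
- by move=> q qs; apply: ps; rewrite inE qs orbT.
- by exists d; apply: (mulfI pp.1); rewrite mulrCA e mulrA.
Qed.

(** The case [rdvd p 1] comes from the empty product; it can occur because [prime_or_unit] admits
    units. *)
Lemma prime_dvd_prod p s : prime_or_unit p ->
  rdvd p (\prod_(x <- s) x) -> rdvd p 1 \/ exists2 x, x \in s & rdvd p x.
Proof.
move=> [_ pp]; elim: s => [|x s IH]; first by rewrite big_nil; left.
rewrite big_cons => /pp[px|/IH[|[y ys py]]]; [|by left|]; right.
  by exists x; rewrite ?mem_head.
by exists y; rewrite // inE ys orbT.
Qed.

End Divisibility.

(** * Gauss's lemma and the factoriality of R[X] *)

Section Gauss.
Variable R : idomainType.
Hypothesis ufd : prods_of_primes R.
Implicit Types (p f g h : {poly R}) (a c : R).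

Lemma rdvdC_coef a p : (forall i, rdvd a p`_i) -> rdvd a%:P p.
Proof.
move=> /choice[q hq]; exists (\poly_(i < size p) q i).
apply/polyP => i; rewrite coefCM coef_poly; case: ltnP => [_|/leq_sizeP/(_ i)].
  exact: hq.
by rewrite mulr0 => ->.
Qed.

Lemma rdvdC_coefE a p i : rdvd a%:P p -> rdvd a p`_i.
Proof. by move=> [q ->]; exists q`_i; rewrite coefCM. Qed.

(** If [a] divided neither [f] nor [g], let i and j be the first indices of coefficients not
    divisible by [a]. In the coefficient i + j of [f * g] every term except the product of these two
    is divisible by [a]. *)
Lemma polyC_prime (a : R) : prime_or_unit a -> prime_or_unit a%:P.
Proof.
move=> [a0 pa]; split; first by rewrite polyC_eq0.
move=> f g fg; apply: contrapT => /not_orP[nf ng].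
have ex h : ~ rdvd a%:P h -> exists i, `[< ~ rdvd a h`_i >].
  move=> nh; apply: contrapT => nex; apply/nh/rdvdC_coef => i.
  by apply: contrapT => ni; apply: nex; exists i; apply/asboolP.
case: (ex_minnP (ex _ nf)) => i /asboolP fi mini.
case: (ex_minnP (ex _ ng)) => j /asboolP gj minj.
have := rdvdC_coefE (i + j) fg.
have lei : (i < (i + j).+1)%N by rewrite ltnS leq_addr.
rewrite coefM (bigD1 (Ordinal lei)) //= addKn.
set r := \sum_(_ < _ | _) _.
have : rdvd a r.
  rewrite /r; elim/big_ind: _ => [|x y [x' ->] [y' ->]|k nk].
  - by exists 0; rewrite mulr0.
  - by exists (x' + y'); rewrite mulrDr.
  case: (ltngtP k i) => ki; last first.
  - by case/eqP: nk; apply: val_inj.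
  - have : (i + j - k < j)%N by have := ltn_ord k; lia.
    by move=> lt; apply: rdvd_mull; apply: contrapT => /asboolP/minj; lia.
  by apply: rdvd_mulr; apply: contrapT => /asboolP/mini; lia.
move=> [r' ->] [e he].
have : rdvd a (f`_i * g`_j) by exists (e - r'); rewrite mulrBr -he addrK.
by case/pa; [exact: fi|exact: gj].
Qed.

(** Primitivity as a cancellation rule for nonzero constants; it has Gauss's lemma built in and
    avoids gcds of coefficients. *)
Definition primitive p : Prop := forall a h, a != 0 -> rdvd a%:P (p * h) -> rdvd a%:P h.

(** Prime factors of the leading coefficient are divided out of [p] as long as one of them divides
    [p]; their number bounds the process. *)
Lemma primitive_part p : p != 0 -> exists c q, [/\ c != 0, primitive q & p = c *: q].
Proof.
move=> p0; have lp0 : lead_coef p != 0 by rewrite lead_coef_eq0.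
have [s [ls ps]] := ufd lp0.
have [n] := ubnP (size s); elim: n => // n IH in s p p0 lp0 ls ps * => sn.
have [[a [ias [q eq]]]|nop] := pselect (exists a, a \in s /\ rdvd a%:P p).
  have [a0 _] := ps _ ias.
  have q0 : q != 0 by apply: contraNneq p0 => q0; rewrite eq q0 mulr0.
  have lq : lead_coef q = \prod_(x <- rem a s) x.
    apply: (mulfI a0); move: ls; rewrite eq lead_coefM lead_coefC => ->.
    by rewrite (perm_big _ (perm_to_rem ias)) big_cons /=.
  have [|||c [r [c0 pr er]]] := IH (rem a s) q q0 _ lq.
  - by rewrite lead_coef_eq0.
  - by move=> x /mem_rem; exact: ps.
  - by rewrite size_rem //; case: s ias sn {ls ps lq}.
  exists (a * c), r; split=> //; first by rewrite mulf_neq0.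
  by rewrite eq er mul_polyC scalerA.
exists 1, p; split; rewrite ?scale1r ?oner_eq0 // => a h a0.
have [t [-> pt]] := ufd a0 => {a a0}.
elim: t h pt => [|a t IHt] h pt; first by rewrite big_nil; exists h; rewrite mul1r.
rewrite big_cons => -[d e].
have pa := pt _ (mem_head _ _).
have : rdvd a%:P (p * h) by rewrite e polyCM -mulrA; exists ((\prod_(j <- t) j)%:P * d).
case/(polyC_prime pa).2 => [ap|[h' eh]]; last first.
  have [||h'' eh'] := IHt h'.
  - by move=> x xt; apply: pt; rewrite inE xt orbT.
  - exists d; apply: (@mulfI _ a%:P); first by rewrite polyC_eq0 pa.1.
    by rewrite mulrCA -eh e polyCM mulrA.
  by exists h''; rewrite polyCM -mulrA -eh'.
(* A prime constant dividing [p] divides the leading coefficient, so it is a unit or divides some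
   [x] in [s]. In the latter case [x] does not divide [p], hence not [a], so [x] divides the
   cofactor and [a] is again a unit. *)
have [z az1] : rdvd a 1.
  have : rdvd a (\prod_(x <- s) x) by rewrite -ls; exact: rdvdC_coefE.
  case/(prime_dvd_prod pa) => // -[x xs [y exy]].
  have [x0 /(_ a y)] := ps _ xs; rewrite -exy; case; first exact: rdvd_refl.
    move=> [z az]; case: nop; exists x; split=> //.
    by apply: rdvd_trans ap; exists z%:P; rewrite az polyCM.
  move=> [z ez]; exists z; apply: (mulIf x0).
  by rewrite mul1r {1}exy {1}ez; ring.
have azP : a%:P * z%:P = 1 by rewrite -polyCM -az1.
have [||h' eh'] := IHt (z%:P * h).
- by move=> w wt; apply: pt; rewrite inE wt orbT.
- by exists d; rewrite mulrCA e polyCM -[RHS]mul1r -azP; ring.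
by exists h'; rewrite polyCM -mulrA -eh' mulrA azP mul1r.
Qed.

(** The argument over the fraction field: the gcd of [q] and [f] is either constant or associated to
    [q]. The multipliers of pseudo-division and of Bezout stand in for denominators, and primitivity
    of [q] cancels them. *)
Lemma irreducible_primitive_prime q : q != 0 -> primitive q ->
  ~ (exists a q1 q2, [/\ a != 0, a *: q = q1 * q2, (size q1 < size q)%N
       & (size q2 < size q)%N]) -> prime_or_unit q.
Proof.
move=> q0 pq irr; split=> // f h [x efh].
have [->|f0] := eqVneq f 0; first by left; exists 0; rewrite mulr0.
have /Pdiv.Idomain.dvdpP[[c g'] /= c0 eq] := dvdp_gcdl q f.
have /Pdiv.Idomain.dvdpP[[d f'] /= d0 ef] := dvdp_gcdr q f.
have [[u v] /eqpP[[c1 c2] /= /andP[c10 c20] eb]] := Bezoutp q f.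
set g := gcdp q f in eq ef eb.
have : g' * g != 0 by rewrite -eq scale_poly_eq0 (negbTE c0).
rewrite mulf_eq0 => /norP[g'0 g0].
have sq : size q = (size g' + size g).-1 by rewrite -(size_scale q c0) eq size_mul.
have [/size_poly1P[k k0 eg]|sg] := boolP (size g == 1%N).
  have w0 : c2 * k != 0 by rewrite mulf_neq0.
  have ew : (c2 * k)%:P = c1%:P * (u * q + v * f) by rewrite polyCM -eg !mul_polyC.
  have e : (c2 * k)%:P * h = q * (c1%:P * (u * h + v * x)).
    rewrite ew; transitivity (c1%:P * (u * (q * h) + v * (f * h))); first by ring.
    by rewrite efh; ring.
  right; have /(pq _ _ w0)[y ey] : rdvd (c2 * k)%:P (q * (c1%:P * (u * h + v * x))).
    by rewrite -e; exists h.
  exists y; apply: (@mulfI _ (c2 * k)%:P); first by rewrite polyC_eq0.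
  by rewrite mulrCA -ey.
have [/size_poly1P[k k0 eg]|sg'] := boolP (size g' == 1%N).
  have w0 : d * k != 0 by rewrite mulf_neq0.
  have e : (d * k)%:P * f = q * (c *: f').
    rewrite -scalerAr scalerAl eq eg polyCM -mulrA mulrCA [d%:P * _]mul_polyC ef; ring.
  left; have /(pq _ _ w0)[y ey] : rdvd (d * k)%:P (q * (c *: f')) by rewrite -e; exists f.
  exists y; apply: (@mulfI _ (d * k)%:P); first by rewrite polyC_eq0.
  by rewrite mulrCA -ey.
case: irr; exists c, g', g; split=> //; move: g0 g'0 sg sg'.
all: rewrite -!size_poly_eq0 sq; lia.
Qed.

Lemma polyC_prods (a : R) : a != 0 -> exists s : seq {poly R},
  a%:P = \prod_(p <- s) p /\ forall p, p \in s -> prime_or_unit p.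
Proof.
move=> /ufd[s [-> ps]]; exists (map polyC s); split.
  by rewrite rmorph_prod big_map.
by move=> _ /mapP[p /ps pp ->]; exact: polyC_prime.
Qed.

(** Induction on the size. If [a *: q] splits into smaller factors with primitive parts [r1] and
    [r2], Gauss's lemma makes [a] divide the product of their contents, so that [q] itself is a
    constant times [r1 * r2]. *)
Lemma poly_prods_of_primes : prods_of_primes {poly R}.
Proof.
move=> p; have [n] := ubnP (size p); elim: n p => // n IH p sp p0.
have [c [q [c0 pq epq]]] := primitive_part p0.
have q0 : q != 0 by apply: contraNneq p0 => q0; rewrite epq q0 scaler0.
have sq : size q = size p by rewrite epq size_scale.
suff [t [et pt]] : exists t : seq {poly R},
    q = \prod_(p <- t) p /\ forall p, p \in t -> prime_or_unit p.
  have [s [es ps]] := polyC_prods c0.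
  exists (s ++ t); rewrite big_cat /= -es -et mul_polyC; split=> // x.
  by rewrite mem_cat => /orP[/ps|/pt].
have [[a [q1 [q2 [a0 eq s1 s2]]]]|irr] := pselect (exists a q1 q2,
    [/\ a != 0, a *: q = q1 * q2, (size q1 < size q)%N & (size q2 < size q)%N]); last first.
  exists [:: q]; rewrite big_seq1; split=> // x; rewrite inE => /eqP ->.
  exact: irreducible_primitive_prime.
have : q1 * q2 != 0 by rewrite -eq scale_poly_eq0 (negbTE a0).
rewrite mulf_eq0 => /norP[q10 q20].
have [c1 [r1 [c10 pr1 e1]]] := primitive_part q10.
have [c2 [r2 [c20 pr2 e2]]] := primitive_part q20.
have e12 : a *: q = (c1 * c2) *: (r1 * r2) by rewrite eq e1 e2 -scalerAl -scalerAr scalerA.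
have [y ey] : rdvd a (c1 * c2).
  have : rdvd a%:P (r1 * (r2 * (c1 * c2)%:P)).
    by exists q; rewrite mul_polyC e12 -mul_polyC mulrA mulrC.
  by move=> /(pr1 _ _ a0)/(pr2 _ _ a0)/(rdvdC_coefE 0); rewrite coefC.
have y0 : y != 0 by apply: contraNneq (mulf_neq0 c10 c20) => y0; rewrite ey y0 mulr0.
have eqy : q = y%:P * (r1 * r2).
  apply: (@mulfI _ a%:P); first by rewrite polyC_eq0.
  by rewrite !mul_polyC e12 ey scalerA.
have [s [es ps]] := polyC_prods y0.
have [||t1 [et1 pt1]] := IH r1.
- by rewrite -(size_scale r1 c10) -e1; lia.
- by apply: contraNneq q10 => r0; rewrite e1 r0 scaler0.
have [||t2 [et2 pt2]] := IH r2.
- by rewrite -(size_scale r2 c20) -e2; lia.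
- by apply: contraNneq q20 => r0; rewrite e2 r0 scaler0.
exists (s ++ t1 ++ t2); rewrite !big_cat /= -es -et1 -et2; split=> // x.
by rewrite !mem_cat => /or3P[/ps|/pt1|/pt2].
Qed.

End Gauss.

Lemma prods_of_primes_iso (R S : idomainType) (f : {rmorphism R -> S})
    (g : {rmorphism S -> R}) : cancel f g -> cancel g f ->
  prods_of_primes S -> prods_of_primes R.
Proof.
move=> fK gK ufd a a0; have [|s [es ps]] := ufd (f a).
  by rewrite -(inj_eq (can_inj gK)) fK rmorph0.
exists (map g s); split; first by rewrite big_map -rmorph_prod -es fK.
move=> _ /mapP[p /ps[p0 pp] ->]; split.
  by rewrite -(inj_eq (can_inj fK)) gK rmorph0.
move=> b c [x e]; have : rdvd p (f b * f c).
  by exists (f x); rewrite -rmorphM e rmorphM gK.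
by case/pp => -[y ey]; [left|right]; exists (g y); rewrite -rmorphM -ey fK.
Qed.

(** * Splitting off the last variable of a multivariate polynomial *)

Section MultiUni.
Variables (n : nat) (R : idomainType).

(** Together with [muni] this identifies polynomials in n + 1 variables with univariate polynomials
    over those in n variables, the basis for induction on the number of variables. *)
Definition muni_inv (q : {poly {mpoly R[n]}}) : {mpoly R[n.+1]} :=
  (map_poly (@mwiden n R) q).['X_ord_max].

Lemma muni_inv_monoid_morphism : monoid_morphism muni_inv.
Proof.
split=> [|p q]; last by rewrite /muni_inv rmorphM hornerM.
by rewrite /muni_inv rmorph1 hornerC.
Qed.

Lemma muni_inv_zmod_morphism : zmod_morphism muni_inv.
Proof. by move=> p q; rewrite /muni_inv rmorphB hornerD hornerN. Qed.

HB.instance Definition _ :=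
  GRing.isZmodMorphism.Build _ _ muni_inv muni_inv_zmod_morphism.
HB.instance Definition _ :=
  GRing.isMonoidMorphism.Build _ _ muni_inv muni_inv_monoid_morphism.

Lemma muni_invZXn a k : muni_inv (a *: 'X^k) = mwiden a * 'X_ord_max ^+ k.
Proof.
by rewrite /muni_inv -mul_polyC rmorphM /= map_polyC /= map_polyXn hornerM hornerC hornerXn.
Qed.

Lemma muniXm m : muni 'X_[m] =
  'X_[[multinom (m (widen_ord (leqnSn n) i)) | i < n]] *: 'X^(m ord_max) :> {poly {mpoly R[n]}}.
Proof. by rewrite muniE msuppX big_seq1 mcoeffX eqxx scale1r. Qed.

Lemma muniK : cancel (@muni n R) muni_inv.
Proof.
move=> p; rewrite [p in LHS]mpolyE (raddf_sum (@muni n R)) (raddf_sum muni_inv) [RHS]mpolyE.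
apply: eq_bigr => m _; transitivity (muni_inv (muni (p@_m *: 'X_[m]))) => //.
rewrite muniZ muniXm scalerA mul_mpolyC muni_invZXn mwidenZ mwidenX -scalerAl; congr (_ *: _).
rewrite mpolyXn -mpolyXD; congr 'X_[_].
apply/mnmP => i; rewrite mnmDE mulmnE mnm1E.
case: (unliftP ord_max i) => [j|] ->.
  have -> : lift ord_max j = widen_ord (leqnSn n) j.
    by apply: val_inj; rewrite /= /bump leqNgt ltn_ord.
  by rewrite mnmwiden_widen mnmE eqE /= gtn_eqF ?ltn_ord // mul0n addn0.
by rewrite mnmwiden_ordmax eqxx mul1n.
Qed.

Lemma muni_invK : cancel muni_inv (@muni n R).
Proof.
move=> q; rewrite -[q in LHS]coefK poly_def (raddf_sum muni_inv).
rewrite (raddf_sum (@muni n R)) -[RHS]coefK poly_def.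
apply: eq_bigr => i _; transitivity (muni (muni_inv (q`_i *: 'X^i))) => //.
rewrite muni_invZXn muniM -mul_polyC; congr (_ * _).
  rewrite [q`_i in LHS]mpolyE (raddf_sum (@mwiden n R)) (raddf_sum (@muni n R)).
  rewrite [q`_i in RHS]mpolyE (raddf_sum polyC).
  apply: eq_bigr => m _; transitivity (muni (mwiden ((q`_i)@_m *: 'X_[m]))) => //.
  rewrite mwidenZ mwidenX muniZ muniXm mnmwiden_ordmax.
  rewrite expr0 alg_polyC -mul_polyC -polyCM mul_mpolyC; congr (_ *: 'X_[_])%:P.
  by apply/mnmP => j; rewrite mnmE mnmwiden_widen.
rewrite mpolyXn muniXm mulmnE mnm1E eqxx mul1n.
rewrite (_ : [multinom _ | _ < _] = 0%MM) ?mpolyX0 ?scale1r //.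
by apply/mnmP => j; rewrite mnmE mulmnE mnm1E mnm0E eqE /= gtn_eqF ?ltn_ord.
Qed.

End MultiUni.

Lemma mpoly_prods_of_primes (K : fieldType) (n : nat) : prods_of_primes {mpoly K[n]}.
Proof.
elim: n => [|n IH].
  (* Without variables the ring is the field, and the unit [a] counts as its own factorization. *)
  move=> a a0; exists [:: a]; rewrite big_seq1; split=> // p; rewrite inE => /eqP ->.
  split=> // b c _; left; exists ((a@_0)^-1%:MP * b).
  rewrite mulrA {1}(nvar0_mpolyC a) -mpolyCM mulfV ?mul1r //.
  by apply: contra_neq a0 => e; rewrite (nvar0_mpolyC a) e mpolyC0.
by apply: (prods_of_primes_iso (@muniK n K) (@muni_invK n K)); exact: poly_prods_of_primes.
Qed.

Lemma muni_eval (R : comNzRingType) (n : nat) (w : 'I_n.+1 -> R) (p : {mpoly R[n.+1]}) :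
  p.@[w] = (map_poly (meval (fun i => w (widen_ord (leqnSn n) i))) (muni p)).[w ord_max].
Proof.
rewrite muniE [in LHS](mpolyE p) !rmorph_sum /= horner_sum; apply: eq_bigr => m _.
rewrite mevalZ mevalX map_polyZ map_polyXn hornerZ hornerXn /=.
rewrite mevalZ mevalX big_ord_recr /= mulrA; congr (_ * _ * _).
by apply: eq_bigr => i _; rewrite mnmE.
Qed.

(** * Polynomials over an algebraically closed field as functions *)

Section Evaluation.
Variable K : closedFieldType.

(** Induction through the leading coefficient in the last variable: where it does not vanish, the
    specialized univariate polynomial is nonzero and so has a nonroot. *)
Lemma mpoly_neq0_eval (n : nat) (p : {mpoly K[n]}) :
  p != 0 -> exists v : 'I_n -> K, p.@[v] != 0.
Proof.
elim: n p => [|n IH] p p0.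
  exists (fun _ => 0); rewrite (nvar0_mpolyC p) mevalC.
  by apply: contra_neq p0 => e; rewrite (nvar0_mpolyC p) e mpolyC0.
have q0 : muni p != 0.
  by rewrite -(inj_eq (can_inj (@muni_invK n K))) muniK /muni_inv rmorph0 horner0.
have [v hv] : exists v, (lead_coef (muni p)).@[v] != 0.
  by apply: IH; rewrite lead_coef_eq0.
have : map_poly (meval v) (muni p) != 0 by rewrite -lead_coef_eq0 lead_coef_map_eq.
move=> /closed_nonrootP[x qx].
exists (fun i => if unlift ord_max i is Some j then v j else x).
rewrite muni_eval unlift_none; move: qx; rewrite /root; congr (_.[_] != 0).
apply: eq_map_poly => a; apply: meval_eq => i.
have -> : widen_ord (leqnSn n) i = lift ord_max i.
  by apply: val_inj; rewrite /= /bump leqNgt ltn_ord.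
by rewrite liftK.
Qed.

(** The locus [r != 0] is dense, so identities may be checked where denominators survive; [r = 1]
    gives the plain identity principle. *)
Lemma mpoly_eq_eval (n : nat) (r p q : {mpoly K[n]}) : r != 0 ->
  (forall v, r.@[v] != 0 -> p.@[v] = q.@[v]) -> p = q.
Proof.
move=> r0 h; apply/eqP; rewrite -subr_eq0; apply/negP => /negP pq.
have [v] := mpoly_neq0_eval (mulf_neq0 r0 pq).
rewrite mevalM mevalB mulf_eq0 => /norP[/h ->]; by rewrite subrr eqxx.
Qed.

End Evaluation.

(* Weighted homogeneity is tested on the image of [p] under
   ['X_i |-> 'X_i * T ^ w i]; a product which is a monomial in [T] has
   monomial factors. *)
Section WeightedHomogeneity.
Variables (K : closedFieldType) (n : nat) (w : 'I_n -> nat).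

Definition wdeg (m : 'X_{1..n}) : nat := \sum_i w i * m i.

Definition whomog (d : nat) (p : {mpoly K[n]}) : Prop :=
  forall m, m \in msupp p -> wdeg m = d.

Definition wpoly (p : {mpoly K[n]}) : {poly {mpoly K[n]}} :=
  mmap (polyC \o @mpolyC n K) (fun i => 'X_i *: 'X^(w i)) p.

Lemma wpolyE p : wpoly p = \sum_(m <- msupp p) (p@_m *: 'X_[m]) *: 'X^(wdeg m).
Proof.
apply: eq_bigr => m _; rewrite /= -mul_mpolyC -scalerA mul_polyC; congr (_ *: _).
rewrite /mmap1 /wdeg (eq_bigr (fun i => ('X_i ^+ m i)%:P * 'X^(w i * m i))).
  by rewrite big_split /= -rmorph_prod -mpolyXE_id -mul_polyC prodrXr.
by move=> i _; rewrite exprZn mul_polyC exprM.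
Qed.

Lemma wpolyM p q : wpoly (p * q) = wpoly p * wpoly q.
Proof. by rewrite /wpoly rmorphM. Qed.

Lemma coef_wpoly p i : (wpoly p)`_i = \sum_(m <- msupp p | wdeg m == i) p@_m *: 'X_[m].
Proof.
rewrite wpolyE coef_sum [RHS]big_mkcond; apply: eq_bigr => m _.
by rewrite coefZ coefXn eq_sym; case: eqP => _; rewrite ?mulr1 ?mulr0.
Qed.

Lemma wpoly_homog d p : whomog d p -> wpoly p = p *: 'X^d.
Proof.
move=> hp; rewrite wpolyE [p in RHS]mpolyE scaler_suml.
by apply: eq_big_seq => m /hp ->.
Qed.

Lemma homog_wpoly d p : (forall i, i != d -> (wpoly p)`_i = 0) -> whomog d p.
Proof.
move=> hp m mp; apply/eqP; apply: contraLR mp => /hp; rewrite coef_wpoly => e.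
move: (congr1 (mcoeff m) e); rewrite raddf_sum mcoeff0 /= => e0.
apply/negP => mp; have := mp; rewrite mcoeff_msupp; apply/negP/negPn/eqP.
rewrite -{}e0 -big_filter (bigD1_seq m) ?filter_uniq ?msupp_uniq //=; last first.
  by rewrite mem_filter eqxx.
rewrite mcoeffZ mcoeffX eqxx mulr1 big1 ?addr0 // => m' m'm.
by rewrite mcoeffZ mcoeffX (negbTE m'm) mulr0.
Qed.

(** While N > 0 the constant term of the product vanishes, so 'X divides [f] or [g] and can be
    cancelled; at N = 0 the factor [f] is constant. *)
Lemma monomial_factor (R : idomainType) N (c : R) (f g : {poly R}) : c != 0 ->
  f * g = c *: 'X^N -> exists d, forall i, i != d -> f`_i = 0.
Proof.
elim: N f g => [|N IH] f g c0 e.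
  exists 0%N => i i0; have : size (f * g) == 1%N.
    by rewrite e expr0 size_scale ?size_poly1.
  rewrite size_mul_eq1 => /andP[/eqP sf _]; apply/(leq_sizeP _ 1%N) => //.
    by rewrite sf.
  by case: i i0.
have : (f * g)`_0 == 0 by rewrite e coefZ coefXn mulr0.
have X0 (h : {poly R}) : h`_0 = 0 -> exists h1, h = h1 * 'X.
  move=> h0; have : root h 0 by rewrite /root horner_coef0 h0.
  by case/factor_theorem => h1; rewrite subr0 => ->; exists h1.
have X0neq : 'X != 0 :> {poly R} by rewrite polyX_eq0.
rewrite coefM big_ord1 mulf_eq0 => /orP[/eqP/X0[f1 ef]|/eqP/X0[g1 eg]].
  have /(IH _ _ c0)[d hd] : f1 * g = c *: 'X^N.
    by apply: (mulIf X0neq); rewrite mulrAC -ef e exprSr scalerAl.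
  by exists d.+1 => -[|i] hi; rewrite ef coefMX //=; apply: hd.
have /(IH _ _ c0)[d hd] : f * g1 = c *: 'X^N; last by exists d.
by apply: (mulIf X0neq); rewrite -mulrA -eg e exprSr scalerAl.
Qed.

Lemma whomog_factor d p q : p * q != 0 -> whomog d (p * q) ->
  exists d', whomog d' p.
Proof.
move=> pq0 /wpoly_homog; rewrite wpolyM => /(monomial_factor pq0)[d' hd'].
by exists d'; apply: homog_wpoly.
Qed.

End WeightedHomogeneity.

(** * Automorphisms of F_1 *)

Section Bihomogeneous.
Variable K : closedFieldType.
Implicit Types (A B C : {mpoly K[4]}) (p q : F1 K).

Lemma bihomogD a b A B : bihomog a b A -> bihomog a b B -> bihomog a b (A + B).
Proof. by move=> hA hB m /msuppD_le; rewrite mem_cat => /orP[/hA|/hB]. Qed.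

Lemma bihomogN a b A : bihomog a b A -> bihomog a b (- A).
Proof. by move=> hA m; rewrite (perm_mem (msuppN A)) => /hA. Qed.

Lemma bihomogB a b A B : bihomog a b A -> bihomog a b B -> bihomog a b (A - B).
Proof. by move=> hA hB; apply/bihomogD => //; exact: bihomogN. Qed.

Lemma bihomog0 a b : bihomog a b (0 : {mpoly K[4]}).
Proof. by move=> m; rewrite msupp0. Qed.

Lemma bihomog_sum (I : eqType) (r : seq I) a b (F : I -> {mpoly K[4]}) :
  (forall i, i \in r -> bihomog a b (F i)) -> bihomog a b (\sum_(i <- r) F i).
Proof.
move=> h; rewrite big_seq; elim/big_ind: _ => //; first exact: bihomog0.
by move=> x y; exact: bihomogD.
Qed.

Lemma bihomogZ a b (k : K) A : bihomog a b A -> bihomog a b (k *: A).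
Proof. by move=> hA m /msuppZ_le/hA. Qed.

Lemma bihomogM a b a' b' A B : bihomog a b A -> bihomog a' b' B ->
  bihomog (a + a')%N (b + b') (A * B).
Proof.
move=> hA hB m /msuppM_le/allpairsP[[m1 m2] /= [/hA h1 /hB h2 ->]].
by move: h1 h2; rewrite /bidegree !mnmDE; lia.
Qed.

Lemma bihomog1 : bihomog 0 0 (1 : {mpoly K[4]}).
Proof. by move=> m; rewrite msupp1 inE => /eqP ->; rewrite /bidegree !mnm0E. Qed.

Lemma bihomogXn a b A n : bihomog a b A -> bihomog (n * a)%N (n%:Z * b) (A ^+ n).
Proof.
move=> hA; elim: n => [|n IH]; first by rewrite mul0r; exact: bihomog1.
rewrite exprS mulSn -addn1 PoszD mulrDl mul1r [n%:Z * b + b]addrC.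
exact: bihomogM.
Qed.

Lemma bihomogX m a b : bidegree a b m -> bihomog a b ('X_[m] : {mpoly K[4]}).
Proof. by move=> h m'; rewrite msuppX inE => /eqP ->. Qed.

Lemma bihomog_vs : bihomog 0 1 ('X_vs : {mpoly K[4]}).
Proof. by apply: bihomogX; rewrite /bidegree !mnm1E. Qed.
Lemma bihomog_vt : bihomog 0 1 ('X_vt : {mpoly K[4]}).
Proof. by apply: bihomogX; rewrite /bidegree !mnm1E. Qed.
Lemma bihomog_vu : bihomog 1 (-1) ('X_vu : {mpoly K[4]}).
Proof. by apply: bihomogX; rewrite /bidegree !mnm1E. Qed.
Lemma bihomog_vz : bihomog 1 0 ('X_vz : {mpoly K[4]}).
Proof. by apply: bihomogX; rewrite /bidegree !mnm1E. Qed.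

Lemma bihomog_inj a b a' b' A : A != 0 -> bihomog a b A -> bihomog a' b' A ->
  a = a' /\ b = b'.
Proof.
move=> /mlead_supp mA /(_ _ mA) h /(_ _ mA); move: h; rewrite /bidegree; lia.
Qed.

(** Under the grading a + b the variables s, t, z have weight 1 and u has weight 0, whereas b alone
    can be negative. *)
Lemma bihomog_ge0 a b A : A != 0 -> bihomog a b A -> exists n : nat, n%:Z = a%:Z + b.
Proof.
move=> /mlead_supp mA /(_ _ mA); rewrite /bidegree => h.
by exists (mlead A vs + mlead A vt + mlead A vz)%N; move: h; lia.
Qed.

(* The bidegree (a, b) is encoded by the nonnegative weights a and a + b. *)
Definition weight_a (i : 'I_4) : nat := nth 0%N [:: 0; 0; 1; 1]%N i.
Definition weight_ab (i : 'I_4) : nat := nth 0%N [:: 1; 1; 0; 1]%N i.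

Lemma ord4E (i : 'I_4) : [\/ i = vs, i = vt, i = vu | i = vz].
Proof.
by case: i => [[|[|[|[|//]]]] hi]; [constructor 1|constructor 2|constructor 3|constructor 4];
  apply: val_inj.
Qed.

Lemma big_ord4 (R : Type) (idx : R) (op : Monoid.law idx) (F : 'I_4 -> R) :
  \big[op/idx]_i F i = op (op (op (F vs) (F vt)) (F vu)) (F vz).
Proof.
rewrite !big_ord_recr big_ord0 /= Monoid.mul1m.
by congr (op (op (op (F _) (F _)) (F _)) (F _)); apply: val_inj.
Qed.

Lemma bihomog_factor a b A B : A * B != 0 -> bihomog a b (A * B) ->
  exists a' b', bihomog a' b' A.
Proof.
move=> AB0 h; have [n hn] := bihomog_ge0 AB0 h.
have [|a' ha] := @whomog_factor K 4 weight_a a A B AB0.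
  by move=> m /h; rewrite /wdeg /bidegree big_ord4 /weight_a /=; lia.
have [|n' hn'] := @whomog_factor K 4 weight_ab n A B AB0.
  by move=> m /h; rewrite /wdeg /bidegree big_ord4 /weight_ab /=; lia.
exists a', (n'%:Z - a'%:Z) => m mA; move: (ha m mA) (hn' m mA).
by rewrite /wdeg /bidegree !big_ord4 /weight_a /weight_ab /=; lia.
Qed.

Definition pt (p : F1 K) : {ffun 'I_4 -> K} := val (repr p).

Lemma evalF1E A p : evalF1 A p = A.@[pt p]. Proof. by []. Qed.

Lemma evalF1M A B p : evalF1 (A * B) p = evalF1 A p * evalF1 B p.
Proof. exact: mevalM. Qed.

Lemma evalF1B A B p : evalF1 (A - B) p = evalF1 A p - evalF1 B p.
Proof. exact: mevalB. Qed.

Lemma evalF1_1 p : evalF1 1 p = 1. Proof. exact: meval1. Qed.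

Lemma evalF1X i p : evalF1 'X_i p = pt p i. Proof. exact: mevalXU. Qed.

Lemma pt_semistable p : semistable (pt p). Proof. exact: valP. Qed.

Lemma pt_st p : (pt p vs != 0) || (pt p vt != 0).
Proof. by have /andP[] := pt_semistable p. Qed.

Lemma pt_uz p : (pt p vu != 0) || (pt p vz != 0).
Proof. by have /andP[] := pt_semistable p. Qed.

Lemma pt_pi (w : cone K) : exists l m : K,
  [/\ l != 0, m != 0 & pt (\pi_(F1 K) w) = torus l m (val w)].
Proof.
have /eqmodP : repr (\pi_(F1 K) w) = w %[mod F1 K] by rewrite reprK.
rewrite /= same_orbit_sym => /asboolP[l [m [l0 m0 e]]]; by exists l, m.
Qed.

Lemma pi_pt p q l m : l != 0 -> m != 0 -> pt p = torus l m (pt q) -> p = q.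
Proof.
move=> l0 m0 e; rewrite -[p]reprK -[q]reprK; apply/eqmodP.
rewrite /= same_orbit_sym; apply/asboolP; by exists l, m.
Qed.

Lemma evalF1_pi a b A (w : cone K) : bihomog a b A ->
  (evalF1 A (\pi_(F1 K) w) != 0) = (A.@[val w] != 0).
Proof.
move=> hA; have [l [m [l0 m0]]] := pt_pi w; rewrite evalF1E => ->.
by rewrite (bihomog_torus _ _ l0 hA) !mulf_eq0 !expf_eq0 expfz_eq0 (negbTE l0) (negbTE m0) !andbF.
Qed.

Lemma semistable_vs (v : {ffun 'I_4 -> K}) : semistable v -> exists p l m,
  [/\ l != 0, m != 0 & pt p = torus l m v].
Proof.
move=> sv; have [l [m h]] := pt_pi (Sub v sv : cone K).
by exists (\pi_(F1 K) (Sub v sv : cone K)), l, m.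
Qed.

Lemma semistable_torus l m (v : {ffun 'I_4 -> K}) : l != 0 -> m != 0 ->
  semistable (torus l m v) = semistable v.
Proof.
by move=> l0 m0; rewrite /semistable !ffunE /= !mulf_eq0 invr_eq0 (negbTE l0) (negbTE m0).
Qed.

Lemma basic_open_nonempty a b A : A != 0 -> bihomog a b A -> exists p, evalF1 A p != 0.
Proof.
move=> A0 hA; have X0 i : 'X_i != 0 :> {mpoly K[4]}.
  by rewrite -msize_poly_eq0 msizeX.
have [v] := mpoly_neq0_eval (mulf_neq0 A0 (mulf_neq0 (X0 vs) (X0 vu))).
rewrite !mevalM !mevalXU !mulf_eq0 !negb_or => /and3P[Av vs0 vu0].
have sv : semistable (finfun v) by rewrite /semistable !ffunE vs0 vu0.
exists (\pi_(F1 K) (Sub (finfun v) sv : cone K)); rewrite (evalF1_pi _ hA) /=.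
by rewrite (_ : A.@[finfun v] = A.@[v]) //; apply: meval_eq => i; rewrite ffunE.
Qed.

Lemma bihomog_eq0 a b a' b' A C : bihomog a b A -> bihomog a' b' C -> C != 0 ->
  (forall p, evalF1 C p != 0 -> evalF1 A p = 0) -> A = 0.
Proof.
move=> hA hC C0 h; apply/eqP; apply/negP => /negP A0.
have [p] := basic_open_nonempty (mulf_neq0 A0 C0) (bihomogM hA hC).
by rewrite evalF1M mulf_eq0 => /norP[/eqP Ap /h].
Qed.

Lemma near_pt_refl p P : near_pt p P -> P p.
Proof. by move=> [a [b [B [_ Bp h]]]]; exact: h. Qed.

Lemma near_ptS p (P Q : F1 K -> Prop) : (forall q, P q -> Q q) -> near_pt p P -> near_pt p Q.
Proof. by move=> PQ [a [b [B [hB Bp h]]]]; exists a, b, B; split=> // q /h/PQ. Qed.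

Lemma near_ptI p P Q : near_pt p P -> near_pt p Q -> near_pt p (fun q => P q /\ Q q).
Proof.
move=> [a [b [B [hB Bp h]]]] [a' [b' [B' [hB' Bp' h']]]].
exists (a + a')%N, (b + b'), (B * B'); split; first exact: bihomogM.
  by rewrite evalF1M mulf_neq0.
by move=> q; rewrite evalF1M mulf_eq0 => /norP[/h ? /h'].
Qed.

Lemma near_pt_neq0 p a b B : bihomog a b B -> evalF1 B p != 0 ->
  near_pt p (fun q => evalF1 B q != 0).
Proof. by move=> hB Bp; exists a, b, B. Qed.

Lemma near_ptT p (P : F1 K -> Prop) : (forall q, P q) -> near_pt p P.
Proof.
move=> h; exists 0%N, 0, 1; split=> //; first exact: bihomog1.
by rewrite evalF1_1 oner_eq0.
Qed.

Lemma morphism_continuous phi p P : F1_morphism phi ->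
  near_pt (phi p) P -> near_pt p (P \o phi).
Proof.
move=> mphi nP; pose f q : K := if `[< P q >] then 1 else 0.
have /(mphi p)[a [b [A [B [hA hB Bp nf]]]]] : regular_at (phi p) f.
  exists 0%N, 0, 1, 1; split; rewrite ?evalF1_1 ?oner_eq0 //; try exact: bihomog1.
  by apply: near_ptS nP => q Pq; rewrite evalF1_1 divr1 /f asboolT.
have Ap : evalF1 A p != 0.
  have := near_pt_refl nf; rewrite /= /f asboolT; last exact: (near_pt_refl nP).
  by apply: contra_eq_neq => ->; rewrite mul0r oner_eq0.
have := near_ptI nf (near_ptI (near_pt_neq0 hA Ap) (near_pt_neq0 hB Bp)).
apply: near_ptS => q [fq [Aq Bq]]; apply: contrapT => nPq.
move: fq; rewrite /= /f asboolF // => /esym/eqP; apply/negP.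
by rewrite mulf_neq0 ?invr_eq0.
Qed.

(** The regular function P / Q is pulled back and denominators are cleared, which gives a relation
    between homogeneous coordinates in the shape that [glue] expects. *)
Lemma local_ratio phi p a b P Q : F1_morphism phi -> bihomog a b P -> bihomog a b Q ->
  evalF1 Q (phi p) != 0 -> exists a' b' A B, [/\ bihomog a' b' A, bihomog a' b' B,
    evalF1 B p != 0 & near_pt p (fun q => evalF1 Q (phi q) != 0 /\
      evalF1 P (phi q) * evalF1 B q = evalF1 Q (phi q) * evalF1 A q)].
Proof.
move=> mphi hP hQ Qp.
have /(mphi p)[a' [b' [A [B [hA hB Bp nf]]]]] :
    regular_at (phi p) (fun q => evalF1 P q / evalF1 Q q).
  by exists a, b, P, Q; split=> //; exact: near_ptT.
exists a', b', A, B; split=> //.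
have := near_ptI nf (near_ptI (near_pt_neq0 hB Bp)
  (morphism_continuous mphi (near_pt_neq0 hQ Qp))).
apply: near_ptS => q [/= fq [Bq Qq]]; split=> //.
by rewrite [RHS]mulrC; apply/eqP; rewrite -eqr_div // fq.
Qed.

Lemma cross_proportional (x1 x2 y1 y2 : K) : (x1 != 0) || (x2 != 0) ->
  (y1 != 0) || (y2 != 0) -> x1 * y2 = x2 * y1 ->
  exists k, [/\ k != 0, y1 = k * x1 & y2 = k * x2].
Proof.
have [->|x10 _ y0 e] := eqVneq x1 0 => /=.
  move=> x20 /[swap]; rewrite mul0r => /esym/eqP; rewrite mulf_eq0 (negbTE x20) => /eqP ->.
  rewrite eqxx /= => y20; exists (y2 / x2); rewrite mulr0 divfK //.
  by split=> //; rewrite mulf_neq0 ?invr_eq0.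
have y10 : y1 != 0.
  apply: contraTneq y0 => y10; move: e; rewrite y10 mulr0 eqxx => /eqP.
  by rewrite mulf_eq0 (negbTE x10) /= => ->.
exists (y1 / x1); rewrite divfK //; split=> //; first by rewrite mulf_neq0 ?invr_eq0.
by apply: (mulfI x10); rewrite e; field.
Qed.

(* Local homogeneous coordinates of the map [h1 : h2] to P^1 are patched by
   passing to lowest terms: two coprime representations differ by a unit. *)
Lemma glue (da : nat) (db : int) (h1 h2 : F1 K -> K) :
  (forall p, (h1 p != 0) || (h2 p != 0)) -> (exists p, h1 p != 0) ->
  (forall p, exists a b A B, [/\ bihomog a b A, bihomog (a + da)%N (b + db) B,
     (evalF1 A p != 0) || (evalF1 B p != 0) &
     near_pt p (fun q => h1 q * evalF1 B q = h2 q * evalF1 A q)]) ->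
  exists a b U Z, [/\ bihomog a b U, bihomog (a + da)%N (b + db) Z &
    forall p, exists k, [/\ k != 0, evalF1 U p = k * h1 p & evalF1 Z p = k * h2 p]].
Proof.
move=> h0 [p0 h1p0] loc.
have [a0 [b0 [A0 [B0 [hA0 hB0 AB0 [x0 [y0 [C0 [hC0 Cp0 nC0]]]]]]]]] := loc p0.
have A0n0 : A0 != 0.
  apply: contraTneq AB0 => A00; move: (nC0 _ Cp0).
  rewrite A00 /evalF1 meval0 mulr0 eqxx /= => /eqP.
  by rewrite mulf_eq0 (negbTE h1p0) /= => ->.
have C0n0 : C0 != 0.
  by apply: contraNneq Cp0 => ->; rewrite /evalF1 meval0.
have [g [U [Z [eA eB cUZ]]]] := lowest_terms B0 (@mpoly_prods_of_primes K 4) A0n0.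
have [g0 U0] : g != 0 /\ U != 0.
  by move: A0n0; rewrite eA mulf_eq0 => /norP[].
have [a [b hU]] : exists a b, bihomog a b U.
  by apply: (@bihomog_factor a0 b0 U g); rewrite mulrC -eA.
have [ag [bg hg]] : exists a b, bihomog a b g.
  by apply: (@bihomog_factor a0 b0 g U); rewrite -eA.
have hZ : bihomog (a + da)%N (b + db) Z.
  have [->|Z0] := eqVneq Z 0; first exact: bihomog0.
  have B00 : B0 != 0 by rewrite eB mulf_neq0.
  have [az [bz hz]] : exists a b, bihomog a b Z.
    by apply: (@bihomog_factor (a0 + da) (b0 + db) Z g); rewrite mulrC -eB.
  have := bihomog_inj A0n0 hA0; rewrite eA => /(_ _ _ (bihomogM hg hU))[e1 e2].
  have := bihomog_inj B00 hB0; rewrite eB => /(_ _ _ (bihomogM hg hz))[e3 e4].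
  have -> : (a + da)%N = az by move: e1 e3; clear; lia.
  by have -> : b + db = bz by move: e2 e4; clear; lia.
exists a, b, U, Z; split=> // p.
have [x [y [A [B [hA hB AB [x1 [y1 [C [hC Cp nC]]]]]]]]] := loc p.
have Cn0 : C != 0 by apply: contraNneq Cp => ->; rewrite /evalF1 meval0.
(* Both local representations give the ratio of [h1] and [h2] on a common dense open set, so their
   cross product vanishes identically. *)
have e : A0 * B - A * B0 = 0.
  apply: (@bihomog_eq0 (a0 + (x + da)) (b0 + (y + db)) _ _ _ (C0 * C)).
  - apply: bihomogB; first exact: bihomogM.
    rewrite addnCA addrCA; exact: bihomogM.
  - exact: bihomogM hC0 hC.
  - exact: mulf_neq0.
  move=> q; rewrite evalF1M mulf_eq0 => /norP[/nC0 n0 /nC n1].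
  rewrite evalF1B !evalF1M; case/orP: (h0 q) => hq.
    apply: (mulfI hq); rewrite mulr0.
    transitivity (evalF1 A0 q * (h1 q * evalF1 B q) - evalF1 A q * (h1 q * evalF1 B0 q)).
      by ring.
    by rewrite n0 n1; ring.
  apply: (mulfI hq); rewrite mulr0.
  transitivity (evalF1 B q * (h2 q * evalF1 A0 q) - evalF1 B0 q * (h2 q * evalF1 A q)).
    by ring.
  by rewrite -n0 -n1; ring.
(* By coprimality the representation at [p] is [E] times the pair [U], [Z]. One of its entries is
   nonzero at [p], hence so is [E], and it can be cancelled. *)
have [E eE] : rdvd U A.
  apply: cUZ; exists B; apply: (mulfI g0); move/eqP: e; rewrite subr_eq0 eA eB => /eqP e.
  by rewrite [RHS]mulrA e; ring.
have eZ : B = Z * E.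
  apply: (mulfI U0); apply: (mulfI g0); move/eqP: e; rewrite subr_eq0 eA eB eE => /eqP e.
  by rewrite mulrA e; ring.
have Ep : evalF1 E p != 0.
  by apply: contraTneq AB; rewrite eE eZ !evalF1M => ->; rewrite !mulr0 eqxx.
apply: cross_proportional => //.
  by move: AB; rewrite eE eZ !evalF1M !mulf_eq0 (negbTE Ep) !orbF.
by apply: (mulIf Ep); move: (nC _ Cp); rewrite eE eZ !evalF1M !mulrA.
Qed.

End Bihomogeneous.

(** * Lifting morphisms to homogeneous coordinates *)

Section Automorphisms.
Variable K : closedFieldType.
Implicit Types (A B C : {mpoly K[4]}) (p q : F1 K).

Definition mkv (R : Type) (s t u z : R) : 'I_4 -> R := fun i => nth z [:: s; t; u] i.

Lemma exists_pt (s t u z : K) : (s != 0) || (t != 0) -> (u != 0) || (z != 0) ->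
  exists p l m, [/\ l != 0, m != 0 & pt p = torus l m (finfun (mkv s t u z))].
Proof. by move=> st uz; apply: semistable_vs; rewrite /semistable !ffunE /mkv /= st uz. Qed.

(** The entry at [vz] carries the sum of the two bidegrees because z, s u and t u are sections of
    the same bundle L_{1,0}. The torus element may depend on the point. *)
Definition is_lift (phi : F1 K -> F1 K) (a1 : nat) (b1 : int) (a2 : nat) (b2 : int)
    (Phi : 4.-tuple {mpoly K[4]}) : Prop :=
  [/\ bihomog a1 b1 (tnth Phi vs), bihomog a1 b1 (tnth Phi vt),
      bihomog a2 b2 (tnth Phi vu), bihomog (a2 + a1)%N (b2 + b1) (tnth Phi vz) &
      forall p, exists l m, [/\ l != 0, m != 0 &
        forall i, evalF1 (tnth Phi i) p = torus l m (pt (phi p)) i]].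

(** The base coordinates [s : t] are glued with equal bidegrees; then the fibre coordinates are
    glued from the ratios of z to s u and t u, with the bidegree of the base coordinates as
    shift. *)
Lemma cox_lift (phi psi : F1 K -> F1 K) : F1_morphism phi -> cancel psi phi ->
  exists a1 b1 a2 b2 Phi, is_lift phi a1 b1 a2 b2 Phi.
Proof.
move=> mphi psiK.
have surj q : exists p, phi p = q by exists (psi q).
have [|||a1 [b1 [S [T [hS hT hST]]]]] := @glue K 0 0 (fun p => pt (phi p) vs) (fun p => pt (phi p) vt).
- by move=> p; exact: pt_st.
(* Surjectivity of [phi] provides a point whose image has nonzero s, as [glue] requires. *)
- have [|//|q [l [m [l0 m0 e]]]] := @exists_pt 1 0 1 0; rewrite ?oner_eq0 //.
  have [p ep] := surj q; exists p; rewrite ep e !ffunE /= mulr1.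
  exact: l0.
- move=> p; case/orP: (pt_st (phi p)) => n0.
  + have [|a [b [A [B [hA hB Bp nAB]]]]] := local_ratio mphi (@bihomog_vt K) (@bihomog_vs K) (p := p).
      by rewrite evalF1X.
    exists a, b, B, A; rewrite addn0 addr0; split; rewrite ?Bp //.
    by apply: near_ptS nAB => q; rewrite !evalF1X => -[_ ->].
  + have [|a [b [A [B [hA hB Bp nAB]]]]] := local_ratio mphi (@bihomog_vs K) (@bihomog_vt K) (p := p).
      by rewrite evalF1X.
    exists a, b, A, B; rewrite addn0 addr0; split; rewrite ?Bp ?orbT //.
    by apply: near_ptS nAB => q; rewrite !evalF1X => -[_ ->].
rewrite addn0 addr0 in hT; move: hST => /choice[lam hlam].
(* The choice of [S] and [T] fixes [l = lam p] in the torus element. As u has weight [l^-1 * m], it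
   is divided by [lam p], and only the common factor [m] is left to find. *)
have [|||a2 [b2 [U [Z [hU hZ hUZ]]]]] := @glue K a1 b1 (fun p => pt (phi p) vu / lam p) (fun p => pt (phi p) vz).
- move=> p; have [l0 _ _] := hlam p.
  by rewrite mulf_eq0 invr_eq0 (negbTE l0) orbF pt_uz.
- have [|//|q [l [m [l0 m0 e]]]] := @exists_pt 1 0 1 0; rewrite ?oner_eq0 //.
  have [p ep] := surj q; have [lp _ _] := hlam p; exists p.
  by rewrite ep e !ffunE /= mulr1 !mulf_neq0 ?invr_eq0.
- have hsu := bihomogM (@bihomog_vs K) (@bihomog_vu K).
  have htu := bihomogM (@bihomog_vt K) (@bihomog_vu K).
  have hz := @bihomog_vz K.
  move=> p; have [lp Sp Tp] := hlam p.
  case/orP: (pt_st (phi p)) => st0; case/orP: (pt_uz (phi p)) => uz0.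
  + have [|a [b [A [B [hA hB Bp nAB]]]]] := local_ratio mphi hz hsu (p := p).
      by rewrite evalF1M !evalF1X mulf_neq0.
    exists a, b, B, (A * S); split=> //; [exact: bihomogM|by rewrite Bp|].
    apply: near_ptS nAB => q; rewrite !evalF1M !evalF1X => -[_ ->].
    have [lq -> _] := hlam q; by field.
  + have [|a [b [A [B [hA hB Bp nAB]]]]] := local_ratio mphi hsu hz (p := p).
      by rewrite evalF1X.
    exists a, b, A, (B * S); split=> //; [exact: bihomogM| |].
      by rewrite evalF1M Sp !mulf_neq0 ?orbT.
    apply: near_ptS nAB => q; rewrite !evalF1M !evalF1X => -[_ <-].
    have [lq -> _] := hlam q; by field.
  + have [|a [b [A [B [hA hB Bp nAB]]]]] := local_ratio mphi hz htu (p := p).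
      by rewrite evalF1M !evalF1X mulf_neq0.
    exists a, b, B, (A * T); split=> //; [exact: bihomogM|by rewrite Bp|].
    apply: near_ptS nAB => q; rewrite !evalF1M !evalF1X => -[_ ->].
    have [lq _ ->] := hlam q; by field.
  + have [|a [b [A [B [hA hB Bp nAB]]]]] := local_ratio mphi htu hz (p := p).
      by rewrite evalF1X.
    exists a, b, A, (B * T); split=> //; [exact: bihomogM| |].
      by rewrite evalF1M Tp !mulf_neq0 ?orbT.
    apply: near_ptS nAB => q; rewrite !evalF1M !evalF1X => -[_ <-].
    have [lq _ ->] := hlam q; by field.
exists a1, b1, a2, b2, [tuple S; T; U; Z]; split=> // p.
have [l0 Sp Tp] := hlam p; have [m [m0 Up Zp]] := hUZ p.
exists (lam p), m; split=> // i.
by case: (ord4E i) => ->; rewrite ffunE /= ?Sp ?Tp ?Up ?Zp //; field.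
Qed.

Lemma poly_eq_horner (f g : {poly K}) : (forall y, y != 0 -> f.[y] = g.[y]) -> f = g.
Proof.
move=> h; apply/eqP; rewrite -subr_eq0; apply/negP => /negP fg.
have /closed_nonrootP[y] : (f - g) * 'X != 0 by rewrite mulf_neq0 ?polyX_eq0.
rewrite /root hornerM hornerX mulf_eq0 => /norP[+ /h e].
by rewrite hornerD hornerN e subrr eqxx.
Qed.

Definition along (w : 'I_4 -> {poly K}) (A : {mpoly K[4]}) : {poly K} := mmap polyC w A.

Lemma horner_along w A y : (along w A).[y] = A.@[fun i => (w i).[y]].
Proof.
rewrite /along /mmap horner_sum mevalE; apply: eq_bigr => m _.
rewrite hornerCM /mmap1 horner_prod; congr (_ * _).
by apply: eq_bigr => i _; rewrite horner_exp.
Qed.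

(* A form on P^1 without zeros has degree 0; applied to a fibre and to the
   exceptional curve. *)
Lemma nowhere_zero_const a b A : bihomog a b A -> (forall p, evalF1 A p != 0) ->
  exists c, [/\ c != 0, A = c%:MP, a = 0%N & b = 0].
Proof.
move=> hA A0.
have {}A0 s t u z : (s != 0) || (t != 0) -> (u != 0) || (z != 0) -> A.@[mkv s t u z] != 0.
  move=> st uz; have [p [l [m [l0 m0 e]]]] := exists_pt st uz.
  have := A0 p; rewrite evalF1E e (bihomog_torus _ _ l0 hA) !mulf_eq0 => /norP[_].
  by rewrite (_ : A.@[_] = A.@[mkv s t u z]) //; apply: meval_eq => i; rewrite ffunE.
have scale l m s t u z : l != 0 ->
    A.@[mkv (l * s) (l * t) (l^-1 * m * u) (m * z)] = m ^+ a * l ^ b * A.@[mkv s t u z].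
  move=> l0; rewrite -(_ : A.@[finfun (mkv s t u z)] = A.@[mkv s t u z]); last first.
    by apply: meval_eq => i; rewrite ffunE.
  rewrite -(bihomog_torus _ _ l0 hA); apply: meval_eq => i.
  by case: (ord4E i) => ->; rewrite !ffunE /=.
have const w : (forall y, (along w A).[y] != 0) -> exists2 c, c != 0 & along w A = c%:P.
  move=> h; have /size_poly1P[c c0 e] : size (along w A) == 1%N; last by exists c.
  apply/negPn/negP => /closed_rootP[y /rootP] y0.
  by have := h y; rewrite y0 eqxx.
have a0 : a = 0%N.
  (* On the fibre t = 0, [A] is a constant c in the chart u = 1, hence c X^a in the chart z = 1. It
     does not vanish at u = 0, so a = 0. *)
  have [|c c0 e] := const (mkv 1%:P 0%:P 1%:P 'X).
    move=> y; rewrite horner_along (_ : A.@[_] = A.@[mkv 1 0 1 y]) ?A0 ?oner_eq0 //.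
    by apply: meval_eq => i; case: (ord4E i) => -> /=; rewrite ?hornerX ?hornerC.
  have e' : along (mkv 1%:P 0%:P 'X 1%:P) A = c *: 'X^a.
    apply: poly_eq_horner => y y0; rewrite hornerZ hornerXn mulrC.
    have <- : (along (mkv 1%:P 0%:P 1%:P 'X) A).[y^-1] = c by rewrite e hornerC.
    rewrite !horner_along; have := scale 1 y 1 0 1 y^-1 (oner_neq0 _).
    rewrite invr1 !mul1r !mulr1 mulfV // exp1rz mulr1 => e'.
    transitivity A.@[mkv 1 0 y 1].
      by apply: meval_eq => i; case: (ord4E i) => -> /=; rewrite ?hornerX ?hornerC.
    rewrite e'; congr (_ * _).
    by apply: meval_eq => i; case: (ord4E i) => -> /=; rewrite ?hornerX ?hornerC.
  have := A0 1 0 0 1; rewrite oner_eq0 orbT => /(_ isT isT).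
  rewrite (_ : A.@[_] = (along (mkv 1%:P 0%:P 'X 1%:P) A).[0]); last first.
    rewrite horner_along.
    by apply: meval_eq => i; case: (ord4E i) => -> /=; rewrite ?hornerX ?hornerC.
  by rewrite e' hornerZ hornerXn expr0n; case: (a) => // n; rewrite mulr0 eqxx.
have An0 : A != 0.
  by apply: contraNneq (A0 1 0 0 1 _ _) => [->||]; rewrite ?meval0 ?oner_eq0 ?orbT.
subst a; have [n /esym hn] := bihomog_ge0 An0 hA; rewrite add0r in hn; subst b.
have n0 : n = 0%N.
  (* The same on the exceptional curve u = 0, with the charts s = 1 and t = 1 and the transition
     factor X^n. *)
  have [|c c0 e] := const (mkv 1%:P 'X 0%:P 1%:P).
    move=> y; rewrite horner_along (_ : A.@[_] = A.@[mkv 1 y 0 1]) ?A0 ?oner_eq0 ?orbT //.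
    by apply: meval_eq => i; case: (ord4E i) => -> /=; rewrite ?hornerX ?hornerC.
  have e' : along (mkv 'X 1%:P 0%:P 1%:P) A = c *: 'X^n.
    apply: poly_eq_horner => y y0; rewrite hornerZ hornerXn mulrC.
    have <- : (along (mkv 1%:P 'X 0%:P 1%:P) A).[y^-1] = c by rewrite e hornerC.
    rewrite !horner_along; have := scale y 1 1 y^-1 0 1 y0.
    rewrite !mulr0 !mulr1 mulfV // expr1n mul1r -exprnP => e'.
    transitivity A.@[mkv y 1 0 1].
      by apply: meval_eq => i; case: (ord4E i) => -> /=; rewrite ?hornerX ?hornerC.
    rewrite e'; congr (_ * _).
    by apply: meval_eq => i; case: (ord4E i) => -> /=; rewrite ?hornerX ?hornerC.
  have := A0 0 1 0 1; rewrite oner_eq0 orbT => /(_ isT isT).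
  rewrite (_ : A.@[_] = (along (mkv 'X 1%:P 0%:P 1%:P) A).[0]); last first.
    rewrite horner_along.
    by apply: meval_eq => i; case: (ord4E i) => -> /=; rewrite ?hornerX ?hornerC.
  by rewrite e' hornerZ hornerXn expr0n; case: (n) => // k; rewrite mulr0 eqxx.
subst n; exists A@_0.
have eA : A = (A@_0)%:MP.
  apply/mpolyP => m; rewrite mcoeffC; have [<-|m0] := eqVneq 0%MM m; first by rewrite mulr1.
  rewrite mulr0; apply: memN_msupp_eq0; apply: contra_neqN m0 => /hA.
  rewrite /bidegree => hm; apply/mnmP => i; rewrite mnm0E.
  by case: (ord4E i) => ->; lia.
split=> //; apply: contra_neq An0 => e; by rewrite eA e mpolyC0.
Qed.

End Automorphisms.

(** * Degrees of a lift and of its inverse *)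

Section Classification.
Variable K : closedFieldType.
Implicit Types (A B C : {mpoly K[4]}) (p q : F1 K).

(** A monomial has [n = a + b] factors among s, t, z and [a] factors among u, z. Since the image of
    z has the sum of the two bidegrees, z counts in both, and all monomials receive the same
    bidegree. *)
Lemma bihomog_comp a1 b1 a2 b2 (Phi : 4.-tuple {mpoly K[4]}) a b (n : nat) A :
  bihomog a1 b1 (tnth Phi vs) -> bihomog a1 b1 (tnth Phi vt) ->
  bihomog a2 b2 (tnth Phi vu) -> bihomog (a2 + a1)%N (b2 + b1) (tnth Phi vz) ->
  bihomog a b A -> n%:Z = a%:Z + b ->
  bihomog (n * a1 + a * a2)%N (n%:Z * b1 + a%:Z * b2) (A \mPo Phi).
Proof.
move=> hS hT hU hZ hA en; rewrite comp_mpolyEX; apply: bihomog_sum => m /hA hm.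
apply: bihomogZ; rewrite comp_mpolyX big_ord4.
have := bihomogM (bihomogM (bihomogM (bihomogXn (n := m vs) hS) (bihomogXn (n := m vt) hT))
  (bihomogXn (n := m vu) hU)) (bihomogXn (n := m vz) hZ).
have ea : a = (m vu + m vz)%N by move: hm; rewrite /bidegree; lia.
have {}en : n = (m vs + m vt + m vz)%N by move: hm en; rewrite /bidegree; lia.
rewrite ea en !PoszD; congr bihomog; ring.
Qed.

Lemma var_coprime (i j : 'I_4) A B : i != j -> 'X_i * A = 'X_j * B ->
  exists C, A = 'X_j * C /\ B = 'X_i * C.
Proof.
move=> ij e; suff [C eC] : exists C, A = 'X_j * C.
  exists C; split=> //.
  have Xj : 'X_j != 0 :> {mpoly K[4]} by rewrite -msize_poly_eq0 msizeX.
  by apply: (mulfI Xj); rewrite -e eC mulrCA.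
exists (\sum_(m <- msupp A) A@_m *: 'X_[(m - U_(j))%MM]).
rewrite {1}[A]mpolyE mulr_sumr; apply: eq_big_seq => m mA.
rewrite -scalerAr -mpolyXD addmC submK // lep1mP.
have : (U_(i) + m)%MM \in msupp (B * 'X_j).
  by rewrite mulrC -e mulrC (perm_mem (msuppMX A U_(i))) map_f.
rewrite (perm_mem (msuppMX B U_(j))) => /mapP[m' _ /(congr1 (fun m : 'X_{1..4} => m j))].
by rewrite !mnmDE !mnm1E eqxx (negbTE ij) add0n => ->.
Qed.

Lemma pt_neq0 (i : 'I_4) : exists p, pt p i != 0.
Proof.
have [||p [l [m [l0 m0 e]]]] := @exists_pt K 1 1 1 1; rewrite ?oner_eq0 //.
exists p; rewrite e !ffunE.
by case: (ord4E i) => -> /=; rewrite mulr1 ?mulf_neq0 ?invr_eq0.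
Qed.

(** The composed lift represents the identity, so its base coordinates are (s h, t h) and, up to the
    constant value of h, its fibre coordinates are (u k, z k). Both h and k vanish nowhere, hence
    are constants, and the composed bidegrees are those of s and u. *)
Lemma lift_comp phi psi a1 b1 a2 b2 (Phi : 4.-tuple {mpoly K[4]})
    a1' b1' a2' b2' (Psi : 4.-tuple {mpoly K[4]}) :
  is_lift phi a1 b1 a2 b2 Phi -> is_lift psi a1' b1' a2' b2' Psi -> cancel phi psi ->
  exists n1 n2 : nat, [/\ n1%:Z = a1'%:Z + b1', n2%:Z = a2'%:Z + b2',
    (n1 * a1 + a1' * a2)%N = 0%N /\ n1%:Z * b1 + a1'%:Z * b2 = 1 &
    (n2 * a1 + a2' * a2)%N = 1%N /\ n2%:Z * b1 + a2'%:Z * b2 = -1].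
Proof.
move=> [hS hT hU hZ liftPhi] [hS' hT' hU' hZ' liftPsi] phiK.
have cmp p : exists l m, [/\ l != 0, m != 0 &
    forall i, evalF1 (tnth Psi i \mPo Phi) p = torus l m (pt p) i].
  have [l' [m' [l'0 m'0 ePhi]]] := liftPhi p.
  have [l [m [l0 m0 ePsi]]] := liftPsi (phi p).
  exists (m' ^+ a1' * l' ^ b1' * l), (m' ^+ (a2' + a1') * l' ^ (b2' + b1') * m).
  split; rewrite ?mulf_neq0 ?expf_neq0 ?expfz_neq0 // => i.
  rewrite evalF1E comp_mpoly_meval.
  rewrite (_ : _.@[_] = (tnth Psi i).@[torus l' m' (pt (phi p))]); last first.
    by apply: meval_eq => j; rewrite -ePhi.
  have {}ePsi := ePsi i; rewrite evalF1E phiK in ePsi.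
  have l'b1 : l' ^ b1' != 0 by rewrite expfz_neq0.
  have m'a1 : m' ^+ a1' != 0 by rewrite expf_neq0.
  case: (ord4E i) ePsi => -> ePsi.
  - by rewrite (bihomog_torus _ _ l'0 hS') ePsi !ffunE /=; ring.
  - by rewrite (bihomog_torus _ _ l'0 hT') ePsi !ffunE /=; ring.
  - rewrite (bihomog_torus _ _ l'0 hU') ePsi !ffunE /= exprD expfzDr //; field.
    by rewrite l0 m'a1 l'b1.
  - by rewrite (bihomog_torus _ _ l'0 hZ') ePsi !ffunE /=; ring.
have cmp0 i : tnth Psi i \mPo Phi != 0.
  have [p pi] := pt_neq0 i; have [l [m [l0 m0 e]]] := cmp p.
  apply/eqP => e0; have := e i; rewrite e0 /evalF1 meval0 => /esym/eqP; apply/negP.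
  by case: (ord4E i) pi => -> pi; rewrite ffunE /= !mulf_eq0 ?invr_eq0 !negb_or ?l0 ?m0 pi.
have Psi0 i : tnth Psi i != 0 by apply: contraNneq (cmp0 i) => ->; rewrite comp_mpoly0.
have [n1 en1] := bihomog_ge0 (Psi0 vs) hS'.
have [n2 en2] := bihomog_ge0 (Psi0 vu) hU'.
have hSS := bihomog_comp hS hT hU hZ hS' en1.
have hTT := bihomog_comp hS hT hU hZ hT' en1.
have hUU := bihomog_comp hS hT hU hZ hU' en2.
have en3 : (n2 + n1)%:Z = (a2' + a1')%:Z + (b2' + b1') by lia.
have hZZ := bihomog_comp hS hT hU hZ hZ' en3.
have e1 : 'X_vt * (tnth Psi vs \mPo Phi) - 'X_vs * (tnth Psi vt \mPo Phi) = 0.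
  apply: (@bihomog_eq0 K _ _ 0 0 _ 1); rewrite ?oner_eq0 //.
  - exact: bihomogB (bihomogM (@bihomog_vt K) hSS) (bihomogM (@bihomog_vs K) hTT).
  - exact: bihomog1.
  move=> p _; have [l [m [l0 m0 e]]] := cmp p.
  by rewrite evalF1B !evalF1M !evalF1X !e !ffunE /=; ring.
have [//|h [eS eT]] := var_coprime _ (subr0_eq e1).
have [ah [bh hh]] : exists a b, bihomog a b h.
  move: hSS (cmp0 vs); rewrite eS [_ * h]mulrC => hSS hSS0; exact: bihomog_factor hSS0 hSS.
have hnz p : evalF1 h p != 0 /\ forall l m,
    (forall i, evalF1 (tnth Psi i \mPo Phi) p = torus l m (pt p) i) -> evalF1 h p = l.
  have [l [m [l0 m0 e]]] := cmp p.
  have hl l1 m1 : (forall i, evalF1 (tnth Psi i \mPo Phi) p = torus l1 m1 (pt p) i) ->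
      evalF1 h p = l1.
    move=> e1'; case/orP: (pt_st p) => n0; apply: (mulIf n0).
      by have := e1' vs; rewrite eS evalF1M evalF1X ffunE mulrC.
    by have := e1' vt; rewrite eT evalF1M evalF1X ffunE mulrC.
  by split=> //; rewrite (hl _ _ e).
have [c [c0 eh ah0 bh0]] := nowhere_zero_const hh (fun p => (hnz p).1).
have [dS1 dS2] : (n1 * a1 + a1' * a2)%N = 0%N /\ n1%:Z * b1 + a1'%:Z * b2 = 1.
  have := bihomog_inj (cmp0 vs) hSS; rewrite eS eh [_ * _%:MP]mulrC mul_mpolyC.
  by move=> /(_ _ _ (bihomogZ (k := c) (@bihomog_vs K))).
have e2 : 'X_vz * (c *: (tnth Psi vu \mPo Phi)) - 'X_vu * (tnth Psi vz \mPo Phi) = 0.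
  apply: (@bihomog_eq0 K (n2 * a1 + a2' * a2 + 1) (n2%:Z * b1 + a2'%:Z * b2) 0 0 _ 1);
    rewrite ?oner_eq0 //.
  - apply: bihomogB.
      rewrite addnC -[X in bihomog _ X]add0r.
      by apply: bihomogM; [exact: bihomog_vz|apply: bihomogZ].
    have := bihomogM (@bihomog_vu K) hZZ; congr bihomog; [lia|].
    rewrite !PoszD; lia.
  - exact: bihomog1.
  move=> p _; have [l [m [l0 m0 e]]] := cmp p.
  rewrite evalF1B !evalF1M !evalF1X {1}/evalF1 mevalZ -/(evalF1 _ p) !e !ffunE /=.
  have := (hnz p).2 _ _ e; rewrite eh evalF1E mevalC => ->.
  by field.
have [//|k [eU eZ]] := var_coprime _ (subr0_eq e2).
have cU0 : c *: (tnth Psi vu \mPo Phi) != 0 by rewrite scaler_eq0 negb_or c0 cmp0.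
have [ak [bk hk]] : exists a b, bihomog a b k.
  move: (bihomogZ (k := c) hUU) cU0; rewrite eU [_ * k]mulrC => hk hk0; exact: bihomog_factor hk0 hk.
have knz p : evalF1 k p != 0.
  have [l [m [l0 m0 e]]] := cmp p.
  have := (hnz p).2 _ _ e; rewrite eh evalF1E mevalC => ec.
  suff -> : evalF1 k p = m by [].
  case/orP: (pt_uz p) => n0; apply: (mulIf n0).
    have : evalF1 (c *: (tnth Psi vu \mPo Phi)) p = evalF1 ('X_vu * k) p by rewrite eU.
    rewrite evalF1M evalF1X {1}/evalF1 mevalZ -/(evalF1 _ p) e ffunE /= ec => ee.
    by rewrite mulrC -ee; field.
  have := e vz; rewrite eZ evalF1M evalF1X ffunE /= => ee.
  by rewrite mulrC ee.
have [d [d0 ek ak0 bk0]] := nowhere_zero_const hk knz.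
exists n1, n2; split=> //.
have := bihomog_inj cU0 (bihomogZ (k := c) hUU); rewrite eU ek [_ * _%:MP]mulrC mul_mpolyC.
by move=> /(_ _ _ (bihomogZ (k := d) (@bihomog_vu K))).
Qed.

Lemma mpoly_supp_list (L : seq 'X_{1..4}) A : uniq L -> {subset msupp A <= L} ->
  A = \sum_(m <- L) A@_m *: 'X_[m].
Proof.
move=> uL sA; apply/mpolyP => m; rewrite raddf_sum /=.
have [mL|mL] := boolP (m \in L).
  rewrite (bigD1_seq m) //= mcoeffZ mcoeffX eqxx mulr1 big1 ?addr0 // => m' m'm.
  by rewrite mcoeffZ mcoeffX (negbTE m'm) mulr0.
rewrite memN_msupp_eq0; last by apply: contra mL => /sA.
rewrite big_seq big1 // => m' m'L; rewrite mcoeffZ mcoeffX.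
by rewrite (_ : m' == m = false) ?mulr0 //; apply: contraNF mL => /eqP <-.
Qed.

Lemma mnm4P (m m' : 'X_{1..4}) : m vs = m' vs -> m vt = m' vt -> m vu = m' vu ->
  m vz = m' vz -> m = m'.
Proof. by move=> *; apply/mnmP => i; case: (ord4E i) => ->. Qed.

Lemma bihomog01E A : bihomog 0 1 A ->
  exists a b, forall v : 'I_4 -> K, A.@[v] = a * v vs + b * v vt.
Proof.
move=> hA; exists A@_U_(vs), A@_U_(vt) => v.
rewrite {1}(@mpoly_supp_list [:: U_(vs); U_(vt)]%MM A).
- by rewrite !big_cons big_nil addr0 mevalD !mevalZ !mevalXU.
- by rewrite /= inE eq_mnm1 andbT.
move=> m /hA; rewrite /bidegree !inE => hm; apply/orP.
case: (eqVneq (m vs) 0%N) => ms.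
  by right; apply/eqP/mnm4P; rewrite mnm1E /=; lia.
by left; apply/eqP/mnm4P; rewrite mnm1E /=; lia.
Qed.

Lemma bihomog1N1E A : bihomog 1 (-1) A ->
  exists a, forall v : 'I_4 -> K, A.@[v] = a * v vu.
Proof.
move=> hA; exists A@_U_(vu) => v.
rewrite {1}(@mpoly_supp_list [:: U_(vu)]%MM A) //.
  by rewrite big_seq1 mevalZ mevalXU.
move=> m /hA; rewrite /bidegree !inE => hm; apply/eqP/mnm4P; rewrite mnm1E /=; lia.
Qed.

Lemma bihomog10E A : bihomog 1 0 A -> exists a b c, forall v : 'I_4 -> K,
  A.@[v] = a * v vz + (b * v vs + c * v vt) * v vu.
Proof.
move=> hA; exists A@_U_(vz), A@_(U_(vs) + U_(vu)), A@_(U_(vt) + U_(vu)) => v.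
rewrite {1}(@mpoly_supp_list [:: U_(vz); U_(vs) + U_(vu); U_(vt) + U_(vu)]%MM A).
- rewrite !big_cons big_nil addr0 !mpolyXD !mevalD !mevalZ !mevalM !mevalXU; ring.
- rewrite /= !inE andbT !negb_or -andbA; apply/and3P; split; apply/eqP.
  + by move/(congr1 (fun m : 'X_{1..4} => m vz)); rewrite mnmDE !mnm1E.
  + by move/(congr1 (fun m : 'X_{1..4} => m vz)); rewrite mnmDE !mnm1E.
  + by move/(congr1 (fun m : 'X_{1..4} => m vs)); rewrite !mnmDE !mnm1E.
move=> m /hA; rewrite /bidegree !inE => hm.
case: (eqVneq (m vz) 0%N) => mz; last first.
  by apply/or3P; constructor 1; apply/eqP/mnm4P; rewrite mnm1E /=; lia.
case: (eqVneq (m vs) 0%N) => ms; apply/or3P; [constructor 3|constructor 2].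
  by apply/eqP/mnm4P; rewrite mnmDE !mnm1E /=; lia.
by apply/eqP/mnm4P; rewrite mnmDE !mnm1E /=; lia.
Qed.

End Classification.

(** * The group of coordinate maps and its action on divisors *)

Section CoxMaps.
Variable K : closedFieldType.
Implicit Types (A B C : {mpoly K[4]}) (p q : F1 K).

(* (s, t, u, z) |-> (c11 s + c12 t, c21 s + c22 t, cu u, cz z + (cs s + ct t) u) *)
Record coxmap := Coxmap
  { c11 : K; c12 : K; c21 : K; c22 : K; cu : K; cz : K; cs : K; ct : K }.

Implicit Type g : coxmap.

Definition cox_ok g : Prop :=
  [/\ c11 g * c22 g - c12 g * c21 g != 0, cu g != 0 & cz g != 0].

Definition coxact g (v : {ffun 'I_4 -> K}) : {ffun 'I_4 -> K} :=
  finfun (mkv (c11 g * v vs + c12 g * v vt) (c21 g * v vs + c22 g * v vt)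
    (cu g * v vu) (cz g * v vz + (cs g * v vs + ct g * v vt) * v vu)).

Definition cox_tuple g : 4.-tuple {mpoly K[4]} :=
  [tuple c11 g *: 'X_vs + c12 g *: 'X_vt; c21 g *: 'X_vs + c22 g *: 'X_vt;
    cu g *: 'X_vu; cz g *: 'X_vz + (cs g *: 'X_vs + ct g *: 'X_vt) * 'X_vu].

Lemma comp_cox_tuple g A (v : {ffun 'I_4 -> K}) : (A \mPo cox_tuple g).@[v] = A.@[coxact g v].
Proof.
rewrite comp_mpoly_meval; apply: meval_eq => i; rewrite ffunE.
by case: (ord4E i) => -> /=; rewrite /tnth /= ?mevalD ?mevalM ?mevalD !mevalZ !mevalXU.
Qed.

Lemma bihomog_cox_tuple g a b A : bihomog a b A -> bihomog a b (A \mPo cox_tuple g).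
Proof.
move=> hA; have [->|A0] := eqVneq A 0; first by rewrite comp_mpoly0; exact: bihomog0.
have [n en] := bihomog_ge0 A0 hA.
have h1 (x y : K) : bihomog 0 1 (x *: 'X_vs + y *: 'X_vt : {mpoly K[4]}).
  by apply: bihomogD; apply: bihomogZ; [exact: bihomog_vs|exact: bihomog_vt].
have := @bihomog_comp K 0 1 1 (-1) (cox_tuple g) a b n A (h1 _ _) (h1 _ _) _ _ hA en.
have -> : (n * 0 + a * 1)%N = a by lia.
have -> : n%:Z * 1 + a%:Z * -1 = b by lia.
apply; first by apply: bihomogZ; exact: bihomog_vu.
apply: bihomogD; first by apply: bihomogZ; exact: bihomog_vz.
exact: bihomogM (h1 _ _) (@bihomog_vu K).
Qed.

Lemma coxact_torus g l m v : l != 0 -> coxact g (torus l m v) = torus l m (coxact g v).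
Proof.
move=> l0; apply/ffunP => i.
by case: (ord4E i) => ->; rewrite !ffunE /mkv /= ?ffunE /=; [ring|ring|ring|field].
Qed.

Definition coxinv g : coxmap :=
  let d := c11 g * c22 g - c12 g * c21 g in
  Coxmap (c22 g / d) (- c12 g / d) (- c21 g / d) (c11 g / d) (cu g)^-1 (cz g)^-1
    (- (cs g * c22 g - ct g * c21 g) / (d * cu g * cz g))
    (- (ct g * c11 g - cs g * c12 g) / (d * cu g * cz g)).

Lemma coxinv_ok g : cox_ok g -> cox_ok (coxinv g).
Proof.
move=> [d0 u0 z0]; split; rewrite /= ?invr_eq0 //.
set d := c11 g * c22 g - c12 g * c21 g in d0 *.
rewrite (_ : _ - _ = d^-1) ?invr_eq0 //.
by rewrite /d; field.
Qed.

Lemma coxinvK g : cox_ok g -> cancel (coxact g) (coxact (coxinv g)).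
Proof.
move=> [d0 u0 z0] v; apply/ffunP => i.
case: (ord4E i) => ->; rewrite !ffunE /mkv /= ?ffunE /=; field; rewrite ?d0 ?u0 ?z0 //.
Qed.

Lemma coxinvKV g : cox_ok g -> cancel (coxact (coxinv g)) (coxact g).
Proof.
move=> [d0 u0 z0] v; apply/ffunP => i.
case: (ord4E i) => ->; rewrite !ffunE /mkv /= ?ffunE /=; field; rewrite ?d0 ?u0 ?z0 //.
Qed.

Lemma coxact_unstable g v : semistable (coxact g v) -> semistable v.
Proof.
apply: contraTT; rewrite /semistable !negb_and !negb_or !negbK !ffunE /mkv /=.
case/orP => /andP[/eqP -> /eqP ->]; first by rewrite !mulr0 addr0 eqxx.
by rewrite !mulr0 addr0 eqxx orbT.
Qed.

Lemma coxact_semistable g v : cox_ok g -> semistable v -> semistable (coxact g v).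
Proof. by move=> ok sv; apply: (@coxact_unstable (coxinv g)); rewrite coxinvK. Qed.

Lemma evalF1Z (k : K) A p : evalF1 (k *: A) p = k * evalF1 A p.
Proof. exact: mevalZ. Qed.

Definition covers g (phi : F1 K -> F1 K) : Prop :=
  forall p, exists l m, [/\ l != 0, m != 0 & pt (phi p) = torus l m (coxact g (pt p))].

Lemma covers_evalF1 g phi a b A p : covers g phi -> bihomog a b A ->
  (evalF1 A (phi p) != 0) = (evalF1 (A \mPo cox_tuple g) p != 0).
Proof.
move=> cov hA; have [l [m [l0 m0 e]]] := cov p.
rewrite !evalF1E e (bihomog_torus _ _ l0 hA) comp_cox_tuple.
by rewrite !mulf_eq0 !expf_eq0 expfz_eq0 (negbTE l0) (negbTE m0) !andbF.
Qed.

Lemma covers_ratio g phi a b A B p : covers g phi -> bihomog a b A -> bihomog a b B ->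
  evalF1 A (phi p) / evalF1 B (phi p) =
  evalF1 (A \mPo cox_tuple g) p / evalF1 (B \mPo cox_tuple g) p.
Proof.
move=> cov hA hB; have [l [m [l0 m0 e]]] := cov p.
rewrite !evalF1E e (bihomog_torus _ _ l0 hA) (bihomog_torus _ _ l0 hB) !comp_cox_tuple.
rewrite invfM mulrACA mulfV ?mul1r // mulf_neq0 ?expf_neq0 ?expfz_neq0 //.
Qed.

Lemma covers_morphism g phi : covers g phi -> F1_morphism phi.
Proof.
move=> cov p f [a [b [A [B [hA hB Bp [a' [b' [C [hC Cp nf]]]]]]]]].
exists a, b, (A \mPo cox_tuple g), (B \mPo cox_tuple g); split.
- exact: bihomog_cox_tuple.
- exact: bihomog_cox_tuple.
- by rewrite -(covers_evalF1 _ cov hB).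
exists a', b', (C \mPo cox_tuple g); split; first exact: bihomog_cox_tuple.
  by rewrite -(covers_evalF1 _ cov hC).
by move=> q; rewrite -(covers_evalF1 _ cov hC) -(covers_ratio _ cov hA hB) => /nf.
Qed.

Lemma exists_covers g : cox_ok g -> exists phi, covers g phi.
Proof.
move=> ok.
exists (fun p => \pi_(F1 K) (Sub (coxact g (pt p)) (coxact_semistable ok (pt_semistable p)) : cone K)).
by move=> p; have [l [m h]] := pt_pi (Sub (coxact g (pt p)) (coxact_semistable ok (pt_semistable p)) : cone K); exists l, m.
Qed.

Lemma covers_cancel g phi psi : cox_ok g -> covers g phi -> covers (coxinv g) psi ->
  cancel phi psi.
Proof.
move=> ok cphi cpsi p; have [l [m [l0 m0 e]]] := cphi p.
have [l' [m' [l'0 m'0 e']]] := cpsi (phi p).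
apply: (@pi_pt K _ _ (l' * l) (m' * m)); rewrite ?mulf_neq0 //.
by rewrite e' e coxact_torus // coxinvK // torusM.
Qed.

Lemma covers_automorphism g phi : cox_ok g -> covers g phi -> F1_automorphism phi.
Proof.
move=> ok cphi; split; first exact: covers_morphism cphi.
have [psi cpsi] := exists_covers (coxinv_ok ok).
exists psi; split; [exact: covers_morphism cpsi|exact: covers_cancel cphi cpsi|].
apply: (covers_cancel (coxinv_ok ok) cpsi) => p.
have [l [m [l0 m0 e]]] := cphi p; exists l, m; split=> //; rewrite e; congr torus.
by rewrite -{2}[pt p](coxinvK ok) (coxinvK (coxinv_ok ok)).
Qed.

(** Comparison with the inverse fixes the bidegrees of a lift, and the few monomials of these
    bidegrees yield the [coxmap]. It is invertible because a degenerate one would send a semistable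
    vector to an unstable one. *)
Lemma automorphism_covers phi : F1_automorphism phi -> exists2 g, cox_ok g & covers g phi.
Proof.
move=> [mphi [psi [mpsi phiK psiK]]].
have [a1 [b1 [a2 [b2 [Phi lPhi]]]]] := cox_lift mphi psiK.
have [a1' [b1' [a2' [b2' [Psi lPsi]]]]] := cox_lift mpsi phiK.
have [n1 [n2 [en1 en2 _ _]]] := lift_comp lPsi lPhi psiK.
have [n1' [n2' [en1' en2' [e1 e2] [e3 e4]]]] := lift_comp lPhi lPsi phiK.
case: lPhi => hS hT hU hZ lift.
(* If the base coordinates had the bidegree of u, both would be multiples of u and vanish together
   on the exceptional curve. *)
have no_swap : ~ (a1 = 1%N /\ b1 = -1).
  move=> [ea eb]; rewrite ea eb in hS hT.
  have [|//|p [l [m [l0 m0 e]]]] := @exists_pt K 1 0 0 1; rewrite ?oner_eq0 ?orbT //.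
  have [l' [m' [l'0 m'0 e']]] := lift p.
  have [x ex] := bihomog1N1E hS; have [y ey] := bihomog1N1E hT.
  have u0 : pt p vu = 0 by rewrite e !ffunE /= mulr0.
  have := pt_st (phi p); have := e' vs; have := e' vt.
  rewrite !evalF1E ex ey u0 !mulr0 !ffunE /= => /esym/eqP + /esym/eqP.
  by rewrite !mulf_eq0 (negbTE l'0) /= => -> ->.
(* In the weights a and a + b the degrees of the two lifts form nonnegative integer matrices whose
   product is a permutation matrix. Hence both are permutation matrices: the degrees of s and u are
   kept or swapped. *)
have [ea1 eb1 ea2 eb2] : [/\ a1 = 0%N, b1 = 1, a2 = 1%N & b2 = -1].
  have {}e2 : (n1' * n1 + a1' * n2)%N = 1%N.
    apply/eqP; rewrite -eqz_nat PoszD !PoszM en1 en2 !mulrDr addrACA e2.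
    by rewrite -!PoszM -PoszD e1.
  have {}e4 : (n2' * n1 + a2' * n2)%N = 0%N.
    apply/eqP; rewrite -eqz_nat PoszD !PoszM en1 en2 !mulrDr addrACA e4.
    by rewrite -!PoszM -PoszD e3.
  have cases (x y : nat) : (x + y = 1 -> (x = 1 /\ y = 0) \/ (x = 0 /\ y = 1))%N by lia.
  have [[/eqP]|[_ /eqP]] := cases _ _ e2; rewrite muln_eq1 => /andP[/eqP x1 /eqP x2].
    have a10 : a1 = 0%N by rewrite x1 in e1; lia.
    rewrite a10 muln0 add0n in e3; move/eqP: e3; rewrite muln_eq1 => /andP[/eqP y1 /eqP y2].
    by rewrite y1 in e4; split; lia.
  have a20 : a2 = 0%N by rewrite x1 in e1; lia.
  rewrite a20 muln0 addn0 in e3; move/eqP: e3; rewrite muln_eq1 => /andP[/eqP y1 /eqP y2].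
  by rewrite y1 in e4; case: no_swap; split; lia.
subst a1 b1 a2 b2.
have [x11 [x12 eS]] := bihomog01E hS; have [x21 [x22 eT]] := bihomog01E hT.
have [xu eU] := bihomog1N1E hU; have [xz [xs [xt eZ]]] := bihomog10E hZ.
pose g := Coxmap x11 x12 x21 x22 xu xz xs xt.
have {eS eT eU eZ} eg p : finfun (fun i => evalF1 (tnth Phi i) p) = coxact g (pt p).
  apply/ffunP => i; rewrite !ffunE /evalF1.
  by case: (ord4E i) => ->; rewrite ?eS ?eT ?eU ?eZ.
have {}lift p : exists l m, [/\ l != 0, m != 0 & coxact g (pt p) = torus l m (pt (phi p))].
  have [l [m [l0 m0 e]]] := lift p; exists l, m; split=> //; rewrite -eg.
  by apply/ffunP => i; rewrite ffunE e.
have sg p : semistable (coxact g (pt p)).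
  by have [l [m [l0 m0 ->]]] := lift p; rewrite semistable_torus // pt_semistable.
have {}sg v : semistable v -> semistable (coxact g v).
  move=> /semistable_vs[p [l [m [l0 m0 e]]]]; have := sg p.
  by rewrite e coxact_torus // semistable_torus.
exists g; last first.
  move=> p; have [l [m [l0 m0 ->]]] := lift p; exists l^-1, m^-1.
  by rewrite torusM !mulVf // torus1 !invr_eq0.
have {}sg s t u z : (s != 0) || (t != 0) -> (u != 0) || (z != 0) ->
    semistable (coxact g (finfun (mkv s t u z))).
  by move=> st uz; apply: sg; rewrite /semistable !ffunE /mkv /= st uz.
have o1 : (1 : K) != 0 := oner_neq0 _.
have xz0 : xz != 0.
  apply/negP => /eqP z0; have := sg 0 1 0 1; rewrite oner_eq0 orbT => /(_ isT isT).
  by rewrite /semistable !ffunE /mkv /= z0 !mulr0 mul0r addr0 eqxx andbF.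
split=> //; apply/negP => /eqP /= e0.
  have kill s t : x11 * s + x12 * t = 0 -> x21 * s + x22 * t = 0 -> (s != 0) || (t != 0) -> False.
    move=> k1 k2 st; have := sg s t 1 0 st; rewrite oner_eq0 => /(_ isT).
    by rewrite /semistable !ffunE /mkv /= k1 k2 eqxx.
  have [/norP[/negPn/eqP x110 /negPn/eqP x120]|n1n0] := boolP (~~ ((x11 != 0) || (x12 != 0))).
    have [/norP[/negPn/eqP x210 /negPn/eqP x220]|n2n0] := boolP (~~ ((x21 != 0) || (x22 != 0))).
      by apply: (kill 1 0); rewrite ?x110 ?x120 ?x210 ?x220 ?mul0r ?addr0 ?o1.
    apply: (kill x22 (- x21)); rewrite ?x110 ?x120; [ring|ring|].
    by rewrite oppr_eq0 orbC; exact: (negPn n2n0).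
  apply: (kill x12 (- x11)); [ring| |].
    by rewrite mulrN [X in _ - X]mulrC -opprB [x21 * _]mulrC e0 oppr0.
  by rewrite oppr_eq0 orbC; exact: (negPn n1n0).
(* If [cu] vanished, this point of the fibre over [1 : 0] would be sent to u = z = 0. *)
have := sg 1 0 1 (- xs / xz); rewrite oner_eq0 => /(_ isT isT).
rewrite /semistable !ffunE /mkv /= e0 mul0r eqxx /= andbC.
by rewrite mulr1 mulr0 addr0 mulr1 mulrC divfK // addNr eqxx.
Qed.

Lemma sect_bihomog a b (c : 'I_(h0 a b) -> K) : bihomog a b%:Z (sect c).
Proof.
apply: bihomog_sum => i _; apply: bihomogZ; apply: bihomogX.
by rewrite -mem_sect_mons mem_tnth.
Qed.

Lemma sect_neq0 a b (c : 'I_(h0 a b) -> K) : nonzero_vec c -> sect c != 0.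
Proof.
move=> [i ci]; apply: contra_neq ci => /(congr1 (mcoeff (tnth (in_tuple (sect_mons a b)) i))).
rewrite mcoeff0 raddf_sum /= (bigD1 i) //= mcoeffZ mcoeffX eqxx mulr1 big1 ?addr0 // => j ji.
rewrite mcoeffZ mcoeffX (_ : _ == _ = false) ?mulr0 //; apply: contraNF ji => /eqP e.
apply/eqP/val_inj => /=; apply/eqP; rewrite -(nth_uniq 0%MM _ _ (sect_mons_uniq a b)) //.
by move: e; rewrite !(tnth_nth 0%MM) /= => ->.
Qed.

(** Base point freeness of L_{a,b}; it supplies the trivializations with which [is_pullback_div] is
    tested at each point. *)
Lemma exists_section a b p : exists2 G : {mpoly K[4]}, bihomog a b%:Z G & evalF1 G p != 0.
Proof.
have [x hx xp] : exists2 G : {mpoly K[4]}, bihomog 0 1 G & evalF1 G p != 0.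
  by case/orP: (pt_st p) => h; [exists 'X_vs|exists 'X_vt]; rewrite ?evalF1X //;
    [exact: bihomog_vs|exact: bihomog_vt].
case/orP: (pt_uz p) => h.
  exists (x ^+ (a + b) * 'X_vu ^+ a); last first.
    by rewrite evalF1M /evalF1 !rmorphXn /= mevalXU mulf_neq0 ?expf_neq0.
  have := bihomogM (bihomogXn (n := a + b) hx) (bihomogXn (n := a) (@bihomog_vu K)).
  by congr bihomog; lia.
exists (x ^+ b * 'X_vz ^+ a); last first.
  by rewrite evalF1M /evalF1 !rmorphXn /= mevalXU mulf_neq0 ?expf_neq0.
have := bihomogM (bihomogXn (n := b) hx) (bihomogXn (n := a) (@bihomog_vz K)).
by congr bihomog; lia.
Qed.

(** Local equations that agree up to units make the ratio of the substituted [F'] to [F] a unit at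
    every point. In lowest terms neither numerator nor denominator has a zero, so both are
    constants. *)
Lemma covers_pullback g phi a b (F F' : {mpoly K[4]}) : covers g phi ->
  bihomog a b%:Z F -> bihomog a b%:Z F' -> F != 0 ->
  is_pullback_div phi a b F F' <-> exists2 k, k != 0 & F' \mPo cox_tuple g = k *: F.
Proof.
move=> cov hF hF' F0; split=> [pull|[k k0 e] p G G' hG hG' Gp G'p]; last first.
  have G'p' : evalF1 (G' \mPo cox_tuple g) p != 0 by rewrite -(covers_evalF1 _ cov hG').
  exists (fun q => evalF1 (k *: G) q / evalF1 (G' \mPo cox_tuple g) q); split.
  - exists a, b%:Z, (k *: G), (G' \mPo cox_tuple g); split=> //.
    + exact: bihomogZ.
    + exact: bihomog_cox_tuple.
    exact: near_ptT.
  - by rewrite evalF1Z !mulf_neq0 ?invr_eq0.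
  apply: near_ptS (near_pt_neq0 hG Gp) => q Gq.
  rewrite (covers_ratio _ cov hF' hG') e !evalF1Z; set y := (evalF1 (G' \mPo _) q)^-1.
  by field.
set W := F' \mPo _; have hW : bihomog a b%:Z W by exact: bihomog_cox_tuple.
have loc p : exists A B : {mpoly K[4]}, [/\ evalF1 A p != 0, evalF1 B p != 0 & W * B = F * A].
  have [G hG Gp] := exists_section a b p.
  have [G' hG' G'p] := exists_section a b (phi p).
  have [e [[a1 [b1 [A [B [hA hB Bp ne]]]]] ep npull]] := pull p G G' hG hG' Gp G'p.
  have G'p' : evalF1 (G' \mPo cox_tuple g) p != 0 by rewrite -(covers_evalF1 _ cov hG').
  have hG'g := bihomog_cox_tuple (g := g) hG'.
  have Ap : evalF1 A p != 0.
    by apply: contra_neq ep => A0; rewrite (near_pt_refl ne) A0 mul0r.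
  exists (A * (G' \mPo cox_tuple g)), (B * G); split; rewrite ?evalF1M ?mulf_neq0 //.
  have [x [y [C [hC Cp nC]]]] := near_ptI (near_ptI ne npull) (near_ptI (near_pt_neq0 hB Bp)
    (near_ptI (near_pt_neq0 hG Gp) (near_pt_neq0 hG'g G'p'))).
  apply/eqP; rewrite -subr_eq0; apply/eqP.
  apply: (@bihomog_eq0 K (a + (a1 + a)) (b%:Z + (b1 + b%:Z)) x y _ C) => //.
  - by apply: bihomogB; apply: (bihomogM _ (bihomogM _ _)).
  - by apply: contraNneq Cp => ->; rewrite /evalF1 meval0.
  move=> q /nC[[eq eW] [Bq [Gq G'q]]].
  move: eW; rewrite (covers_ratio _ cov hF' hG') eq -/W => eW.
  rewrite evalF1B !evalF1M.
  have -> : evalF1 W q = evalF1 A q / evalF1 B q * (evalF1 F q / evalF1 G q) *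
      evalF1 (G' \mPo cox_tuple g) q by rewrite -eW divfK.
  by field; rewrite Bq Gq.
have W0 : W != 0.
  have [p Fp] := basic_open_nonempty F0 hF; have [A [B [Ap Bp e]]] := loc p.
  apply: contraNneq (mulf_neq0 Fp Ap) => W0; rewrite -evalF1M -e W0 mul0r.
  by rewrite /evalF1 meval0.
have [h [X [Y [eW eF cXY]]]] := lowest_terms F (@mpoly_prods_of_primes K 4) W0.
have h0 : h != 0 by apply: contraNneq W0 => h0; rewrite eW h0 mul0r.
have Y0 : Y != 0 by apply: contraNneq F0 => Y0; rewrite eF Y0 mulr0.
have X0 : X != 0 by apply: contraNneq W0 => X0; rewrite eW X0 mulr0.
have [x1 [y1 hX]] : exists x y, bihomog x y X.
  by move: hW W0; rewrite eW mulrC => hW W0; exact: bihomog_factor W0 hW.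
have [x2 [y2 hY]] : exists x y, bihomog x y Y.
  by move: hF F0; rewrite eF mulrC => hYh Yh0; exact: bihomog_factor Yh0 hYh.
have XYp p : evalF1 X p != 0 /\ evalF1 Y p != 0.
  have [A [B [Ap Bp e]]] := loc p.
  have {}e : X * B = Y * A by apply: (mulfI h0); rewrite !mulrA -eW -eF.
  have [E eA] : rdvd X A by apply: cXY; exists B.
  have eB : B = Y * E by apply: (mulfI X0); rewrite e eA mulrCA.
  move: Ap Bp; rewrite eA eB !evalF1M !mulf_eq0.
  by move=> /norP[-> _] /norP[-> _].
have [k [k0 eX _ _]] := nowhere_zero_const hX (fun p => (XYp p).1).
have [k' [k'0 eY _ _]] := nowhere_zero_const hY (fun p => (XYp p).2).
exists (k / k'); first by rewrite mulf_neq0 ?invr_eq0.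
rewrite eW eF eX eY ![h * _]mulrC !mul_mpolyC scalerA divfK //.
Qed.

Lemma linsys_AutP a b (c c' : 'I_(h0 a b) -> K) : nonzero_vec c ->
  linsys_Aut c c' <-> exists g k, [/\ cox_ok g, k != 0 &
    forall v : {ffun 'I_4 -> K}, (sect c').@[coxact g v] = k * (sect c).@[v]].
Proof.
move=> c0; have cP := covers_pullback _ (@sect_bihomog _ _ c) (@sect_bihomog _ _ c') (sect_neq0 c0).
split=> [[phi [/automorphism_covers[g ok cov] /(cP _ _ cov)[k k0 e]]]|[g [k [ok k0 e]]]].
  by exists g, k; split=> // v; rewrite -comp_cox_tuple e mevalZ.
have [phi cov] := exists_covers ok.
exists phi; split; first exact: covers_automorphism cov.
apply/(cP _ _ cov); exists k => //.
apply: (@mpoly_eq_eval K 4 1); first exact: oner_neq0.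
move=> v _; rewrite (_ : _.@[v] = (sect c' \mPo cox_tuple g).@[finfun v]); last first.
  by apply: meval_eq => i; rewrite ffunE.
rewrite comp_cox_tuple e mevalZ; congr (_ * _).
by apply: meval_eq => i; rewrite ffunE.
Qed.

End CoxMaps.

(** * Rationality of a quotient with a rational slice *)

Section PolynomialFunctions.
Variables (K : closedFieldType) (n : nat).
Implicit Types (f g : ('I_n -> K) -> K).

(** Polynomiality as a property of functions, closed under the usual operations, so that the normal
    form can be given by formulas without writing out its polynomials. *)
Definition polyfun f : Prop := exists P : {mpoly K[n]}, forall v, f v = P.@[v].

Lemma polyfun_const (k : K) : polyfun (fun _ => k).
Proof. by exists k%:MP => v; rewrite mevalC. Qed.

Lemma polyfun_coord i : polyfun (fun v => v i).
Proof. by exists 'X_i => v; rewrite mevalXU. Qed.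

Lemma polyfunD f g : polyfun f -> polyfun g -> polyfun (fun v => f v + g v).
Proof. by move=> [P hP] [Q hQ]; exists (P + Q) => v; rewrite mevalD hP hQ. Qed.

Lemma polyfunN f : polyfun f -> polyfun (fun v => - f v).
Proof. by move=> [P hP]; exists (- P) => v; rewrite mevalN hP. Qed.

Lemma polyfunM f g : polyfun f -> polyfun g -> polyfun (fun v => f v * g v).
Proof. by move=> [P hP] [Q hQ]; exists (P * Q) => v; rewrite mevalM hP hQ. Qed.

Lemma polyfunX f k : polyfun f -> polyfun (fun v => f v ^+ k).
Proof. by move=> [P hP]; exists (P ^+ k) => v; rewrite rmorphXn hP. Qed.

Lemma polyfun_sum (I : Type) (r : seq I) (p : pred I) (F : I -> ('I_n -> K) -> K) :
  (forall i, polyfun (F i)) -> polyfun (fun v => \sum_(i <- r | p i) F i v).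
Proof.
by move=> /choice[P hP]; exists (\sum_(i <- r | p i) P i) => v; rewrite raddf_sum; apply: eq_bigr.
Qed.

Lemma eq_polyfun f g : f =1 g -> polyfun g -> polyfun f.
Proof. by move=> fg [P hP]; exists P => v; rewrite fg hP. Qed.

End PolynomialFunctions.

Lemma polyfun_comp (K : closedFieldType) (n k : nat) (f : ('I_n -> K) -> K)
    (F : ('I_k -> K) -> 'I_n -> K) :
  polyfun f -> (forall i, polyfun (fun v => F v i)) -> polyfun (fun v => f (F v)).
Proof.
move=> [P hP] /choice[Q hQ]; exists (P \mPo [tuple Q i | i < n]) => v.
by rewrite hP comp_mpoly_meval; apply: meval_eq => i; rewrite hQ tnth_mktuple.
Qed.

(** * Homogeneous fractions and homogenization *)

Section Homogeneous.
Variable K : closedFieldType.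

Lemma dhomog_scale n d (P : {mpoly K[n]}) (k : K) (v w : 'I_n -> K) :
  P \is d.-homog -> (forall i, w i = k * v i) -> P.@[w] = k ^+ d * P.@[v].
Proof.
move=> /dhomogP hP hw; rewrite !mevalE mulr_sumr; apply: eq_big_seq => m /hP <-.
rewrite mulrCA; congr (_ * _); rewrite /= mdegE -prodrXr -big_split; apply: eq_bigr => i _ /=.
by rewrite hw exprMn.
Qed.

(** ['X_ord0] is the homogenizing variable. The bound [msize p <= e.+1] in the lemmas below keeps
    [e - mdeg m] from being truncated. *)
Definition homogenize r (e : nat) (p : {mpoly K[r]}) : {mpoly K[r.+1]} :=
  \sum_(m <- msupp p) p@_m *:
    ('X_ord0 ^+ (e - mdeg m) * \prod_i 'X_(lift ord0 i) ^+ m i).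

Lemma homogenize_homog r e (p : {mpoly K[r]}) : (msize p <= e.+1)%N ->
  homogenize e p \is e.-homog.
Proof.
move=> pe; rewrite /homogenize big_seq; apply: rpred_sum => m mp; apply: rpredZ.
have := msize_mdeg_lt mp => me.
have hX i : ('X_i : {mpoly K[r.+1]}) \is 1.-homog by rewrite dhomogX /= mdeg1.
have hP : (\prod_i 'X_(lift ord0 i) ^+ m i : {mpoly K[r.+1]}) \is (mdeg m).-homog.
  rewrite mdegE; elim/big_ind2: _ => [|P d P' d' hd hd'|i _].
  - exact: dhomog1.
  - exact: dhomogM.
  - by have := dhomogMn (m i) (hX (lift ord0 i)); rewrite mul1n.
have := dhomogM (dhomogMn (e - mdeg m) (hX ord0)) hP.
by rewrite mul1n subnK // -ltnS (leq_trans me).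
Qed.

Lemma homogenizeE r e (p : {mpoly K[r]}) (w : 'I_r.+1 -> K) (y : 'I_r -> K) :
  (msize p <= e.+1)%N -> (forall i, w (lift ord0 i) = w ord0 * y i) ->
  (homogenize e p).@[w] = w ord0 ^+ e * p.@[y].
Proof.
move=> pe hw; rewrite /homogenize [in RHS]mevalE raddf_sum mulr_sumr.
apply: eq_big_seq => m mp /=; have := msize_mdeg_lt mp => me.
rewrite mevalZ mevalM rmorphXn rmorph_prod /= mevalXU [RHS]mulrCA; congr (_ * _).
rewrite (eq_bigr (fun i => w ord0 ^+ m i * y i ^+ m i)); last first.
  by move=> i _; rewrite rmorphXn /= mevalXU hw exprMn.
rewrite big_split prodrXr -mdegE mulrA -exprD; congr (_ ^+ _ * _); lia.
Qed.

(* The homogeneous components of numerator and denominator are proportional. *)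
Lemma scaling_invariant_proj n (p q : {mpoly K[n]}) : q != 0 ->
  (forall (k : K) (v w : 'I_n -> K), k != 0 -> (forall i, w i = k * v i) ->
     p.@[w] * q.@[v] = p.@[v] * q.@[w]) ->
  proj_funfield (tofrac p / tofrac q).
Proof.
move=> q0 h; pose N := maxn (msize p) (msize q).
have ep : p = \sum_(d < N) pihomog mdeg d p by apply: pihomog_partitionE; exact: leq_maxl.
have eq : q = \sum_(d < N) pihomog mdeg d q by apply: pihomog_partitionE; exact: leq_maxr.
have [d qd0] : exists d : 'I_N, pihomog mdeg d q != 0.
  apply: contrapT => nex; case/eqP: q0; rewrite eq big1 // => d _; apply/eqP.
  by apply: contrapT => /negP qd; apply: nex; exists d.
have scale (P : {mpoly K[n]}) (k : K) (v : 'I_n -> K) :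
    P = \sum_(d < N) pihomog mdeg d P ->
    P.@[fun i => k * v i] = (\poly_(d < N) (pihomog mdeg d P).@[v]).[k].
  move=> {1}->; rewrite horner_poly raddf_sum; apply: eq_bigr => i _ /=.
  by rewrite mulrC; apply: dhomog_scale (pihomogP _ _ _) _.
have e : pihomog mdeg d p * q = p * pihomog mdeg d q.
  apply: (@mpoly_eq_eval K n 1); first exact: oner_neq0.
  move=> v _; rewrite !mevalM.
  have /(congr1 (fun P : {poly K} => P`_d)) :
     q.@[v] *: (\poly_(d < N) (pihomog mdeg d p).@[v]) =
     p.@[v] *: (\poly_(d < N) (pihomog mdeg d q).@[v]).
    apply: poly_eq_horner => k k0; rewrite !hornerZ -!scale //.
    by rewrite mulrC; exact: h k0 _.
  by rewrite !coefZ !coef_poly ltn_ord mulrC.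
exists d, (pihomog mdeg d p), (pihomog mdeg d q); split=> //; try exact: pihomogP.
have t0 (P : {mpoly K[n]}) : P != 0 -> tofrac P != 0 by rewrite tofrac_eq0.
by apply/eqP; rewrite eqr_div ?t0 // -!rmorphM /= -e mulrC.
Qed.

End Homogeneous.

Lemma tofrac_addf (R : idomainType) (x y z t : R) : y != 0 -> t != 0 ->
  tofrac (x * t + z * y) / tofrac (y * t) = tofrac x / tofrac y + tofrac z / tofrac t.
Proof. by move=> y0 t0; rewrite addf_div ?tofrac_eq0 // tofracD !tofracM. Qed.

Lemma tofrac_mulf (R : idomainType) (x y z t : R) :
  tofrac (x * z) / tofrac (y * t) = (tofrac x / tofrac y) * (tofrac z / tofrac t).
Proof. by rewrite mulf_div !tofracM. Qed.

(** * From a slice to the field of invariants *)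

Section SliceRationality.
Variables (K : closedFieldType) (n r : nat).
Variable orb : ('I_n -> K) -> ('I_n -> K) -> Prop.
Variables (A D : 'I_r -> ('I_n -> K) -> K) (B : ('I_r -> K) -> 'I_n -> K).
Variable Dt : ('I_n -> K) -> K.

(** [B] parametrizes the slice, the fractions [A i / D i] are the coordinates of the slice point in
    the orbit of [v], and [Dt] is nonzero exactly at the points treated as generic. *)
Definition quot_coords (v : 'I_n -> K) : 'I_r -> K := fun i => A i v / D i v.

Local Notation N := quot_coords.

Hypothesis A_poly : forall i, polyfun (A i).
Hypothesis D_poly : forall i, polyfun (D i).
Hypothesis B_poly : forall j, polyfun (fun y => B y j).
Hypothesis Dt_poly : polyfun Dt.
Hypothesis Dt_neq0 : exists y, Dt (B y) != 0.
Hypothesis B_neq0 : forall y, nonzero_vec (B y).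
Hypothesis generic : forall v, Dt v != 0 ->
  [/\ nonzero_vec v, forall i, D i v != 0, orb v (B (N v)) & Dt (B (N v)) != 0].
Hypothesis B_inj : forall y y', Dt (B y) != 0 -> Dt (B y') != 0 ->
  orb (B y) (B y') -> y = y'.
Hypothesis orb_sym : forall c c', nonzero_vec c -> nonzero_vec c' -> orb c c' -> orb c' c.
Hypothesis orb_trans : forall c c' c'', nonzero_vec c -> nonzero_vec c' -> nonzero_vec c'' ->
  orb c c' -> orb c' c'' -> orb c c''.
Hypothesis orb_scale : forall c c' (k : K), nonzero_vec c -> k != 0 ->
  (forall i, c' i = k * c i) -> orb c c'.
(** As [L] is onto, nonzero polynomials stay nonzero after composition with it; this carries
    identities from generic points to arbitrary orbit pairs. *)
Hypothesis orb_polymap : forall c c', nonzero_vec c -> nonzero_vec c' -> orb c c' ->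
  exists L L' : ('I_n -> K) -> 'I_n -> K,
  [/\ forall j, polyfun (fun v => L v j), forall j, polyfun (fun v => L' v j),
      forall v, L (L' v) = v, L c = c' &
      forall v, nonzero_vec v -> nonzero_vec (L v) /\ orb v (L v)].

Lemma quot_coords_orb v v' : Dt v != 0 -> Dt v' != 0 -> orb v v' -> N v = N v'.
Proof.
move=> /generic[v0 _ o1 d1] /generic[v'0 _ o2 d2] o; apply: B_inj => //.
apply: (orb_trans (B_neq0 _) v'0 (B_neq0 _) _ o2).
by apply: (orb_trans (B_neq0 _) v0 v'0 _ o); apply: orb_sym.
Qed.

Lemma quot_coordsK y : Dt (B y) != 0 -> N (B y) = y.
Proof.
move=> d; have [v0 _ o1 d1] := generic d; apply: B_inj => //; exact: orb_sym.
Qed.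

(** The isomorphism substitutes the quotient coordinates into fractions of forms. It is onto because
    an invariant fraction is recovered from its restriction to the slice or to a translate of the
    slice. *)
Lemma slice_rational : rational_quotient orb.
Proof.
exists r; have [Ap hA] := choice A_poly; have [Dp hD] := choice D_poly.
have [Bp hB] := choice B_poly; have [Dtp hDt] := Dt_poly.
(* Homogeneous coordinates of [N v], with the product of all denominators [D k] in position 0. *)
pose T := [tuple (if unlift ord0 i is Some j then Ap j * \prod_(k | k != j) Dp k
                  else \prod_k Dp k) | i < r.+1].
pose ev (P : {mpoly K[r.+1]}) := P \mPo T.
pose delta v := \prod_k D k v.
pose nt v : 'I_r.+1 -> K := fun i => (tnth T i).@[v].
have evE P v : (ev P).@[v] = P.@[nt v] by rewrite comp_mpoly_meval.
have evM P Q : ev (P * Q) = ev P * ev Q by rewrite /ev rmorphM.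
have evD P Q : ev (P + Q) = ev P + ev Q by rewrite /ev rmorphD.
have evB P Q : ev (P - Q) = ev P - ev Q by rewrite /ev rmorphB.
have evC k : ev k%:MP = k%:MP by rewrite /ev comp_mpolyC.
have ev1 : ev 1 = 1 by rewrite /ev comp_mpoly1.
have evDM P Q P' Q' : ev (P * Q' + P' * Q) = ev P * ev Q' + ev P' * ev Q.
  by rewrite evD !evM.
clearbody ev.
have nt0 v : nt v ord0 = delta v.
  rewrite /nt tnth_mktuple unlift_none rmorph_prod.
  by apply: eq_bigr => i _; rewrite /= -hD.
have nt1 v i : Dt v != 0 -> nt v (lift ord0 i) = delta v * N v i.
  move=> /generic[_ d0 _ _]; rewrite /nt tnth_mktuple liftK rmorphM rmorph_prod /= -hA.
  transitivity (A i v * \prod_(k | k != i) D k v).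
    by congr (_ * _); apply: eq_bigr => k _; rewrite /= -hD.
  by rewrite /delta [X in _ = X * _](bigD1 i) //= /quot_coords; field.
have delta0 v : Dt v != 0 -> delta v != 0.
  by move=> /generic[_ d0 _ _]; apply/prodf_neq0.
pose cone (y : 'I_r -> K) : 'I_r.+1 -> K :=
  fun i => if unlift ord0 i is Some j then y j else 1.
have ntE v i : Dt v != 0 -> nt v i = delta v * cone (N v) i.
  move=> d; rewrite /cone; case: (unliftP ord0 i) => [j|] ->.
    exact: nt1.
  by rewrite mulr1 nt0.
have Dtp0 : Dtp != 0.
  have [y] := Dt_neq0; rewrite hDt; apply: contraNneq => ->; by rewrite meval0.
(* Up to scaling, the values of [nt] include every [w] with [w ord0 != 0] whose slice point is
   generic, since [N (B y) = y]. A nonzero form does not vanish at all of these. *)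
have ev_neq0 d P : P \is d.-homog -> P != 0 -> ev P != 0.
  move=> hP P0.
  pose Q := Dtp \mPo [tuple Bp j | j < n].
  have QE y : Q.@[y] = Dt (B y).
    rewrite comp_mpoly_meval hDt; apply: meval_eq => j; by rewrite tnth_mktuple hB.
  have X0 : 'X_ord0 != 0 :> {mpoly K[r.+1]} by rewrite -msize_poly_eq0 msizeX.
  have Q0 : homogenize (msize Q) Q != 0.
    have [y] := Dt_neq0; rewrite -QE => Qy; apply: contraNneq Qy => e.
    have := @homogenizeE K r (msize Q) Q (cone y) y (leqnSn _).
    rewrite e meval0 /cone unlift_none expr1n mul1r => -> // i.
    by rewrite liftK mul1r.
  have [w] := mpoly_neq0_eval (mulf_neq0 P0 (mulf_neq0 X0 Q0)).
  rewrite !mevalM mevalXU !mulf_eq0 !negb_or => /and3P[Pw w0 Qw].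
  pose y i := w (lift ord0 i) / w ord0.
  have Dy : Dt (B y) != 0.
    move: Qw; rewrite (@homogenizeE K r _ _ _ y) //.
      by rewrite mulf_eq0 negb_or QE => /andP[].
    by move=> i; rewrite /y mulrC divfK.
  apply: contraNneq Pw => e; have := evE P (B y); rewrite e meval0 => /esym/eqP.
  rewrite (@dhomog_scale K _ d P (delta (B y) / w ord0) w).
  - by rewrite mulf_eq0 expf_eq0 mulf_eq0 invr_eq0 (negbTE w0) (negbTE (delta0 _ Dy)) andbF.
  - by [].
  move=> i; rewrite ntE // quot_coordsK // /cone; case: (unliftP ord0 i) => [j|] ->.
    by rewrite /y; field.
  by field.
have tf0 k (P : {mpoly K[k]}) : P != 0 -> tofrac P != 0 by rewrite tofrac_eq0.
have frac_eq k (P Q P' Q' : {mpoly K[k]}) : Q != 0 -> Q' != 0 ->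
    tofrac P / tofrac Q = tofrac P' / tofrac Q' <-> P * Q' = P' * Q.
  move=> Q0 Q'0; split=> [/eqP|e].
    by rewrite eqr_div ?tf0 // -!tofracM tofrac_eq => /eqP.
  by apply/eqP; rewrite eqr_div ?tf0 // -!tofracM e.
(* On [proj_funfield] the value does not depend on the chosen fraction; elsewhere it is set to 0. *)
have /choice[f fE] : forall x : {fraction {mpoly K[r.+1]}},
    exists y : {fraction {mpoly K[n]}}, forall d P Q, P \is d.-homog -> Q \is d.-homog ->
      Q != 0 -> x = tofrac P / tofrac Q -> y = tofrac (ev P) / tofrac (ev Q).
  move=> x; have [[d [P [Q [hP hQ Q0 ex]]]]|nex] := pselect (proj_funfield x); last first.
    by exists 0 => d P Q hP hQ Q0 ex; case: nex; exists d, P, Q.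
  exists (tofrac (ev P) / tofrac (ev Q)) => d' P' Q' hP' hQ' Q'0.
  rewrite ex => /(frac_eq _ _ _ _ _ Q0 Q'0) e.
  apply/(frac_eq _ _ _ _ _ (ev_neq0 _ _ hQ Q0) (ev_neq0 _ _ hQ' Q'0)).
  by rewrite -!evM e.
have pos_open (q : {mpoly K[n]}) (G : ('I_n -> K) -> 'I_n -> K) v0 :
    (forall j, polyfun (fun v => G v j)) -> q.@[G v0] != 0 ->
    exists2 q' : {mpoly K[n]}, q' != 0 & forall v, q'.@[v] = q.@[G v].
  move=> /choice[Gp hG] qG; exists (q \mPo [tuple Gp j | j < n]).
    apply: contraNneq qG => e; have := comp_mpoly_meval v0 q [tuple Gp j | j < n].
    rewrite e meval0 => e0; apply/eqP; rewrite e0; apply: meval_eq => i.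
    by rewrite tnth_mktuple hG.
  by move=> v; rewrite comp_mpoly_meval; apply: meval_eq => i; rewrite tnth_mktuple hG.
have orb_ratio d P Q v v' : P \is d.-homog -> Q \is d.-homog -> Dt v != 0 -> Dt v' != 0 ->
    orb v v' -> (ev P).@[v] * (ev Q).@[v'] = (ev P).@[v'] * (ev Q).@[v].
  move=> hP hQ dv dv' o; have eN := quot_coords_orb dv dv' o.
  have h R : R \is d.-homog -> (ev R).@[v] = delta v ^+ d * R.@[cone (N v)].
    by move=> hR; rewrite evE; apply: dhomog_scale hR _ => i; exact: ntE.
  have h' R : R \is d.-homog -> (ev R).@[v'] = delta v' ^+ d * R.@[cone (N v)].
    by move=> hR; rewrite evE eN; apply: dhomog_scale hR _ => i; exact: ntE.
  rewrite !h // !h' //; ring.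
exists f; split.
- move=> x [d [P [Q [hP hQ Q0 ex]]]].
  have ef := fE _ _ _ _ hP hQ Q0 ex; have eQ0 := ev_neq0 _ _ hQ Q0.
  split.
    (* Proportional vectors lie in one orbit, so [ev P / ev Q] is invariant under scaling; values
       are compared where a vector and its multiple are both generic. *)
    rewrite ef; apply: scaling_invariant_proj => // k v w k0 hw.
    have [[y0 dy0] kn0] : (exists y, Dt (B y) != 0) /\ k^-1 != 0 by rewrite invr_eq0.
    pose G (v : 'I_n -> K) (i : 'I_n) := k * v i.
    have Gpoly j : polyfun (fun v => G v j).
      by apply: polyfunM; [exact: polyfun_const|exact: polyfun_coord].
    have [||q' q'0 q'E] := pos_open Dtp G (fun i => k^-1 * B y0 i).
    - exact: Gpoly.
    - rewrite (_ : G _ = B y0) -?hDt //; apply: funext => i.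
      by rewrite /G mulrA mulfV // mul1r.
    have -> : w = G v by apply: funext.
    have hPG : exists P' : {mpoly K[n]}, forall v, P'.@[v] = (ev P).@[G v].
      have [|P' e] := polyfun_comp (f := fun v => (ev P).@[v]) _ Gpoly; first by exists (ev P).
      by exists P' => u; rewrite -e.
    have hQG : exists P' : {mpoly K[n]}, forall v, P'.@[v] = (ev Q).@[G v].
      have [|P' e] := polyfun_comp (f := fun v => (ev Q).@[v]) _ Gpoly; first by exists (ev Q).
      by exists P' => u; rewrite -e.
    have [[P' eP'] [Q' eQ']] := (hPG, hQG).
    rewrite -eP' -eQ' -!mevalM; congr (_.@[_]).
    apply: (@mpoly_eq_eval K n (Dtp * q')); first exact: mulf_neq0.
    move=> u; rewrite mevalM q'E -!hDt mulf_eq0 => /norP[du dGu].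
    rewrite !mevalM eP' eQ'; apply/esym; apply: (orb_ratio d) => //.
    by have [u0 _ _ _] := generic du; apply: (orb_scale u0 k0).
  move=> d' P' Q' hP' hQ' ex' c c' c0 c'0 o Qc Qc'.
  have Q'0 : Q' != 0 by apply: contraNneq Qc => ->; rewrite meval0.
  move: ex'; rewrite ef => /(frac_eq _ _ _ _ _ eQ0 Q'0) e.
  (* [c] and [c'] need not be generic. The identity between the values at [u] and [L u] holds for
     [u] in a dense set, hence also at [c]. *)
  have [L [L' [Lp Lp' LK Lc Lo]]] := orb_polymap c0 c'0 o.
  suff id : P'.@[L c] * Q'.@[c] = P'.@[c] * Q'.@[L c].
    by rewrite -Lc in Qc' *; apply/eqP; rewrite eqr_div // id.
  have comp_ex (P1 : {mpoly K[n]}) : exists P2 : {mpoly K[n]}, forall v, P2.@[v] = P1.@[L v].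
    have [|P2 e2] := polyfun_comp (f := fun v => P1.@[v]) _ Lp; first by exists P1.
    by exists P2 => u; rewrite -e2.
  have comp_ex0 (P1 : {mpoly K[n]}) : P1 != 0 -> exists2 P2 : {mpoly K[n]}, P2 != 0 &
      forall v, P2.@[v] = P1.@[L v].
    by move=> /mpoly_neq0_eval[v0 hv0]; apply: (pos_open P1 L (L' v0)); rewrite ?LK.
  have [PL ePL] := comp_ex P'; have [QL eQL] := comp_ex Q'.
  have [DL DL0 eDL] := comp_ex0 _ Dtp0; have [qL qL0 eqL] := comp_ex0 _ eQ0.
  rewrite -ePL -eQL -!mevalM; congr (_.@[_]).
  apply: (@mpoly_eq_eval K n (Dtp * DL * (ev Q * qL))); first by rewrite !mulf_neq0.
  move=> u; rewrite !mevalM eDL eqL ePL eQL -!hDt !mulf_eq0 !negb_or.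
  move=> /andP[/andP[du dLu] /andP[qu qLu]].
  have [u0 _ _ _] := generic du; have oL := (Lo u u0).2.
  have r1 := orb_ratio _ _ _ _ _ hP hQ du dLu oL.
  have e1 w : (ev P).@[w] * Q'.@[w] = P'.@[w] * (ev Q).@[w] by rewrite -!mevalM e.
  apply: (mulfI qu); apply: (mulfI qLu).
  transitivity (Q'.@[u] * (ev Q).@[u] * (P'.@[L u] * (ev Q).@[L u])); first by ring.
  rewrite -e1; transitivity (Q'.@[u] * Q'.@[L u] * ((ev P).@[L u] * (ev Q).@[u])); first by ring.
  rewrite -r1; transitivity (Q'.@[L u] * (ev Q).@[L u] * ((ev P).@[u] * Q'.@[u])); first by ring.
  by rewrite e1; ring.
- move=> y [[d [P [Q [hP hQ Q0 ey]]]] inv].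
  have [v0] := mpoly_neq0_eval (mulf_neq0 Q0 Dtp0).
  rewrite mevalM -hDt mulf_eq0 => /norP[Qv0 dv0].
  have [v0n _ o0 d0] := generic dv0.
  (* The denominator [Q] may vanish on the whole slice. The fraction is therefore restricted to the
     translate of the slice by [L], which passes through [v0]. *)
  have [L [L' [Lp Lp' LK Lc Lo]]] := orb_polymap (B_neq0 _) v0n (orb_sym v0n (B_neq0 _) o0).
  have pull (R : {mpoly K[n]}) : exists R' : {mpoly K[r]}, forall y, R'.@[y] = R.@[L (B y)].
    have Rp : polyfun (fun v => R.@[v]) by exists R.
    by have [R' eR'] := polyfun_comp (polyfun_comp Rp Lp) B_poly; exists R' => z; rewrite -eR'.
  have [P' eP'] := pull P; have [Q' eQ'] := pull Q.
  pose e := maxn (msize P') (msize Q').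
  have eP : (msize P' <= e.+1)%N by rewrite leqW // leq_maxl.
  have eQ : (msize Q' <= e.+1)%N by rewrite leqW // leq_maxr.
  have hhP := homogenize_homog eP; have hhQ := homogenize_homog eQ.
  have hQ0 : homogenize e Q' != 0.
    apply: contraNneq Qv0 => h0; rewrite -Lc -eQ'.
    have := @homogenizeE K r e Q' (cone (N v0)) (N v0) eQ.
    rewrite h0 meval0 /cone unlift_none expr1n mul1r => -> // i.
    by rewrite liftK mul1r.
  exists (tofrac (homogenize e P') / tofrac (homogenize e Q')); first by exists e, (homogenize e P'), (homogenize e Q').
  rewrite (fE _ _ _ _ hhP hhQ hQ0 erefl) ey.
  have evQ0 := ev_neq0 _ _ hhQ hQ0.
  apply/(frac_eq _ _ _ _ _ evQ0 Q0).
  apply: (@mpoly_eq_eval K n (Dtp * Q * ev (homogenize e Q'))); first by rewrite !mulf_neq0.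
  move=> v; rewrite !mevalM -hDt !mulf_eq0 !negb_or => /andP[/andP[dv Qv] eQv].
  have evh R : (msize R <= e.+1)%N -> (ev (homogenize e R)).@[v] = delta v ^+ e * R.@[N v].
    move=> hR; rewrite evE -nt0; apply: homogenizeE hR _ => i.
    by rewrite nt1 // nt0.
  move: eQv; rewrite !evh // eP' eQ' => eQv.
  have [vn _ ov _] := generic dv; have [Ln oL] := Lo _ (B_neq0 (N v)).
  have QL : Q.@[L (B (N v))] != 0 by move: eQv; rewrite mulf_eq0 => /norP[].
  have := inv d P Q hP hQ ey v (L (B (N v))) vn Ln
    (orb_trans vn (B_neq0 _) Ln ov oL) Qv QL.
  move=> /eqP; rewrite eqr_div // => /eqP e1.
  by rewrite -mulrA -e1 [RHS]mulrCA.
- move=> x x' [d [P [Q [hP hQ Q0 ex]]]] [d' [P' [Q' [hP' hQ' Q'0 ex']]]].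
  rewrite (fE _ _ _ _ hP hQ Q0 ex) (fE _ _ _ _ hP' hQ' Q'0 ex') ex ex'.
  move=> /(frac_eq _ _ _ _ _ (ev_neq0 _ _ hQ Q0) (ev_neq0 _ _ hQ' Q'0)) e.
  apply/(frac_eq _ _ _ _ _ Q0 Q'0); apply/eqP; rewrite -subr_eq0; apply/eqP.
  apply: contrapT => /eqP n0; have := ev_neq0 (d + d')%N _ _ n0.
  have hh : P * Q' - P' * Q \is (d + d').-homog.
    by apply: rpredB; [|rewrite addnC]; apply: dhomogM.
  by move=> /(_ hh); rewrite evB !evM e subrr eqxx.
- move=> x x' [d [P [Q [hP hQ Q0 ex]]]] [d' [P' [Q' [hP' hQ' Q'0 ex']]]].
  rewrite (fE _ _ _ _ hP hQ Q0 ex) (fE _ _ _ _ hP' hQ' Q'0 ex').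
  have eQ0 := tf0 _ _ (ev_neq0 _ _ hQ Q0); have eQ'0 := tf0 _ _ (ev_neq0 _ _ hQ' Q'0).
  have QQ' := dhomogM hQ hQ'; have QQ'0 := mulf_neq0 Q0 Q'0.
  have tQ0 := tf0 _ _ Q0; have tQ'0 := tf0 _ _ Q'0.
  split.
    rewrite (fE (x + x') _ (P * Q' + P' * Q) _ _ QQ' QQ'0).
    - apply: etrans (congr2 (fun u w => tofrac u / tofrac w) (evDM P Q P' Q') (evM Q Q')) _.
      by apply: tofrac_addf; rewrite -tofrac_eq0.
    - by apply: rpredD; [|rewrite addnC]; apply: dhomogM.
    - by rewrite ex ex'; apply/esym/tofrac_addf.
  rewrite (fE (x * x') _ (P * P') _ (dhomogM hP hP') QQ' QQ'0).
    apply: etrans (congr2 (fun u w => tofrac u / tofrac w) (evM P P') (evM Q Q')) _.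
    exact: tofrac_mulf.
  by rewrite ex ex'; apply/esym/tofrac_mulf.
- move=> k; have h1 : (1 : {mpoly K[r.+1]}) \is 0.-homog by exact: dhomog1.
  have hk : (k%:MP_[r.+1]) \is 0.-homog by rewrite -[k%:MP_[_]]mulr1 mul_mpolyC; exact: rpredZ.
  have one0 : (1 : {mpoly K[r.+1]}) != 0 by exact: oner_neq0.
  have e : tofrac k%:MP_[r.+1] = tofrac k%:MP_[r.+1] / tofrac (1 : {mpoly K[r.+1]}).
    by rewrite tofrac1 divr1.
  rewrite (fE _ _ _ _ hk h1 one0 e) evC ev1.
  by rewrite tofrac1 divr1.
Qed.

End SliceRationality.

(** * Binary forms and cubic sections *)

(* A binary form sum_i f_i s^i t^(n-i) of degree n is represented by the
   polynomial sum_i f_i X^i together with n. *)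
Section BinaryForms.
Variable K : closedFieldType.
Implicit Types (f h A B : {poly K}) (n m : nat).

Definition heval n f (s t : K) : K := \sum_(i < n.+1) f`_i * s ^+ i * t ^+ (n - i).

Lemma heval_horner n f s t : (size f <= n.+1)%N -> t != 0 ->
  heval n f s t = t ^+ n * f.[s / t].
Proof.
move=> sf t0; rewrite (horner_coef_wide _ sf) mulr_sumr; apply: eq_bigr => i _.
have := ltn_ord i; rewrite ltnS => le_in.
have -> : t ^+ n = t ^+ (n - i) * t ^+ i by rewrite -exprD subnK.
by rewrite expr_div_n; field; rewrite expf_neq0.
Qed.

Lemma heval_t0 n f s : heval n f s 0 = f`_n * s ^+ n.
Proof.
rewrite /heval (bigD1 ord_max) //= subnn expr0 mulr1 big1 ?addr0 // => i ni.
have : (i : nat) != n by rewrite -val_eqE in ni.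
by have := ltn_ord i; rewrite ltnS expr0n subn_eq0 => i1 i2; rewrite (_ : (n <= i)%N = false) ?mulr0 //; lia.
Qed.

Lemma hevalM n m f h s t : (size f <= n.+1)%N -> (size h <= m.+1)%N ->
  heval (n + m) (f * h) s t = heval n f s t * heval m h s t.
Proof.
move=> sf sh; have [->|t0] := eqVneq t 0.
  rewrite !heval_t0 coefM exprD.
  have ln : (n < (n + m).+1)%N by rewrite ltnS leq_addr.
  rewrite (bigD1 (Ordinal ln)) //= addKn big1 => [|i ni]; first by rewrite addr0 mulrACA.
  have {}ni : (i : nat) != n by rewrite -val_eqE in ni.
  have [lt|le] := ltnP n i.
    by rewrite (leq_sizeP _ _ sf) ?mul0r.
  by rewrite [h`__](leq_sizeP _ _ sh) ?mulr0 //; lia.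
have sfh : (size (f * h)%R <= (n + m).+1)%N.
  by apply: leq_trans (size_polyMleq _ _) _; lia.
by rewrite !heval_horner // hornerM exprD mulrACA.
Qed.

Lemma hevalZ n (k : K) f s t : heval n (k *: f) s t = k * heval n f s t.
Proof. by rewrite /heval mulr_sumr; apply: eq_bigr => i _; rewrite coefZ !mulrA. Qed.

Lemma hevalD n f h s t : heval n (f + h) s t = heval n f s t + heval n h s t.
Proof. by rewrite /heval -big_split; apply: eq_bigr => i _; rewrite coefD !mulrDl. Qed.

Lemma heval0 n s t : heval n 0 s t = 0.
Proof. by rewrite /heval big1 // => i _; rewrite coef0 !mul0r. Qed.

Lemma heval_sum (I : Type) (r : seq I) (P : pred I) (F : I -> {poly K}) n s t :
  heval n (\sum_(i <- r | P i) F i) s t = \sum_(i <- r | P i) heval n (F i) s t.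
Proof.
by apply: (big_morph (fun f => heval n f s t)) => [f h|]; [exact: hevalD|exact: heval0].
Qed.

Lemma size_linear_exp A k : (size A <= 2)%N -> (size (A ^+ k) <= k.+1)%N.
Proof.
move=> sA; apply: leq_trans (size_poly_exp_leq _ _) _.
by rewrite ltnS -[leqRHS]mul1n leq_mul2r; apply/orP; right; lia.
Qed.

Lemma hevalXn A k s t : (size A <= 2)%N -> heval k (A ^+ k) s t = heval 1 A s t ^+ k.
Proof.
move=> sA; elim: k => [|k IH].
  by rewrite /heval big_ord1 !expr0 coef1 !mulr1.
by rewrite !exprS -IH -add1n hevalM // size_linear_exp.
Qed.

Lemma heval_inj n f h : (size f <= n.+1)%N -> (size h <= n.+1)%N ->
  (forall s t, heval n f s t = heval n h s t) -> f = h.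
Proof.
move=> sf sh e; apply: poly_eq_horner => y _.
by have := e y 1; rewrite !heval_horner ?oner_eq0 // expr1n !mul1r divr1.
Qed.

Definition lform (a b : K) : {poly K} := a *: 'X + b%:P.

Lemma size_lform a b : (size (lform a b) <= 2)%N.
Proof.
apply: leq_trans (size_polyD _ _) _; rewrite geq_max.
by rewrite (leq_trans (size_scale_leq _ _)) ?size_polyX // (leq_trans (size_polyC_leq1 _)).
Qed.

Lemma heval_lform a b s t : heval 1 (lform a b) s t = a * s + b * t.
Proof.
rewrite /heval !big_ord_recl big_ord0 /= !coefD !coefZ !coefX !coefC /=; ring.
Qed.

Definition hsub n A B f : {poly K} := \sum_(i < n.+1) f`_i *: (A ^+ i * B ^+ (n - i)).

Lemma size_hsub n A B f : (size A <= 2)%N -> (size B <= 2)%N ->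
  (size (hsub n A B f) <= n.+1)%N.
Proof.
move=> sA sB; apply: leq_trans (size_sum _ _ _) _; apply/bigmax_leqP => i _.
apply: leq_trans (size_scale_leq _ _) _; apply: leq_trans (size_polyMleq _ _) _.
have := size_linear_exp i sA; have := size_linear_exp (n - i) sB; have := ltn_ord i.
move: (size _) (size _) => x y; lia.
Qed.

Lemma hevalXnM n k A B s t : (k <= n)%N -> (size A <= 2)%N -> (size B <= 2)%N ->
  heval n (A ^+ k * B ^+ (n - k)) s t = heval 1 A s t ^+ k * heval 1 B s t ^+ (n - k).
Proof.
move=> kn sA sB; rewrite -!hevalXn //.
by rewrite -hevalM ?size_linear_exp // subnKC.
Qed.

Lemma heval_hsub n A B f s t : (size A <= 2)%N -> (size B <= 2)%N ->
  heval n (hsub n A B f) s t = heval n f (heval 1 A s t) (heval 1 B s t).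
Proof.
move=> sA sB; rewrite heval_sum; apply: eq_bigr => i _.
by rewrite hevalZ hevalXnM ?mulrA // -ltnS.
Qed.

(* The GL_2-invariant pairing of binary forms of degree n, multiplied by n!. *)
Definition pair n f h : K :=
  \sum_(i < n.+1) (-1) ^+ i * (i`! * (n - i)`!)%:R * f`_i * h`_(n - i).

Lemma pairDr n f h h' : pair n f (h + h') = pair n f h + pair n f h'.
Proof. by rewrite /pair -big_split; apply: eq_bigr => i _; rewrite coefD mulrDr. Qed.

Lemma pairZr n (k : K) f h : pair n f (k *: h) = k * pair n f h.
Proof. by rewrite /pair mulr_sumr; apply: eq_bigr => i _; rewrite coefZ; ring. Qed.

Lemma pairDl n f f' h : pair n (f + f') h = pair n f h + pair n f' h.
Proof. by rewrite /pair -big_split; apply: eq_bigr => i _; rewrite /= coefD; ring. Qed.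

Lemma pairZl n (k : K) f h : pair n (k *: f) h = k * pair n f h.
Proof. by rewrite /pair mulr_sumr; apply: eq_bigr => i _; rewrite coefZ; ring. Qed.

Lemma pair0r n f : pair n f 0 = 0.
Proof. by rewrite /pair big1 // => i _; rewrite coef0 mulr0. Qed.

Lemma pair_sumr (I : Type) (r : seq I) n f (F : I -> {poly K}) :
  pair n f (\sum_(i <- r) F i) = \sum_(i <- r) pair n f (F i).
Proof.
by elim: r => [|i r IH]; rewrite ?big_nil ?pair0r // !big_cons pairDr IH.
Qed.

Lemma pairXn n f k : (k <= n)%N ->
  pair n f 'X^(n - k) = (-1) ^+ k * (k`! * (n - k)`!)%:R * f`_k.
Proof.
move=> kn; have lk : (k < n.+1)%N by [].
rewrite /pair (bigD1 (Ordinal lk)) //= coefXn eqxx mulr1 big1 ?addr0 // => i ik.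
rewrite coefXn (_ : _ == _ = false) ?mulr0 //.
have : (i : nat) != k by rewrite -val_eqE in ik.
by have := ltn_ord i; lia.
Qed.

(* The n-th powers of linear forms represent the evaluations. *)
Lemma pair_linear_exp n f a c : pair n f (lform a c ^+ n) = n`!%:R * heval n f (- c) a.
Proof.
rewrite /pair /heval mulr_sumr; apply: eq_bigr => i _.
have := ltn_ord i; rewrite ltnS => le_in.
have -> : (lform a c ^+ n)`_(n - i) = 'C(n, i)%:R * a ^+ (n - i) * c ^+ i.
  rewrite /lform addrC exprDn coef_sum.
  have lk : (n - i < n.+1)%N by rewrite ltnS leq_subr.
  rewrite (bigD1 (Ordinal lk)) //= big1 ?addr0 => [|k ki].
    rewrite coefMn -rmorphXn exprZn -scalerAr coefZ coefCM coefXn eqxx.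
    by rewrite subKn // bin_sub // !mulr1 -mulr_natl; ring.
  rewrite coefMn -rmorphXn exprZn -scalerAr coefZ coefCM coefXn.
  rewrite (_ : _ == _ = false) ?mulr0 ?mul0rn //.
  by apply: contraNF ki => /eqP e; apply/eqP/val_inj.
rewrite -(bin_fact le_in) !natrM [(- c) ^+ _]exprNn; ring.
Qed.

(** Characteristic zero: factorials and binomial coefficients are invertible, so that the n-th
    powers of linear forms span the forms of degree n. *)
Hypothesis natr_neq0 : forall k, k.+1%:R != 0 :> K.

Lemma fact_neq0 k : k`!%:R != 0 :> K.
Proof. by have := fact_gt0 k; case: k`! => // m _. Qed.

(** By linearity [h] may be replaced by the powers of s - x t, for which the pairing is n! times the
    value of [f] at (x, 1); a substitution merely moves that point. *)
Lemma pair_hsub n f h a11 a12 a21 a22 :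
  (size f <= n.+1)%N -> (size h <= n.+1)%N ->
  pair n (hsub n (lform a11 a12) (lform a21 a22) f) (hsub n (lform a11 a12) (lform a21 a22) h)
  = (a11 * a22 - a12 * a21) ^+ n * pair n f h.
Proof.
move=> sf sh; set A := lform a11 a12; set B := lform a21 a22.
have [sA sB] : (size A <= 2)%N /\ (size B <= 2)%N by rewrite !size_lform.
set d := a11 * a22 - a12 * a21.
pose phi g := pair n (hsub n A B f) (hsub n A B g) - d ^+ n * pair n f g.
have hsubXn k : (k <= n)%N -> hsub n A B 'X^k = A ^+ k * B ^+ (n - k).
  move=> kn; have lk : (k < n.+1)%N by [].
  rewrite /hsub (bigD1 (Ordinal lk)) //= coefXn eqxx scale1r big1 ?addr0 // => i ik.
  rewrite coefXn (_ : _ == _ = false) ?scale0r //.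
  by apply: contraNF ik => /eqP e; apply/eqP/val_inj.
have phiE (g : {poly K}) : (size g <= n.+1)%N -> phi g = \sum_(k < n.+1) g`_k * phi 'X^k.
  move=> sg; have eg : g = \sum_(k < n.+1) g`_k *: 'X^k.
    by rewrite -poly_def; apply/polyP => k; rewrite coef_poly; case: ltnP => // /(leq_sizeP _ _ sg).
  rewrite {1}/phi {2}eg [hsub n A B g]/hsub !pair_sumr mulr_sumr -sumrB.
  apply: eq_bigr => k _; rewrite /phi pairZr pairZr hsubXn ?mulrBr //; first by ring.
  by rewrite -ltnS.
have phi0 k : (k < n.+1)%N -> phi 'X^k = 0.
  move=> kn.
  (* The defect [phi] vanishes on the n-th power of X - x for every x. As a polynomial in x this has
     the coefficients [phi 'X^(n - j)] times nonzero integers. *)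
  have e : \poly_(j < n.+1) ((-1) ^+ j * 'C(n, j)%:R * phi 'X^(n - j)) = 0.
    apply: poly_eq_horner => x _; rewrite horner0.
    have sl : (size (lform 1 (- x) ^+ n) <= n.+1)%N by rewrite size_linear_exp ?size_lform.
    have : phi (lform 1 (- x) ^+ n) = 0.
      have e : hsub n A B (lform 1 (- x) ^+ n) = lform (a11 - x * a21) (a12 - x * a22) ^+ n.
        apply: (heval_inj (n := n)); rewrite ?size_hsub ?size_linear_exp ?size_lform //.
        move=> s t; rewrite heval_hsub // hevalXn ?size_lform // hevalXn ?size_lform //.
        by rewrite /A /B !heval_lform; congr (_ ^+ _); ring.
      rewrite /phi e !pair_linear_exp heval_hsub // !heval_lform opprK.
      (* The matrix maps the zero of the transformed linear form to [d] times (x, 1), the zero of s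
         - x t. *)
      have -> : a11 * - (a12 - x * a22) + a12 * (a11 - x * a21) = d * x by rewrite /d; ring.
      have -> : a21 * - (a12 - x * a22) + a22 * (a11 - x * a21) = d * 1 by rewrite /d; ring.
      apply/eqP; rewrite subr_eq0; apply/eqP; rewrite mulrCA; congr (_ * _).
      rewrite /heval mulr_sumr; apply: eq_bigr => i _.
      have := ltn_ord i; rewrite ltnS => le_in.
      have -> : d ^+ n = d ^+ i * d ^+ (n - i) by rewrite -exprD subnKC.
      by rewrite !exprMn expr1n; ring.
    rewrite phiE // => <-; rewrite horner_poly.
    rewrite (reindex_inj rev_ord_inj) /=; apply: eq_bigr => i _.
    have := ltn_ord i; rewrite ltnS => le_in; rewrite subSS subKn //.
    have -> : (lform 1 (- x) ^+ n)`_i = 'C(n, n - i)%:R * (- x) ^+ (n - i).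
      rewrite /lform scale1r addrC exprDn coef_sum.
      rewrite (bigD1 i) //= big1 ?addr0 => [|k' ki].
        by rewrite coefMn -rmorphXn coefCM coefXn eqxx mulr1 bin_sub // mulr_natl.
      rewrite coefMn -rmorphXn coefCM coefXn (_ : _ == _ = false) ?mulr0 ?mul0rn //.
      by apply: contraNF ki => /eqP e; apply/eqP/val_inj.
    rewrite [(- x) ^+ _]exprNn; ring.
  move: (congr1 (fun q : {poly K} => q`_(n - k)) e).
  rewrite coef0 coef_poly ltnS leq_subr subKn // => /eqP.
  rewrite !mulf_eq0 signr_eq0 /= => /orP[bin0|/eqP //].
  have := fact_neq0 n; rewrite -(@bin_fact n (n - k)) ?leq_subr //.
  by rewrite natrM (eqP bin0) mul0r eqxx.
apply/eqP; rewrite -subr_eq0; apply/eqP; rewrite -/(phi h) phiE // big1 // => k _.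
by rewrite phi0 // mulr0.
Qed.

End BinaryForms.

(** * Cubic sections as quadruples of binary forms *)

Section CubicSections.
Variables (K : closedFieldType) (b : nat).
Implicit Types (F : nat -> {poly K}) (g : coxmap K).

Definition fsize F : Prop := forall k, (size (F k) <= (b + k).+1)%N.

Definition feval F (s t u z : K) : K :=
  \sum_(k < 4) u ^+ k * z ^+ (3 - k) * heval (b + k) (F k) s t.

(** The action on quadruples of forms (unrelated to the factorial): the coefficients in u and z
    after substituting [coxact g], obtained by expanding the powers of cz z + l u. *)
Definition fact g F : nat -> {poly K} := fun k =>
  let A := lform (c11 g) (c12 g) in let B := lform (c21 g) (c22 g) in
  let l := lform (cs g) (ct g) in
  let h i := hsub (b + i) A B (F i) in
  match k with
  | 0%N => cz g ^+ 3 *: h 0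
  | 1%N => cz g ^+ 2 *: (cu g *: h 1 + 3%:R *: (l * h 0))
  | 2%N => cz g *: (cu g ^+ 2 *: h 2 + (2%:R * cu g) *: (l * h 1) + 3%:R *: (l ^+ 2 * h 0))
  | 3%N => cu g ^+ 3 *: h 3 + cu g ^+ 2 *: (l * h 2) + cu g *: (l ^+ 2 * h 1) + l ^+ 3 * h 0
  | _ => 0
  end.

Lemma fsize_fact g F : fsize (fact g F).
Proof.
have sh i : (size (hsub (b + i) (lform (c11 g) (c12 g)) (lform (c21 g) (c22 g)) (F i)) <= (b + i).+1)%N.
  by apply: size_hsub; exact: size_lform.
have sM k i : (size (lform (cs g) (ct g) ^+ k *
    hsub (b + i) (lform (c11 g) (c12 g)) (lform (c21 g) (c22 g)) (F i))%R <= (b + (k + i)).+1)%N.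
  apply: leq_trans (size_polyMleq _ _) _; have := sh i.
  have := size_linear_exp k (size_lform (cs g) (ct g)); lia.
have sM1 i := sM 1%N i.
have sZ (k : K) (p : {poly K}) m : (size p <= m)%N -> (size (k *: p) <= m)%N.
  exact: leq_trans (size_scale_leq _ _).
have sD (p q : {poly K}) m : (size p <= m)%N -> (size q <= m)%N -> (size (p + q)%R <= m)%N.
  by move=> *; apply: leq_trans (size_polyD _ _) _; rewrite geq_max; apply/andP.
case=> [|[|[|[|k]]]] /=; last by rewrite size_poly0.
- exact/sZ/sh.
- by apply/sZ/sD; apply: (sZ); [exact: sh|exact: sM1].
- by apply/sZ/sD; [apply: (sD)|]; apply: (sZ); [exact: sh|exact: sM1|exact: sM].
- by apply: (sD); [apply: (sD); [apply: (sD)|]; apply: (sZ); [exact: sh|exact: sM1|exact: sM]|exact: sM].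
Qed.

Lemma feval_fact g F s t u z : feval (fact g F) s t u z =
  feval F (c11 g * s + c12 g * t) (c21 g * s + c22 g * t) (cu g * u)
    (cz g * z + (cs g * s + ct g * t) * u).
Proof.
rewrite /feval !big_ord_recl !big_ord0 /bump /= !addr0.
rewrite /fact; set A := lform (c11 g) _; set B := lform (c21 g) _; set l := lform (cs g) _.
set S := c11 g * s + c12 g * t; set T := c21 g * s + c22 g * t; set L := cs g * s + ct g * t.
have eH i : heval (b + i) (hsub (b + i) A B (F i)) s t = heval (b + i) (F i) S T.
  by rewrite heval_hsub ?size_lform // !heval_lform.
have hl k i : heval (b + (k + i)) (l ^+ k * hsub (b + i) A B (F i)) s t =
    L ^+ k * heval (b + i) (F i) S T.
  rewrite addnCA hevalM ?size_linear_exp ?size_hsub ?size_lform // eH.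
  by rewrite hevalXn ?size_lform // heval_lform.
have h1 i : heval (b + i.+1) (l * hsub (b + i) A B (F i)) s t = L * heval (b + i) (F i) S T.
  exact: (hl 1%N i).
have h2 i : heval (b + i.+2) (l ^+ 2 * hsub (b + i) A B (F i)) s t =
    L ^+ 2 * heval (b + i) (F i) S T.
  exact: (hl 2%N i).
have h3 : heval (b + 3) (l ^+ 3 * hsub (b + 0) A B (F 0%N)) s t =
    L ^+ 3 * heval (b + 0) (F 0%N) S T.
  exact: (hl 3%N 0%N).
by rewrite !(hevalD, hevalZ) !(h1, h2, h3, eH); ring.
Qed.

Lemma feval_inj F F' : fsize F -> fsize F' -> (forall s t u z, feval F s t u z = feval F' s t u z) ->
  forall k, (k < 4)%N -> F k = F' k.
Proof.
move=> sF sF' e k k4; apply: (heval_inj (sF k) (sF' k)) => s t.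
have e1 G u : feval G s t u 1 = (\poly_(k < 4) heval (b + k) (G k) s t).[u].
  rewrite horner_poly; apply: eq_bigr => i _.
  by rewrite expr1n mulr1 mulrC.
have : \poly_(k < 4) heval (b + k) (F k) s t = \poly_(k < 4) heval (b + k) (F' k) s t.
  by apply: poly_eq_horner => u _; rewrite -!e1 e.
by move/(congr1 (fun p : {poly K} => p`_k)); rewrite !coef_poly k4.
Qed.

Local Notation n := (h0 3 b).

Definition mon (j : 'I_n) : 'X_{1..4} := tnth (in_tuple (sect_mons 3 b)) j.

Lemma mon_bidegree j : bidegree 3 b%:Z (mon j).
Proof. by rewrite -mem_sect_mons mem_tnth. Qed.

Lemma mon_inj : injective mon.
Proof.
move=> i j; rewrite /mon !(tnth_nth 0%MM) /= => /eqP.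
by rewrite nth_uniq ?sect_mons_uniq // => /eqP/val_inj.
Qed.

(** The index [j] stands for the coefficient of s^i in F_k with k = [cdeg j] and i = [cexp j]. *)
Definition cdeg (j : 'I_n) : nat := mon j vu.
Definition cexp (j : 'I_n) : nat := mon j vs.

Lemma cdeg_lt j : (cdeg j < 4)%N.
Proof. by have := mon_bidegree j; rewrite /bidegree /cdeg; lia. Qed.

Lemma cexp_le j : (cexp j <= b + cdeg j)%N.
Proof. by have := mon_bidegree j; rewrite /bidegree /cdeg /cexp; lia. Qed.

Lemma cidx_inj i j : cdeg i = cdeg j -> cexp i = cexp j -> i = j.
Proof.
rewrite /cdeg /cexp => e1 e2; apply: mon_inj; apply: mnm4P => //.
all: have := mon_bidegree i; have := mon_bidegree j; rewrite /bidegree; lia.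
Qed.

Lemma cidx_ex k i : (k < 4)%N -> (i <= b + k)%N -> exists j, cdeg j = k /\ cexp j = i.
Proof.
move=> k4 ik; pose m : 'X_{1..4} := [multinom [tuple i; (b + k - i)%N; k; (3 - k)%N]].
have [m1 m2 m3 m4] : [/\ m vs = i, m vt = (b + k - i)%N, m vu = k & m vz = (3 - k)%N].
  by rewrite /m !multinomE !(tnth_nth 0%N).
have /tnthP[j ej] : m \in in_tuple (sect_mons 3 b).
  by rewrite /= mem_sect_mons /bidegree m1 m2 m3 m4; lia.
by exists j; rewrite /cdeg /cexp /mon -ej.
Qed.

Definition forms (c : 'I_n -> K) : nat -> {poly K} := fun k =>
  \sum_(j | cdeg j == k) c j *: 'X^(cexp j).

Definition coords F : 'I_n -> K := fun j => (F (cdeg j))`_(cexp j).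

Lemma coef_forms c j : (forms c (cdeg j))`_(cexp j) = c j.
Proof.
rewrite /forms coef_sum (bigD1 j) //= coefZ coefXn eqxx mulr1 big1 ?addr0 // => i /andP[/eqP ei ij].
rewrite coefZ coefXn (_ : _ == _ = false) ?mulr0 //; apply: contraNF ij => /eqP e.
by apply/eqP/cidx_inj.
Qed.

Lemma formsK c : coords (forms c) = c.
Proof. by apply: funext => j; rewrite /coords coef_forms. Qed.

Lemma fsize_forms c : fsize (forms c).
Proof.
move=> k; apply: leq_trans (size_sum _ _ _) _; apply/bigmax_leqP => j /eqP <-.
apply: leq_trans (size_scale_leq _ _) _; rewrite size_polyXn ltnS; exact: cexp_le.
Qed.

Lemma coordsK F k : fsize F -> (k < 4)%N -> forms (coords F) k = F k.
Proof.
move=> sF k4; apply/polyP => i; have [ik|ik] := leqP i (b + k).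
  by have [j [<- <-]] := cidx_ex k4 ik; rewrite coef_forms.
by rewrite !(leq_sizeP _ _ (leq_trans _ ik)) ?sF ?fsize_forms.
Qed.

Lemma feval_sect c (v : 'I_4 -> K) : (sect c).@[v] = feval (forms c) (v vs) (v vt) (v vu) (v vz).
Proof.
rewrite /sect raddf_sum /feval /=.
have eF (k : 'I_4) : heval (b + k) (forms c k) (v vs) (v vt) =
    \sum_(j | cdeg j == k) c j * (v vs ^+ cexp j * v vt ^+ (b + k - cexp j)).
  rewrite /forms heval_sum /=; apply: eq_bigr => j /eqP ej; rewrite hevalZ; congr (_ * _).
  have := cexp_le j; rewrite ej -ltnS => lt; rewrite /heval (bigD1 (Ordinal lt)) //=.
  rewrite coefXn eqxx mul1r big1 ?addr0 // => i ij; rewrite coefXn.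
  rewrite (_ : _ == _ = false) ?mul0r //; apply: contraNF ij => /eqP e; exact/eqP/val_inj.
rewrite (eq_bigr (fun k : 'I_4 => \sum_(j | cdeg j == k) v vu ^+ k * v vz ^+ (3 - k) *
   (c j * (v vs ^+ cexp j * v vt ^+ (b + k - cexp j))))); last first.
  by move=> k _; rewrite eF mulr_sumr.
rewrite (exchange_big_dep predT) //=; apply: eq_bigr => j _.
rewrite (big_pred1 (Ordinal (cdeg_lt j))) /=; last by move=> k /=; apply/eqP/eqP => [e|->] //; exact: val_inj.
rewrite mevalZ -/(mon j) mevalX big_ord4 [RHS]mulrCA; congr (c j * _).
rewrite /= /cdeg /cexp; have := mon_bidegree j; rewrite /bidegree => hj.
have -> : mon j vt = (b + mon j vu - mon j vs)%N by lia.
have -> : mon j vz = (3 - mon j vu)%N by lia.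
by ring.
Qed.

Definition cact g c : 'I_n -> K := coords (fact g (forms c)).

Lemma forms_cact g c k : (k < 4)%N -> forms (cact g c) k = fact g (forms c) k.
Proof. exact/coordsK/fsize_fact. Qed.

Lemma sect_cact g c (v : {ffun 'I_4 -> K}) : (sect (cact g c)).@[v] = (sect c).@[coxact g v].
Proof.
rewrite !feval_sect !ffunE /mkv /= -feval_fact; apply: eq_bigr => k _.
by rewrite forms_cact.
Qed.

Lemma sect_inj (c c' : 'I_n -> K) : (forall v : {ffun 'I_4 -> K}, (sect c).@[v] = (sect c').@[v]) -> c = c'.
Proof.
move=> e; rewrite -(formsK c) -(formsK c'); apply: funext => j; rewrite /coords.
rewrite (feval_inj (fsize_forms c) (fsize_forms c') _ (cdeg_lt j)) // => s t u z.
have := e (finfun (mkv s t u z)).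
by rewrite !feval_sect !ffunE.
Qed.

End CubicSections.

(** * Orbits in the linear system as orbits of a linear action *)

Section LinsysOrbits.
Variables (K : closedFieldType) (b : nat).
Implicit Types (F : nat -> {poly K}) (g h : coxmap K).
Local Notation n := (h0 3 b).
Implicit Types (c : 'I_n -> K).

Definition coxmul g h : coxmap K :=
  Coxmap (c11 g * c11 h + c12 g * c21 h) (c11 g * c12 h + c12 g * c22 h)
    (c21 g * c11 h + c22 g * c21 h) (c21 g * c12 h + c22 g * c22 h)
    (cu g * cu h) (cz g * cz h)
    (cz g * cs h + cu h * (cs g * c11 h + ct g * c21 h))
    (cz g * ct h + cu h * (cs g * c12 h + ct g * c22 h)).

Lemma coxact_mul g h v : coxact (coxmul g h) v = coxact g (coxact h v).
Proof.
by apply/ffunP => i; case: (ord4E i) => ->; rewrite !ffunE /mkv /= ?ffunE /=; ring.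
Qed.

Lemma coxmul_ok g h : cox_ok g -> cox_ok h -> cox_ok (coxmul g h).
Proof.
move=> [g1 g2 g3] [h1 h2 h3]; split; rewrite /= ?mulf_neq0 //.
by move: (mulf_neq0 g1 h1); congr (_ != 0); ring.
Qed.

(** [coxinv] moves the coordinate map to the side of [c], so that the point of the orbit becomes an
    explicit function of [c], namely a multiple of [cact g c]. *)
Lemma linsysE c c' : nonzero_vec c -> linsys_Aut c c' <->
  exists g k, [/\ cox_ok g, k != 0 & forall v : {ffun 'I_4 -> K},
    (sect c').@[v] = k * (sect c).@[coxact g v]].
Proof.
move=> /linsys_AutP ->; split=> -[g [k [ok k0 e]]].
  exists (coxinv g), k; split=> //; first exact: coxinv_ok.
  by move=> v; rewrite -e coxinvKV.
exists (coxinv g), k; split=> //; first exact: coxinv_ok.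
by move=> v; rewrite e coxinvKV.
Qed.

Lemma linsys_sym c c' : nonzero_vec c -> nonzero_vec c' -> linsys_Aut c c' -> linsys_Aut c' c.
Proof.
move=> c0 c'0 /(linsysE _ c0)[g [k [ok k0 e]]]; apply/(linsysE _ c'0).
exists (coxinv g), k^-1; split; rewrite ?invr_eq0 //; first exact: coxinv_ok.
by move=> v; rewrite e coxinvKV // mulKf.
Qed.

Lemma linsys_trans c c' c'' : nonzero_vec c -> nonzero_vec c' -> nonzero_vec c'' ->
  linsys_Aut c c' -> linsys_Aut c' c'' -> linsys_Aut c c''.
Proof.
move=> c0 c'0 c''0 /(linsysE _ c0)[g [k [ok k0 e]]] /(linsysE _ c'0)[g' [k' [ok' k'0 e']]].
apply/(linsysE _ c0); exists (coxmul g g'), (k' * k).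
split; rewrite ?mulf_neq0 //; first exact: coxmul_ok.
by move=> v; rewrite e' e coxact_mul mulrA.
Qed.

Definition cscale (k : K) c : 'I_n -> K := fun j => k * c j.

Lemma sect_cscale k c (v : 'I_4 -> K) : (sect (cscale k c)).@[v] = k * (sect c).@[v].
Proof.
rewrite /sect !raddf_sum mulr_sumr; apply: eq_bigr => j _ /=.
by rewrite !mevalZ mulrA.
Qed.

Lemma linsys_cact g k c : nonzero_vec c -> cox_ok g -> k != 0 ->
  linsys_Aut c (cscale k (cact g c)).
Proof.
move=> c0 ok k0; apply/(linsysE _ c0); exists g, k; split=> // v.
by rewrite sect_cscale sect_cact.
Qed.

Lemma linsys_cactE c c' : nonzero_vec c -> linsys_Aut c c' ->
  exists g k, [/\ cox_ok g, k != 0 & c' = cscale k (cact g c)].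
Proof.
move=> c0 /(linsysE _ c0)[g [k [ok k0 e]]]; exists g, k; split=> //.
by apply: sect_inj => v; rewrite e sect_cscale sect_cact.
Qed.

Definition cox1 : coxmap K := Coxmap 1 0 0 1 1 1 0 0.

Lemma cox1_ok : cox_ok cox1.
Proof. by split; rewrite /= ?mulr0 ?mulr1 ?subr0 oner_eq0. Qed.

Lemma coxact1 v : coxact cox1 v = v.
Proof.
by apply/ffunP => i; case: (ord4E i) => ->; rewrite !ffunE /mkv /=; ring.
Qed.

Lemma linsys_scale c c' (k : K) : nonzero_vec c -> k != 0 ->
  (forall j, c' j = k * c j) -> linsys_Aut c c'.
Proof.
move=> c0 k0 e; have -> : c' = cscale k c by apply: funext.
apply/(linsysE _ c0); exists cox1, k; split=> //; first exact: cox1_ok.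
by move=> v; rewrite sect_cscale coxact1.
Qed.

Lemma nonzero_cact g k c : cox_ok g -> k != 0 -> nonzero_vec c ->
  nonzero_vec (cscale k (cact g c)).
Proof.
move=> ok k0 [j cj]; apply: contrapT => nz.
have z : cscale k (cact g c) = fun _ => 0.
  by apply: funext => i; apply/eqP/negPn/negP => i0; apply: nz; exists i.
have s0 (v : 'I_4 -> K) : (sect c).@[v] = 0.
  apply: (mulfI k0); rewrite mulr0.
  rewrite (_ : (sect c).@[v] = (sect c).@[coxact g (coxact (coxinv g) (finfun v))]); last first.
    by rewrite coxinvKV //; apply: meval_eq => i; rewrite ffunE.
  rewrite -sect_cact -sect_cscale z /sect big1 ?meval0 // => i _; exact: scale0r.
have : sect c = 0.
  by apply: (@mpoly_eq_eval K 4 1); rewrite ?oner_neq0 // => v _; rewrite s0 meval0.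
by apply/eqP; apply: sect_neq0; exists j.
Qed.

End LinsysOrbits.

(** * Behaviour of the pairing under substitutions *)

Section Covariants.
Variables (K : closedFieldType).
Hypothesis natr_neq0 : forall k, k.+1%:R != 0 :> K.
Implicit Types (f h : {poly K}).

Lemma heval1 s t : heval 1 (1 : {poly K}) s t = t.
Proof. rewrite /heval !big_ord_recl big_ord0 /= !coef1 /=; ring. Qed.

Lemma heval_X s t : heval 1 ('X : {poly K}) s t = s.
Proof. rewrite /heval !big_ord_recl big_ord0 /= !coefX /=; ring. Qed.

Lemma size_mulX_leq m f : (size f <= m)%N -> (size (f * 'X)%R <= m.+1)%N.
Proof.
by move=> sf; apply: leq_trans (size_polyMleq _ _) _; rewrite size_polyX addn2.
Qed.

Section Substitution.
Variables (a11 a12 a21 a22 : K).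
Let A := lform a11 a12.
Let B := lform a21 a22.
Let d := a11 * a22 - a12 * a21.

(** Read in degree m + 1, [f * 'X] is s f while [f] itself is t f. This convention recurs below: a
    factor 'X marks evaluation of a functional at s, its absence evaluation at t. *)
Lemma hsub_mulX m f : (size f <= m.+1)%N ->
  hsub m.+1 A B (f * 'X) = a11 *: (hsub m A B f * 'X) + a12 *: hsub m A B f.
Proof.
move=> sf; have -> : a11 *: (hsub m A B f * 'X) + a12 *: hsub m A B f = hsub m A B f * A.
  by rewrite /A /lform mulrDr -scalerAr [_ * a12%:P]mulrC mul_polyC.
have sH : (size (hsub m A B f) <= m.+1)%N by rewrite size_hsub ?size_lform.
apply: (heval_inj (n := m.+1)).
- by rewrite size_hsub ?size_lform.
- apply: leq_trans (size_polyMleq _ _) _; have := size_lform a11 a12; rewrite -/A; lia.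
move=> s t; rewrite heval_hsub ?size_lform // -addn1 !hevalM ?size_lform ?size_polyX //.
by rewrite heval_hsub ?size_lform // heval_X.
Qed.

Lemma hsub_mul1 m f : (size f <= m.+1)%N ->
  hsub m.+1 A B f = a21 *: (hsub m A B f * 'X) + a22 *: hsub m A B f.
Proof.
move=> sf; have -> : a21 *: (hsub m A B f * 'X) + a22 *: hsub m A B f = hsub m A B f * B.
  by rewrite /B /lform mulrDr -scalerAr [_ * a22%:P]mulrC mul_polyC.
have sH : (size (hsub m A B f) <= m.+1)%N by rewrite size_hsub ?size_lform.
apply: (heval_inj (n := m.+1)).
- by rewrite size_hsub ?size_lform.
- apply: leq_trans (size_polyMleq _ _) _; have := size_lform a21 a22; rewrite -/B; lia.
move=> s t; rewrite heval_hsub ?size_lform // -{1}[f]mulr1 -addn1 !hevalM ?size_lform ?size_poly1 //.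
by rewrite heval_hsub ?size_lform // heval1.
Qed.

Lemma pair_hsub_s m f h : (size f <= m.+1)%N -> (size h <= m.+2)%N ->
  a11 * pair m.+1 (hsub m A B f * 'X) (hsub m.+1 A B h) +
  a12 * pair m.+1 (hsub m A B f) (hsub m.+1 A B h) =
  d ^+ m.+1 * pair m.+1 (f * 'X) h.
Proof.
move=> sf sh; rewrite -!pairZl -pairDl -hsub_mulX //.
by rewrite pair_hsub ?size_mulX_leq ?pairZl.
Qed.

Lemma pair_hsub_t m f h : (size f <= m.+1)%N -> (size h <= m.+2)%N ->
  a21 * pair m.+1 (hsub m A B f * 'X) (hsub m.+1 A B h) +
  a22 * pair m.+1 (hsub m A B f) (hsub m.+1 A B h) =
  d ^+ m.+1 * pair m.+1 f h.
Proof.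
move=> sf sh; rewrite -!pairZl -pairDl -hsub_mul1 //.
by rewrite pair_hsub ?(leqW sf) ?pairZl.
Qed.

(* The determinant of the bilinear form (l, l') |-> <l f, l' f> on linear forms. *)
Definition delta m f : K :=
  pair m.+1 (f * 'X) (f * 'X) * pair m.+1 f f - pair m.+1 (f * 'X) f * pair m.+1 f (f * 'X).

(** The Gram matrix of the transformed form is congruent, via the substitution matrix, to
    [d ^+ m.+1] times the old one; determinants are compared. *)
Lemma delta_hsub m f : (size f <= m.+1)%N ->
  d ^+ 2 * delta m (hsub m A B f) = d ^+ m.+1 ^+ 2 * delta m f.
Proof.
move=> sf; have sfX := size_mulX_leq sf; have sf1 := leqW sf.
have := pair_hsub natr_neq0 a11 a12 a21 a22 sfX sfX.
have := pair_hsub natr_neq0 a11 a12 a21 a22 sfX sf1.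
have := pair_hsub natr_neq0 a11 a12 a21 a22 sf1 sfX.
have := pair_hsub natr_neq0 a11 a12 a21 a22 sf1 sf1.
rewrite -/A -/B -/d hsub_mulX // hsub_mul1 // /delta !(pairDl, pairDr, pairZl, pairZr).
set f' := hsub m A B f; move: (d ^+ m.+1) => e.
move: (pair _ (f * _) (f * _)) (pair _ (f * _) f) (pair _ f (f * _)) (pair _ f f) => x1 x2 x3 x4.
move: (pair _ (f' * _) (f' * _)) (pair _ (f' * _) f') (pair _ f' (f' * _)) (pair _ f' f') => y1 y2 y3 y4.
move=> h4 h3 h2 h1.
transitivity ((e * x1) * (e * x4) - (e * x2) * (e * x3)); last by ring.
by rewrite -h1 -h2 -h3 -h4 /d; ring.
Qed.

End Substitution.

Lemma deltaZ m (k : K) f : delta m (k *: f) = k ^+ 4 * delta m f.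
Proof. by rewrite /delta -!scalerAl !(pairZl, pairZr); ring. Qed.

Lemma hsub_id m f : (size f <= m.+1)%N -> hsub m (lform 1 0) (lform 0 1) f = f.
Proof.
move=> sf; apply: (heval_inj (n := m)); rewrite ?size_hsub ?size_lform // => s t.
by rewrite heval_hsub ?size_lform // !heval_lform !mul0r !mul1r addr0 add0r.
Qed.

Lemma coef_hsub_diag m f (a d : K) i : (i <= m)%N ->
  (hsub m (lform a 0) (lform 0 d) f)`_i = a ^+ i * d ^+ (m - i) * f`_i.
Proof.
move=> im; have lt : (i < m.+1)%N by [].
rewrite /hsub coef_sum (bigD1 (Ordinal lt)) //= /lform scale0r add0r addr0.
rewrite big1 ?addr0 => [|k ki]; rewrite coefZ exprZn -rmorphXn -scalerAl coefZ coefMC coefXn.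
  by rewrite eqxx mul1r; ring.
rewrite (_ : (i == k)%N = false) ?mul0r ?mulr0 //.
by apply: contraNF ki => /eqP e; apply/eqP/val_inj.
Qed.

End Covariants.

(** * The slice *)

Section NormalForm.
Variables (K : closedFieldType) (b : nat).
Hypothesis natr_neq0 : forall k, k.+1%:R != 0 :> K.
Implicit Types (F : nat -> {poly K}) (g h : coxmap K).

(* The covariant linear functional l |-> <F_k l, F_(k+1)>, evaluated at s and t. *)
Definition Ts k F : K := pair (b + k).+1 (F k * 'X) (F k.+1).
Definition Tt k F : K := pair (b + k).+1 (F k) (F k.+1).

(** The substitution matrix times the new vector of values (Ts, Tt) is a multiple of the old one.
    The factors [e] make room for scalars such as powers of [cu] and [cz]. *)
Lemma T_transform a11 a12 a21 a22 (e : nat -> K) F F' k : fsize b F ->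
  F' k = e k *: hsub (b + k) (lform a11 a12) (lform a21 a22) (F k) ->
  F' k.+1 = e k.+1 *: hsub (b + k.+1) (lform a11 a12) (lform a21 a22) (F k.+1) ->
  a11 * Ts k F' + a12 * Tt k F' =
    e k * e k.+1 * (a11 * a22 - a12 * a21) ^+ (b + k).+1 * Ts k F /\
  a21 * Ts k F' + a22 * Tt k F' =
    e k * e k.+1 * (a11 * a22 - a12 * a21) ^+ (b + k).+1 * Tt k F.
Proof.
move=> sF e1 e2; rewrite /Ts /Tt e1 e2 -scalerAl !(pairZl, pairZr) !addnS.
have sF1 := sF k.+1; rewrite addnS in sF1.
have es := pair_hsub_s natr_neq0 a11 a12 a21 a22 (sF k) sF1.
have et := pair_hsub_t natr_neq0 a11 a12 a21 a22 (sF k) sF1.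
by split; rewrite -mulrA -?es -?et; ring.
Qed.

Lemma fact_diag g F k : cs g = 0 -> ct g = 0 -> (k < 4)%N -> fact b g F k =
  (cz g ^+ (3 - k) * cu g ^+ k) *:
    hsub (b + k) (lform (c11 g) (c12 g)) (lform (c21 g) (c22 g)) (F k).
Proof.
move=> e1 e2; rewrite /fact e1 e2.
have -> : lform (0 : K) 0 = 0 by rewrite /lform scale0r addr0.
case: k => [|[|[|[|//]]]] _.
- by rewrite expr0 mulr1.
- by rewrite mul0r scaler0 addr0 scalerA expr1.
- by rewrite expr0n !mul0r !scaler0 !addr0 scalerA expr1.
- by rewrite !expr0n !mul0r !scaler0 !addr0 expr0 mul1r.
Qed.

(** With l written as x A + y B in the substituted linear forms, the substitution can be pulled out
    of the combination of F_1 and l F_0. *)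
Lemma fact01 g F x y : fsize b F -> cs g = x * c11 g + y * c21 g -> ct g = x * c12 g + y * c22 g ->
  let H := hsub b (lform (c11 g) (c12 g)) (lform (c21 g) (c22 g)) in
  let H1 := hsub b.+1 (lform (c11 g) (c12 g)) (lform (c21 g) (c22 g)) in
  fact b g F 0 = cz g ^+ 3 *: H (F 0%N) /\ fact b g F 1 = cz g ^+ 2 *:
    H1 (cu g *: F 1%N + 3%:R *: (x *: (F 0%N * 'X) + y *: F 0%N)).
Proof.
move=> sF e1 e2 H H1; have sF0 := sF 0%N; rewrite addn0 in sF0.
rewrite /= addn0 addn1; split=> //; congr (_ *: _).
have hD (f1 f2 : {poly K}) : H1 (f1 + f2) = H1 f1 + H1 f2.
  by rewrite /H1 /hsub -big_split; apply: eq_bigr => i _; rewrite coefD scalerDl.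
have hZ (k : K) (f : {poly K}) : H1 (k *: f) = k *: H1 f.
  by rewrite /H1 /hsub scaler_sumr; apply: eq_bigr => i _; rewrite coefZ scalerA.
rewrite !(hD, hZ) /H1 hsub_mulX // (hsub_mul1 _ _ _ _ sF0) // -/H; congr (_ + _ *: _).
by rewrite e1 e2 /lform -!mul_polyC !polyCD !polyCM; ring.
Qed.

Definition dl F : K := delta b (F 0%N).

(* The translation z |-> z + l u kills the functional (Ts 0, Tt 0). *)
Definition xs F : K :=
  - (Ts 0 F * pair b.+1 (F 0%N) (F 0%N) - Tt 0 F * pair b.+1 (F 0%N * 'X) (F 0%N)) / 3%:R.
Definition xt F : K :=
  - (pair b.+1 (F 0%N * 'X) (F 0%N * 'X) * Tt 0 F - pair b.+1 (F 0%N) (F 0%N * 'X) * Ts 0 F)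
    / 3%:R.

(** [xs] and [xt] are the Cramer numerators, divided by the 3 from the cube of z + l u. The
    determinant is cleared through [cu = cz = dl F], which keeps the map polynomial in [F]. *)
Definition gA F : coxmap K := Coxmap 1 0 0 1 (dl F) (dl F) (xs F) (xt F).
Definition FA F := fact b (gA F) F.

Lemma FA01 F : fsize b F -> FA F 0%N = dl F ^+ 3 *: F 0%N /\
  FA F 1%N = dl F ^+ 2 *: (dl F *: F 1%N + 3%:R *: (xs F *: (F 0%N * 'X) + xt F *: F 0%N)).
Proof.
move=> sF; have sF0 := sF 0%N; rewrite addn0 in sF0; have sF1 := sF 1%N; rewrite addn1 in sF1.
have [] := @fact01 (gA F) F (xs F) (xt F) sF; rewrite /= ?mulr1 ?mulr0 ?addr0 ?add0r //.
move=> e0 e1; rewrite /FA e0 e1 hsub_id // hsub_id //.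
apply: leq_trans (size_polyD _ _) _; rewrite geq_max.
rewrite (leq_trans (size_scale_leq _ _)) //= (leq_trans (size_scale_leq _ _)) //.
apply: leq_trans (size_polyD _ _) _; rewrite geq_max.
rewrite (leq_trans (size_scale_leq _ _)) ?size_mulX_leq //=.
by rewrite (leq_trans (size_scale_leq _ _)) // leqW.
Qed.

Lemma three_neq0 : 3%:R != 0 :> K. Proof. exact: natr_neq0. Qed.

Lemma T0_FA F : fsize b F -> Ts 0 (FA F) = 0 /\ Tt 0 (FA F) = 0.
Proof.
move=> sF; have [e0 e1] := FA01 sF; have t0 := three_neq0.
rewrite /Ts /Tt e0 e1 -scalerAl !(pairZl, pairZr, pairDr) /xs /xt /Ts /Tt !addn0.
rewrite /dl /delta.
move: (pair _ (F 0%N * 'X) (F 0%N * 'X)) (pair _ (F 0%N * 'X) (F 0%N)) => x1 x2.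
move: (pair _ (F 0%N) (F 0%N * 'X)) (pair _ (F 0%N) (F 0%N)) => x3 x4.
move: (pair _ (F 0%N * 'X) (F 1%N)) (pair _ (F 0%N) (F 1%N)) => x5 x6.
by split; field.
Qed.

(* The substitution by the vectors dual to T_1 and T_2 makes T_1 vanish at t and
   T_2 at s. *)
Definition gB F : coxmap K := Coxmap (Ts 1 F) (Ts 2 F) (Tt 1 F) (Tt 2 F) 1 1 0 0.
Definition detB F : K := Ts 1 F * Tt 2 F - Ts 2 F * Tt 1 F.
Definition FB F := fact b (gB (FA F)) (FA F).

Lemma FBE F k : (k < 4)%N -> FB F k = 1 *: hsub (b + k)
  (lform (Ts 1 (FA F)) (Ts 2 (FA F))) (lform (Tt 1 (FA F)) (Tt 2 (FA F))) (FA F k).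
Proof. by move=> k4; rewrite /FB fact_diag //= !expr1n mulr1. Qed.

Lemma linear_system_unique (x1 x2 y1 y2 u v : K) : x1 * y2 - x2 * y1 != 0 ->
  x1 * u + x2 * v = 0 -> y1 * u + y2 * v = 0 -> u = 0 /\ v = 0.
Proof.
move=> d0 e1 e2; split; apply: (mulfI d0); rewrite mulr0.
  transitivity (y2 * (x1 * u + x2 * v) - x2 * (y1 * u + y2 * v)); first by ring.
  by rewrite e1 e2 !mulr0 subr0.
transitivity (x1 * (y1 * u + y2 * v) - y1 * (x1 * u + x2 * v)); first by ring.
by rewrite e1 e2 !mulr0 subr0.
Qed.

(** The values of T_1 and T_2 are the columns of the substitution matrix. By [T_transform] the
    matrix sends the new values to multiples of its own columns, so the new values are multiples of
    the two unit vectors. *)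
Lemma T_FB F : fsize b F -> detB (FA F) != 0 ->
  [/\ Ts 0 (FB F) = 0 /\ Tt 0 (FB F) = 0, Ts 1 (FB F) != 0 /\ Tt 1 (FB F) = 0
    & Ts 2 (FB F) = 0 /\ Tt 2 (FB F) != 0].
Proof.
move=> sF d0; have sA : fsize b (FA F) := fsize_fact _ _ _.
have tr k (k3 : (k < 3)%N) := T_transform sA (@FBE F k (ltnW k3)) (@FBE F k.+1 k3) (e := fun=> 1).
have [s0 t0] := tr 0%N isT; have [s1 t1] := tr 1%N isT; have [s2 t2] := tr 2%N isT.
have [z0 z1] := T0_FA sF; rewrite z0 z1 !mulr0 in s0 t0.
set u := Ts 1 (FA F) in d0 s0 t0 s1 t1 s2 t2 *; set v := Tt 1 (FA F) in d0 s0 t0 s1 t1 s2 t2 *.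
set u' := Ts 2 (FA F) in d0 s0 t0 s1 t1 s2 t2 *; set v' := Tt 2 (FA F) in d0 s0 t0 s1 t1 s2 t2 *.
rewrite /detB -/u -/u' -/v -/v' in d0.
rewrite !mul1r in s1 t1 s2 t2.
have ne k : (u * v' - u' * v) ^+ k != 0 by rewrite expf_neq0.
move: s1 t1 s2 t2; move: (ne (b + 1).+1) (ne (b + 2).+1).
move: (_ ^+ (b + 1).+1) (_ ^+ (b + 2).+1) => d1 d2 d10 d20 s1 t1 s2 t2.
have [x1 x2] : Ts 1 (FB F) - d1 = 0 /\ Tt 1 (FB F) = 0.
  apply: (linear_system_unique d0).
    by rewrite mulrBr addrAC s1; ring.
  by rewrite mulrBr addrAC t1; ring.
have [x3 x4] : Ts 2 (FB F) = 0 /\ Tt 2 (FB F) - d2 = 0.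
  apply: (linear_system_unique d0).
    by rewrite mulrBr addrA s2; ring.
  by rewrite mulrBr addrA t2; ring.
split; first exact: linear_system_unique d0 s0 t0.
  by rewrite (subr0_eq x1).
by rewrite (subr0_eq x4).
Qed.

(** The coefficients of s^b in F_0, of s^(b+1) in F_1 and of s^(b+1) t in F_2. For a diagonal
    substitution their successive weights differ by the factors of s and t. *)
Definition pp F : K := (F 0%N)`_b.
Definition rr F : K := (F 1%N)`_b.+1.
Definition qq F : K := (F 2%N)`_b.+1.

Definition gen F : K := dl F * detB (FA F) * (pp (FB F) * rr (FB F) * qq (FB F)).

Definition slice F : Prop :=
  [/\ [/\ pp F = 1, rr F = 1 & qq F = 1], Ts 0 F = 0 /\ Tt 0 F = 0, Tt 1 F = 0 & Ts 2 F = 0].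

(** On the slice the translation is zero, so [gA] multiplies all forms by the cube of [dl F], and
    [gB] is diagonal with entries proportional to [Ts 1 F] and [Tt 2 F]. Thus [gen] is a product of
    powers of these three. *)
Lemma gen_slice F : fsize b F -> slice F ->
  (gen F != 0) = [&& dl F != 0, Ts 1 F != 0 & Tt 2 F != 0].
Proof.
move=> sF [[p1 r1 q1] [s0 t0] t1 s2].
have [xs0 xt0] : xs F = 0 /\ xt F = 0 by rewrite /xs /xt s0 t0 !mulr0 !mul0r subr0 oppr0 mul0r.
have eA k : (k < 4)%N -> FA F k = dl F ^+ 3 *: F k.
  move=> k4; rewrite /FA fact_diag //= -exprD subnK // hsub_id //; exact: sF.
have ds2 : Ts 1 (FA F) = dl F ^+ 6 * Ts 1 F.
  by rewrite /Ts !eA // -scalerAl !(pairZl, pairZr) mulrA -exprD.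
have ds3 : Tt 2 (FA F) = dl F ^+ 6 * Tt 2 F.
  by rewrite /Tt !eA // !(pairZl, pairZr) mulrA -exprD.
have ds4 : Tt 1 (FA F) = 0.
  by rewrite /Tt !eA // !(pairZl, pairZr) -/(Tt 1 F) t1 !mulr0.
have ds5 : Ts 2 (FA F) = 0.
  by rewrite /Ts !eA // -scalerAl !(pairZl, pairZr) -/(Ts 2 F) s2 !mulr0.
have eB k i : (k < 4)%N -> (i <= b + k)%N -> (FB F k)`_i =
    Ts 1 (FA F) ^+ i * Tt 2 (FA F) ^+ (b + k - i) * dl F ^+ 3 * (F k)`_i.
  move=> k4 ik; rewrite FBE // scale1r ds4 ds5 coef_hsub_diag // eA // coefZ; ring.
rewrite /gen /pp /rr /qq !eB ?leq_addr ?addn1 ?addn2 //.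
rewrite -/(pp F) -/(rr F) -/(qq F) p1 r1 q1 /detB ds2 ds3 ds4 ds5 mul0r subr0.
rewrite !(mulf_eq0, expf_eq0) oner_eq0 /=.
by case: (dl F == 0); case: (Ts 1 F == 0); case: (Tt 2 F == 0); rewrite ?andbF ?orbT ?andbT ?orbF //= ?andbF.
Qed.

End NormalForm.

(** * Existence and uniqueness of the normal form *)

Section Slice.
Variables (K : closedFieldType) (b : nat).
Hypothesis natr_neq0 : forall k, k.+1%:R != 0 :> K.
Implicit Types (F : nat -> {poly K}) (g : coxmap K).

Local Notation Ts := (Ts b).
Local Notation Tt := (Tt b).
Local Notation FA := (FA b).
Local Notation FB := (FB b).
Local Notation pp := (pp b).
Local Notation rr := (rr b).
Local Notation qq := (qq b).

(** These ratios bring all three coefficients to the common value [pp F * (pp F / rr F) ^+ b], which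
    [kC] scales to 1. *)
Definition gC F : coxmap K := Coxmap (pp F / rr F) 0 0 (rr F / qq F) 1 1 0 0.
Definition kC F : K := (pp F * (pp F / rr F) ^+ b)^-1.
Definition FC F : nat -> {poly K} := fun k => kC (FB F) *: fact b (gC (FB F)) (FB F) k.

Lemma fsize_FC F : fsize b (FC F).
Proof. by move=> k; rewrite (leq_trans (size_scale_leq _ _)) // fsize_fact. Qed.

Lemma FCE F k : (k < 4)%N -> FC F k = kC (FB F) *: hsub (b + k)
  (lform (pp (FB F) / rr (FB F)) 0) (lform 0 (rr (FB F) / qq (FB F))) (FB F k).
Proof. by move=> k4; rewrite /FC fact_diag //= !expr1n mulr1 scale1r. Qed.

Lemma genP F : gen b F != 0 -> [/\ dl b F != 0, detB b (FA F) != 0, pp (FB F) != 0,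
  rr (FB F) != 0 & qq (FB F) != 0].
Proof. by rewrite !mulf_eq0 !negb_or => /andP[/andP[-> ->] /andP[/andP[-> ->] ->]]. Qed.

Lemma coef_FC F k i : (k < 4)%N -> (i <= b + k)%N -> (FC F k)`_i = kC (FB F) *
  ((pp (FB F) / rr (FB F)) ^+ i * (rr (FB F) / qq (FB F)) ^+ (b + k - i) * (FB F k)`_i).
Proof. by move=> k4 ik; rewrite FCE // coefZ coef_hsub_diag. Qed.

(** A diagonal substitution multiplies each value of T_k by a nonzero factor, so the zeros achieved
    by [FB] persist; [delta_hsub] and [deltaZ] keep [dl] nonzero through both substitutions. *)
Lemma slice_FC F : fsize b F -> gen b F != 0 -> slice b (FC F) /\ gen b (FC F) != 0.
Proof.
move=> sF /genP[dl0 dB0 p0 r0 q0].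
have sA : fsize b (FA F) by exact: fsize_fact.
have sB : fsize b (FB F) by exact: fsize_fact.
have [[s0 t0] [s1 t1] [s2 t2]] := T_FB natr_neq0 sF dB0.
have k0 : kC (FB F) != 0.
  by rewrite invr_eq0 mulf_neq0 ?expf_neq0 ?mulf_neq0 ?invr_eq0.
set a := pp (FB F) / rr (FB F); set d := rr (FB F) / qq (FB F).
have a0 : a != 0 by rewrite mulf_neq0 ?invr_eq0.
have d0 : d != 0 by rewrite mulf_neq0 ?invr_eq0.
have tr k (k3 : (k < 3)%N) := T_transform natr_neq0 sB (@FCE F k (ltnW k3)) (@FCE F k.+1 k3)
  (e := fun=> kC (FB F)).
have tz k : (k < 3)%N -> (Ts k (FC F) == 0) = (Ts k (FB F) == 0) /\
    (Tt k (FC F) == 0) = (Tt k (FB F) == 0).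
  move=> /tr[]; rewrite -/a -/d !mul0r !addr0 add0r subr0 => e1 e2.
  have E0 : kC (FB F) * kC (FB F) * (a * d) ^+ (b + k).+1 != 0.
    by apply: mulf_neq0; [apply: mulf_neq0|apply: expf_neq0; apply: mulf_neq0].
  split.
    by rewrite -[LHS](inj_eq (mulfI a0)) e1 mulr0 mulf_eq0 (negbTE E0).
  by rewrite -[LHS](inj_eq (mulfI d0)) e2 mulr0 mulf_eq0 (negbTE E0).
have slFC : slice b (FC F).
  split; last 3 first.
  - by split; apply/eqP; rewrite ?(tz 0%N _).1 ?(tz 0%N _).2 ?s0 ?t0.
  - by apply/eqP; rewrite (tz 1%N _).2 ?t1.
  - by apply/eqP; rewrite (tz 2%N _).1 ?s2.
  have e1 : (b + 1 - b.+1 = 0)%N by rewrite addn1 subnn.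
  have e2 : (b + 2 - b.+1 = 1)%N by rewrite addn2 subSS subSnn.
  have an k : a ^+ k != 0 by rewrite expf_neq0.
  have b2 : (b.+1 <= b + 2)%N by rewrite addn2.
  split; rewrite /pp /rr /qq coef_FC ?addn0 ?subnn ?e1 ?e2 ?addn1 //.
  - by rewrite -/(pp (FB F)) /kC -/a mulr1; field; rewrite p0 an.
  - rewrite -/(rr (FB F)) /kC -/a mulr1 exprS; move: (an b); rewrite /a.
    by move: (_ ^+ b) => x x0; field; rewrite p0 x0 r0.
  - rewrite -/(qq (FB F)) /kC -/a exprS; move: (an b); rewrite /a.
    by move: (_ ^+ b) => x x0; field; rewrite p0 x0 r0 q0.
split=> //; rewrite gen_slice //; last exact: fsize_FC.
rewrite (tz 1%N _).1 // (tz 2%N _).2 // s1 t2 !andbT.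
have dA0 : dl b (FA F) != 0.
  by rewrite /dl (FA01 sF).1 deltaZ mulf_neq0 ?expf_neq0.
have dlt a11 a12 a21 a22 (f : {poly K}) : (size f <= b.+1)%N -> a11 * a22 - a12 * a21 != 0 ->
    delta b f != 0 -> delta b (hsub b (lform a11 a12) (lform a21 a22) f) != 0.
  move=> sf n0 f0; have := delta_hsub natr_neq0 a11 a12 a21 a22 sf.
  apply: contra_eq_neq => ->; rewrite mulr0 eq_sym.
  by rewrite mulf_neq0 // !expf_neq0.
have sA0 := sA 0%N; rewrite addn0 in sA0; have sB0 := sB 0%N; rewrite addn0 in sB0.
have dB : dl b (FB F) != 0.
  by rewrite /dl FBE // addn0 scale1r; apply: dlt.
rewrite /dl FCE // addn0 deltaZ; apply: mulf_neq0; first exact: expf_neq0.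
by apply: dlt => //; rewrite mul0r subr0; exact: mulf_neq0.
Qed.

Lemma fact_ext g F F' k : (forall k, (k < 4)%N -> F k = F' k) -> (k < 4)%N ->
  fact b g F k = fact b g F' k.
Proof. by move=> e; case: k => [|[|[|[|//]]]] _; rewrite /fact !e. Qed.

(** Vanishing of T_0 on both sides forces l = 0, vanishing of T_1 at t and of T_2 at s makes the
    matrix diagonal, and the normalized coefficients leave only maps that act trivially. *)
Lemma slice_unique F F' g (k : K) : fsize b F -> fsize b F' -> slice b F -> slice b F' ->
  gen b F != 0 -> gen b F' != 0 -> cox_ok g -> k != 0 ->
  (forall m, (m < 4)%N -> F' m = k *: fact b g F m) -> forall m, (m < 4)%N -> F' m = F m.
Proof.
move=> sF sF' sl sl' gn gn' [d0 u0 z0] k0 eF'.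
move: gn gn'; rewrite !gen_slice // => /and3P[dl0 s10 t20] /and3P[dl'0 s1'0 t2'0].
case: sl => [[p1 r1 q1] [s0 t0] t1 s2]; case: sl' => [[p1' r1' q1'] [s0' t0'] t1' s2'].
pose d := c11 g * c22 g - c12 g * c21 g.
pose x := (cs g * c22 g - ct g * c21 g) / d; pose y := (ct g * c11 g - cs g * c12 g) / d.
have ecs : cs g = x * c11 g + y * c21 g by rewrite /x /y /d; field.
have ect : ct g = x * c12 g + y * c22 g by rewrite /x /y /d; field.
have [e0 e1] := fact01 sF ecs ect.
(* The pulled back F_0 and F_1 are plain substitutions in these two forms even if l is nonzero, so
   [T_transform] applies to T_0. *)
pose G m := if m is 0%N then F 0%N else if m is 1%N then
  cu g *: F 1%N + 3%:R *: (x *: (F 0%N * 'X) + y *: F 0%N) else 0.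
have sF0 := sF 0%N; have sF1 := sF 1%N.
have sG : fsize b G.
  case=> [|[|m]]; rewrite /G ?size_poly0 //.
  rewrite addn0 in sF0.
  apply: leq_trans (size_polyD _ _) _; rewrite geq_max (leq_trans (size_scale_leq _ _)) //=.
  apply: leq_trans (size_scale_leq _ _) _; apply: leq_trans (size_polyD _ _) _.
  rewrite geq_max !(leq_trans (size_scale_leq _ _)) // addn1 ?size_mulX_leq //.
  exact: leqW.
have := @T_transform K b natr_neq0 (c11 g) (c12 g) (c21 g) (c22 g)
  (fun m => k * cz g ^+ (3 - m)) G F' 0 sG.
rewrite !eF' // e0 e1 addn0 addn1 !scalerA => /(_ erefl erefl).
rewrite s0' t0' !mulr0 addr0 -/d => -[/esym/eqP + /esym/eqP].
rewrite !mulf_eq0 !expf_eq0 (negbTE k0) (negbTE z0) (negbTE d0) !andbF /=.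
rewrite /Ts /Tt /G !(pairZr, pairDr) addn0.
have -> : pair b.+1 (F 0%N * 'X) (F 1%N) = Ts 0 F by rewrite /Ts addn0.
have -> : pair b.+1 (F 0%N) (F 1%N) = Tt 0 F by rewrite /Tt addn0.
rewrite s0 t0 !mulr0 !add0r !mulf_eq0 (negbTE (three_neq0 natr_neq0)) /=.
rewrite [x * _ + _]addrC [X in _ + X]mulrC [X in X + _]mulrC.
rewrite [x * _ + _]addrC [X in _ -> (_ + X == _) -> _]mulrC [X in _ -> (X + _ == _) -> _]mulrC.
move=> /eqP l1 /eqP l2.
(* The linear form x s + y t is annihilated by the bilinear form of F_0, whose determinant is
   [dl F]. *)
have [x0 y0] : x = 0 /\ y = 0.
  apply: (@linear_system_unique K (pair b.+1 (F 0%N * 'X) (F 0%N * 'X)) (pair b.+1 (F 0%N * 'X) (F 0%N))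
    (pair b.+1 (F 0%N) (F 0%N * 'X)) (pair b.+1 (F 0%N) (F 0%N))).
  - exact: dl0.
  - by rewrite -[RHS]l1; ring.
  - by rewrite -[RHS]l2; ring.
have cs0 : cs g = 0 by rewrite ecs x0 y0 !mul0r addr0.
have ct0 : ct g = 0 by rewrite ect x0 y0 !mul0r addr0.
pose N m := k * (cz g ^+ (3 - m) * cu g ^+ m).
have eN m : (m < 4)%N -> F' m = N m *:
    hsub (b + m) (lform (c11 g) (c12 g)) (lform (c21 g) (c22 g)) (F m).
  by move=> m4; rewrite eF' // fact_diag // scalerA.
have [_ h1] := T_transform natr_neq0 sF (@eN 1%N isT) (@eN 2%N isT).
have [h2 _] := T_transform natr_neq0 sF (@eN 2%N isT) (@eN 3%N isT).
have c210 : c21 g = 0.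
  move: h1; rewrite t1 t1' !mulr0 addr0 => /eqP; rewrite mulf_eq0 (negbTE s1'0) orbF.
  by move=> /eqP.
have c120 : c12 g = 0.
  move: h2; rewrite s2 s2' !mulr0 add0r => /eqP; rewrite mulf_eq0 (negbTE t2'0) orbF.
  by move=> /eqP.
have coefF' m i : (m < 4)%N -> (i <= b + m)%N ->
    (F' m)`_i = N m * (c11 g ^+ i * c22 g ^+ (b + m - i) * (F m)`_i).
  by move=> m4 im; rewrite eN // c120 c210 coefZ coef_hsub_diag.
have e2 : (b + 1 - b.+1 = 0)%N by rewrite addn1 subnn.
have e3 : (b + 2 - b.+1 = 1)%N by rewrite addn2 subSS subSnn.
have E0 : N 0%N * c11 g ^+ b = 1.
  rewrite -p1' /pp coefF' ?addn0 // subnn -/(pp F) p1; ring.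
have E1 : N 1%N * c11 g ^+ b.+1 = 1.
  rewrite -r1' /rr coefF' ?addn1 // subnn -/(rr F) r1; ring.
have E2 : N 2%N * (c11 g ^+ b.+1 * c22 g) = 1.
  rewrite -q1' /qq coefF' ?e3 //; last by rewrite addn2.
  by rewrite -/(qq F) q1 mulr1.
have NE m : (m < 4)%N -> N m * cz g ^+ m = N 0%N * cu g ^+ m.
  move=> m4; rewrite /N expr0 mulr1; have -> : cz g ^+ (3 - 0) = cz g ^+ (3 - m) * cz g ^+ m.
    by rewrite -exprD subn0 subnK.
  by ring.
(* With the next two equations, [g] acts as the torus element with [l = c11 g] and [m = cz g] that
   defines F_1; its scalar effect is cancelled by [k]. *)
have za : cz g = cu g * c11 g.
  have := NE 1%N isT; rewrite !expr1 => e; rewrite -[LHS]mulr1 -E1 mulrCA mulrA [_ * cz g]mulrC.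
  transitivity (N 1%N * cz g * c11 g ^+ b.+1); first by ring.
  by rewrite e exprS -[RHS]mulr1 -E0; ring.
have zd : cz g = cu g * c22 g.
  apply: (mulfI z0); transitivity (cz g ^+ 2 * (N 2%N * (c11 g ^+ b.+1 * c22 g))).
    by rewrite E2; ring.
  transitivity (N 2%N * cz g ^+ 2 * (c11 g ^+ b.+1 * c22 g)); first by ring.
  rewrite NE // {1}za (exprS _ b); transitivity (N 0%N * c11 g ^+ b * (cu g ^+ 2 * c11 g * c22 g)); first by ring.
  by rewrite E0; ring.
have ad : c22 g = c11 g by apply: (mulfI u0); rewrite -za -zd.
move=> m m4; apply/polyP => i; have [im|im] := leqP i (b + m); last first.
  by rewrite !(leq_sizeP _ _ (leq_trans _ im)).
rewrite coefF' // ad -exprD subnKC // mulrA -[RHS]mul1r; congr (_ * _).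
apply: (mulfI (expf_neq0 m z0)); rewrite mulr1 exprD.
transitivity (N m * cz g ^+ m * (c11 g ^+ b * c11 g ^+ m)); first by ring.
rewrite NE // za exprMn; transitivity (N 0%N * c11 g ^+ b * (cu g ^+ m * c11 g ^+ m)); first by ring.
by rewrite E0 mul1r.
Qed.

End Slice.

(** * A polynomial parametrization of the slice *)

Section Fill.
Variables (K : closedFieldType) (b : nat).
Hypothesis natr_neq0 : forall k, k.+1%:R != 0 :> K.
Hypothesis b_ge2 : (2 <= b)%N.
Implicit Types (F : nat -> {poly K}) (f h : {poly K}).
Local Notation n := (h0 3 b).

(** The coefficient of [h] at m - i is paired with that of [f] at i. When the latter is 1, changing
    the former kills the pairing with only a constant divisor, so the result is polynomial in both
    forms. *)
Definition solve m i (f h : {poly K}) : {poly K} :=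
  h - (pair m f h / ((-1) ^+ i * (i`! * (m - i)`!)%:R)) *: 'X^(m - i).

Lemma pair_coef_neq0 m i : (-1) ^+ i * (i`! * (m - i)`!)%:R != 0 :> K.
Proof. by rewrite mulf_neq0 ?signr_eq0 // natrM mulf_neq0 // fact_neq0. Qed.

Lemma pair_solve m i f h : (i <= m)%N -> f`_i = 1 -> pair m f (solve m i f h) = 0.
Proof.
move=> im fi; rewrite /solve -scaleNr pairDr pairZr pairXn // fi mulr1.
by rewrite mulNr divfK ?subrr // pair_coef_neq0.
Qed.

Lemma coef_solve m i f h j : j != (m - i)%N -> (solve m i f h)`_j = h`_j.
Proof. by move=> ji; rewrite coefB coefZ coefXn (negbTE ji) mulr0 subr0. Qed.

Lemma size_solve m i f h : (size h <= m.+1)%N -> (size (solve m i f h) <= m.+1)%N.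
Proof.
move=> sh; apply: leq_trans (size_polyD _ _) _; rewrite geq_max sh size_polyN /=.
by apply: leq_trans (size_scale_leq _ _) _; rewrite size_polyXn ltnS leq_subr.
Qed.

Definition fill0 F : {poly K} := F 0%N + 'X^b.
(** Each equation is solved against a coefficient already set to 1: s^b in F_0 governs the
    coefficients 1 and 0 of F_1, s^(b+1) in F_1 the coefficient 1 of F_2, and s^(b+1) in F_2 the
    coefficient 1 of F_3. *)
Definition fill1 F : {poly K} :=
  solve b.+1 b.+1 (fill0 F * 'X) (solve b.+1 b (fill0 F) (F 1%N + 'X^(b.+1))).
Definition fill2 F : {poly K} := solve b.+2 b.+1 (fill1 F) (F 2%N + 'X^(b.+1)).
Definition fill3 F : {poly K} := solve b.+3 b.+2 (fill2 F * 'X) (F 3%N).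

Definition fill F : nat -> {poly K} := fun k =>
  match k with
  | 0%N => fill0 F
  | 1%N => fill1 F
  | 2%N => fill2 F
  | 3%N => fill3 F
  | _ => 0
  end.

(* (k, i) stands for the coefficient of s^i in F_k. *)
Definition determined : seq (nat * nat) :=
  [:: (0, b); (1, b.+1); (1, 1); (1, 0); (2, b.+1); (2, 1); (3, 1)]%N.

Definition free_index (j : 'I_n) : bool := (cdeg j, cexp j) \notin determined.

Definition zero_off_free F : Prop := forall k i, (k, i) \in determined -> (F k)`_i = 0.

Lemma fsize_fill F : fsize b F -> fsize b (fill F).
Proof.
move=> sF; have s0 : (size (fill0 F) <= b.+1)%N.
  have := sF 0%N; rewrite addn0 => sF0.
  by apply: leq_trans (size_polyD _ _) _; rewrite geq_max sF0 size_polyXn leqnn.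
have sX k m : (size (F k) <= m.+2)%N -> (b <= m)%N -> (size (F k + 'X^(b.+1) : {poly K})%R <= m.+2)%N.
  by move=> s1 bm; apply: leq_trans (size_polyD _ _) _; rewrite geq_max s1 size_polyXn.
have := sF 1%N; have := sF 2%N; have := sF 3%N; rewrite addn1 addn2 addn3 => s3 s2 s1.
case=> [|[|[|[|k]]]]; rewrite ?size_poly0 // ?addn0 ?addn1 ?addn2 ?addn3 //=.
- by apply: size_solve; apply: size_solve; apply: sX.
- by apply: size_solve; apply: sX.
- exact: size_solve.
Qed.

Lemma coef_fill F k i : (k < 4)%N -> (k, i) \notin determined -> (fill F k)`_i = (F k)`_i.
Proof.
move=> k4; rewrite /determined !inE !negb_or !xpair_eqE.
case: k k4 => [|[|[|[|//]]]] _ /=; rewrite ?andbT ?andbF //=.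
- by move=> ib; rewrite /fill0 coefD coefXn (negbTE ib) addr0.
- move=> /and3P[i1 i2 i3]; rewrite /fill1 !coef_solve ?subnn ?subSnn //.
  by rewrite coefD coefXn (negbTE i1) addr0.
- move=> /andP[i1 i2]; rewrite /fill2 coef_solve ?subSnn //.
  by rewrite coefD coefXn (negbTE i1) addr0.
- by move=> i1; rewrite /fill3 coef_solve ?subSnn.
Qed.

Lemma slice_fill F : fsize b F -> zero_off_free F -> slice b (fill F).
Proof.
move=> sF zF.
have p0 : (fill0 F)`_b = 1 by rewrite coefD coefXn eqxx zF ?add0r // inE eqxx.
have p1 : (fill1 F)`_b.+1 = 1.
  rewrite /fill1 !coef_solve ?subnn ?subSnn //; last by lia.
  by rewrite coefD coefXn eqxx zF ?add0r // !inE eqxx orbT.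
have p2 : (fill2 F)`_b.+1 = 1.
  rewrite /fill2 !coef_solve ?subSnn //; last by lia.
  by rewrite coefD coefXn eqxx zF ?add0r // !inE eqxx !orbT.
split; rewrite /Ts /Tt /pp /rr /qq /= ?addn0 ?addn1 ?addn2; first by split.
- split; first by apply: pair_solve => //; rewrite coefMX.
  (* The outer correction changes the constant coefficient of F_1, which is paired with the
     coefficient b + 1 of F_0; that one is 0, so the inner equation stays solved. *)
  rewrite /fill1 {1}/solve -scaleNr pairDr pairZr pairXn // pair_solve // ?leqnSn // add0r.
  have := fsize_fill sF 0%N; rewrite addn0 /= => /leq_sizeP -> //.
  by rewrite !mulr0.
- by apply: pair_solve; rewrite ?leqnSn.
- by apply: pair_solve; rewrite ?leqnSn // coefMX.
Qed.

(* The equations of the slice are triangular in the prescribed coefficients. *)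
Lemma slice_eq F F' : fsize b F -> fsize b F' -> slice b F -> slice b F' ->
  (forall k i, (k < 4)%N -> (k, i) \notin determined -> (F k)`_i = (F' k)`_i) ->
  forall k, (k < 4)%N -> F k = F' k.
Proof.
move=> sF sF' [[p1 r1 q1] [s0 t0] t1 s2] [[p1' r1' q1'] [s0' t0'] t1' s2'] e.
have e0 : F 0%N = F' 0%N.
  apply/polyP => i; have [->|ib] := eqVneq i b; first by rewrite [LHS]p1 [RHS]p1'.
  by apply: e; rewrite // !inE !xpair_eqE /= (negbTE ib).
have pairN m i f (x : K) : (i <= m)%N -> f`_i = 1 -> x * pair m f 'X^(m - i) = 0 -> x = 0.
  move=> im fi; rewrite pairXn // fi mulr1 => /eqP.
  by rewrite mulf_eq0 (negbTE (pair_coef_neq0 _ _)) orbF => /eqP.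
have pairB m f (h1 h2 h3 : {poly K}) : h1 = h2 + h3 -> pair m f h1 = 0 -> pair m f h2 = 0 ->
    pair m f h3 = 0.
  by move=> ->; rewrite pairDr => + e2; rewrite e2 add0r.
have e1 : F 1%N = F' 1%N.
  pose x := (F 1%N - F' 1%N)`_1; pose y := (F 1%N - F' 1%N)`_0.
  have ed : F 1%N = F' 1%N + (x *: 'X^1 + y *: 'X^0).
    apply/polyP => i; rewrite !coefD !coefZ !coefXn /x /y !coefB.
    have [->|i1] := eqVneq i 1%N; first by rewrite /= mulr1 mulr0; ring.
    have [->|i0] := eqVneq i 0%N; first by rewrite /= mulr1 mulr0; ring.
    have [->|ib] := eqVneq i b.+1; first by rewrite !mulr0 !addr0 [LHS]r1 [RHS]r1'.
    rewrite !mulr0 !addr0; apply: e => //.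
    by rewrite !inE !xpair_eqE /= (negbTE i1) (negbTE i0) (negbTE ib).
  move: s0 t0 s0' t0'; rewrite /Ts /Tt addn0 -e0 => s0 t0 s0' t0'.
  have := pairB _ _ _ _ _ ed t0 t0'; have := pairB _ _ _ _ _ ed s0 s0'.
  rewrite !pairDr !pairZr => sD tD.
  have F0b : (F 0%N)`_b.+1 = 0 by have := sF 0%N; rewrite addn0 => /leq_sizeP ->.
  have p0 : pair b.+1 (F 0%N) 'X^0 = 0.
    by have := pairXn (F 0%N) (leqnn b.+1); rewrite subnn F0b mulr0.
  have x0 : x = 0.
    apply: (pairN b.+1 b (F 0%N)) => //.
    by rewrite subSnn -[RHS]tD p0 mulr0 addr0.
  have y0 : y = 0.
    apply: (pairN b.+1 b.+1 (F 0%N * 'X)) => //; first by rewrite coefMX.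
    by rewrite subnn -[RHS]sD x0 mul0r add0r.
  by rewrite ed x0 y0 !scale0r !addr0.
have single k (x : K) : (k < 4)%N -> x = (F k - F' k)`_1 ->
    (forall i, i != 1%N -> (F k)`_i = (F' k)`_i) -> F k = F' k + x *: 'X^1.
  move=> k4 -> ek; apply/polyP => i; rewrite coefD coefZ coefXn coefB.
  have [->|i1] := eqVneq i 1%N; first by rewrite /= mulr1; ring.
  by rewrite mulr0 addr0; exact: ek.
have e2 : F 2%N = F' 2%N.
  have ed : F 2%N = F' 2%N + (F 2%N - F' 2%N)`_1 *: 'X^1.
    apply: single => // i i1; have [->|ib] := eqVneq i b.+1; first by rewrite [LHS]q1 [RHS]q1'.
    by apply: e; rewrite // !inE !xpair_eqE /= (negbTE i1) (negbTE ib).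
  move: t1 t1'; rewrite /Tt addn1 -e1 => t1 t1'.
  have := pairB _ _ _ _ _ ed t1 t1'; rewrite pairZr => tD.
  rewrite ed (_ : (F 2%N - F' 2%N)`_1 = 0) ?scale0r ?addr0 //.
  by apply: (pairN b.+2 b.+1 (F 1%N)) => //; rewrite subSnn.
have e3 : F 3%N = F' 3%N.
  have ed : F 3%N = F' 3%N + (F 3%N - F' 3%N)`_1 *: 'X^1.
    apply: single => // i i1.
    by apply: e; rewrite // !inE !xpair_eqE /= (negbTE i1).
  move: s2 s2'; rewrite /Ts addn2 -e2 => s2 s2'.
  have := pairB _ _ _ _ _ ed s2 s2'; rewrite pairZr => tD.
  rewrite ed (_ : (F 3%N - F' 3%N)`_1 = 0) ?scale0r ?addr0 //.
  by apply: (pairN b.+3 b.+2 (F 2%N * 'X)) => //; rewrite ?coefMX // subSnn.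
by case=> [|[|[|[|]]]].
Qed.

(* A point of the slice in general position, from f_0 = s^b + t^b. *)
Definition witness : nat -> {poly K} := fun k =>
  match k with 0%N => 1 | 2%N => 1 | 3%N => 'X^(b + 3) | _ => 0 end.

Lemma fsize_witness : fsize b witness.
Proof.
by case=> [|[|[|[|k]]]]; rewrite /witness ?size_poly0 ?size_poly1 ?size_polyXn.
Qed.

Lemma witness_zero_off_free : zero_off_free witness.
Proof.
move=> k i; rewrite !inE !xpair_eqE => H.
case: k H => [|[|[|[|k]]]] /=; rewrite ?coef0 ?coef1 ?coefXn ?orbF ?andbF //.
- by move=> /eqP ->; case: (b) b_ge2.
- by case/orP => /eqP ->.
- by move=> /eqP ->; rewrite addn3.
Qed.

(** By [gen_slice] only [dl], [Ts 1] and [Tt 2] matter. As b is at least 2, the few exponents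
    involved are distinct and almost all products of coefficients in the pairings vanish. *)
Lemma gen_witness : gen b (fill witness) != 0.
Proof.
have sW := fsize_fill fsize_witness; have sl := slice_fill fsize_witness witness_zero_off_free.
rewrite gen_slice //; case: sl => [[p1 r1 q1] [s0 t0] t1 s2].
have fc k i : (k < 4)%N -> (k, i) \notin determined ->
  (fill witness k)`_i = (witness k)`_i := @coef_fill witness k i.
have fW0 : fill witness 0%N = 'X^0 + 'X^b by [].
have bang k : k`!%:R != 0 :> K := fact_neq0 natr_neq0 k.
have pXn m f i : (i <= m)%N ->
    pair m f 'X^i = (-1) ^+ (m - i) * ((m - i)`! * i`!)%:R * f`_(m - i).
  by move=> im; rewrite -{1}(subKn im) pairXn ?leq_subr // subKn.
have b1 : (b == 1)%N = false by apply/eqP; lia.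
have b0 : (b == 0)%N = false by apply/eqP; lia.
have W1 i : (1 < i)%N -> i != b.+1 -> (fill witness 1%N)`_i = 0.
  move=> i1 ib; rewrite fc ?coef0 // !inE !xpair_eqE /= (negbTE ib).
  by rewrite !orbF /=; apply/negP; lia.
have W2 i : (1 < i)%N -> i != b.+1 -> (fill witness 2%N)`_i = 0.
  move=> i1 ib; rewrite fc ?coef1 //; first by case: i i1 {ib}.
  by rewrite !inE !xpair_eqE /= (negbTE ib) /=; apply/negP; lia.
have W20 : (fill witness 2%N)`_0 = 1.
  by rewrite fc ?coef1 // !inE !xpair_eqE.
have W3 i : i != 1%N -> (fill witness 3%N)`_i = (i == (b + 3)%N)%:R.
  by move=> i1; rewrite fc ?coefXn // !inE !xpair_eqE /= (negbTE i1).
clear fc; move: (fill witness) sW p1 r1 q1 s0 t0 t1 s2 fW0 W1 W2 W20 W3.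
move=> F sW p1 r1 q1 s0 t0 t1 s2 fW0 W1 W2 W20 W3.
apply/and3P; split.
(* For s^b + t^b the diagonal entries of the bilinear form vanish and the others are x up to sign,
   where x is b! times b + 1 + (-1)^b. So [dl] is the square of x up to sign. *)
- pose x : K := (-1) ^+ b * b`!%:R + b.+1`!%:R.
  have x0 : x != 0.
    rewrite /x factS natrM -mulrDl mulf_neq0 // -signr_odd; case: (odd b).
      rewrite expr1 -natr1 addrCA addNr addr0.
      by case: (b) b_ge2.
    by rewrite expr0 addrC natr1.
  rewrite /dl /delta fW0 !mulrDl -!exprSr !pairDr !pXn ?subSnn ?subSS ?subn0 ?subnn //; try lia.
  have h1 : (b == b.+1) = false by apply/eqP; lia.
  have h2 : (b.+1 == b) = false by apply/eqP; lia.
  have h3 : (0%N == b) = false by apply/eqP; lia.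
  have h4 : (1%N == b) = false by apply/eqP; lia.
  rewrite !coefD !coefXn !eqSS b1 b0 h1 h2 h3 h4 !eqxx /= !(addr0, add0r, mulr0, mulr1, mul0r).
  rewrite !muln1 !mul1n expr1 expr0 mul1r -/x.
  have -> : (-1) ^+ b.+1 * b.+1`!%:R + -1 * b`!%:R = - ((-1) ^+ b * x) :> K.
    have e : (-1) ^+ b * (-1) ^+ b = 1 :> K by rewrite -expr2 sqrr_sign.
    by rewrite /x exprS mulrDr mulrA e; ring.
  by rewrite mulNr opprK !mulf_neq0 ?signr_eq0.
(* The equation [Ts 0 = 0] forces the constant coefficient of F_1 to vanish. *)
- have w0 : (F 1%N)`_0 = 0.
    set w := (F 1%N)`_0; pose u := (F 1%N)`_1.
    have e1 : F 1%N = 'X^(b.+1) + (u *: 'X^1 + w *: 'X^0).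
      apply/polyP => i; rewrite !coefD !coefZ !coefXn.
      have [->|ib] := eqVneq i b.+1.
        by rewrite [LHS]r1 eqSS b0 !mulr0 !addr0.
      have [->|i1] := eqVneq i 1%N.
        by rewrite add0r mulr1 mulr0 addr0.
      have [->|i0] := eqVneq i 0%N; first by rewrite add0r mulr0 add0r mulr1.
      by rewrite W1 //; [rewrite !mulr0 !addr0|lia].
    have h1 : (b.-1 == 0)%N = false by apply/eqP; lia.
    have h2 : (b.-1 == b) = false by apply/eqP; lia.
    have := s0; rewrite /Ts addn0 e1 !(pairDr, pairZr) !pXn // subnn subn0 subSS subn0.
    rewrite !coefMX fW0 !coefD !coefXn /= eqxx b0 h1 h2 !(addr0, add0r, mulr0, mulr1).
    move=> /eqP; rewrite !mulf_eq0 signr_eq0 natrM mulf_eq0 !(negbTE (bang _)) /=.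
    by rewrite orbF => /eqP.
  (* Only s^(b+1) in F_1 against t^(b+2) in F_2 survives, both with coefficient 1. *)
  rewrite /Ts addn1.
  have -> : F 2%N = 'X^0 + ('X^(b.+1) + (F 2%N)`_1 *: 'X^1).
    apply/polyP => i; rewrite !coefD !coefZ !coefXn.
    have [->|ib] := eqVneq i b.+1.
      by rewrite [LHS]q1 eqSS b0 !mulr0 !addr0 add0r.
    have [->|i1] := eqVneq i 1%N.
        by rewrite add0r mulr1 add0r.
    have [->|i0] := eqVneq i 0%N; first by rewrite W20 !mulr0 !addr0.
    by rewrite W2 //; [rewrite !mulr0 !addr0|lia].
  rewrite !(pairDr, pairZr) !pXn // ?subn0 ?subSnn ?subSS ?subn0; try lia.
  rewrite !coefMX /= w0 (W1 b) //; last by apply/eqP; lia.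
  rewrite -[(F 1%N)`_b.+1]/(rr b (F)) r1 !mulr0 !addr0 mulr1.
  by rewrite mulf_neq0 ?signr_eq0 // natrM mulf_neq0.
(* Here the surviving term is t^(b+2) in F_2 against s^(b+3) in F_3. *)
- rewrite /Tt addn2.
  have -> : F 3%N = 'X^(b.+3) + (F 3%N)`_1 *: 'X^1.
    apply/polyP => i; rewrite !coefD !coefZ !coefXn.
    have [->|i1] := eqVneq i 1%N; first by rewrite /=; ring.
    by rewrite W3 // addn3 mulr0 addr0.
  rewrite !(pairDr, pairZr) !pXn // subnn subSS subn0 W20 (W2 b.+2) ?mulr0 ?addr0 //; last by apply/eqP; lia.
  by rewrite mulr1 mulf_neq0 ?signr_eq0 // natrM mulf_neq0.
Qed.

End Fill.

(** * Forms depending polynomially on parameters *)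

Section PolynomialForms.
Variables (K : closedFieldType) (n : nat).
Implicit Types (f h : ('I_n -> K) -> {poly K}) (a : ('I_n -> K) -> K).

Definition ppoly f : Prop := forall i, polyfun (fun v => (f v)`_i).

Lemma eq_ppoly f h : f =1 h -> ppoly h -> ppoly f.
Proof. by move=> e hh i; apply: eq_polyfun (hh i) => v; rewrite e. Qed.

Lemma ppoly_const (p : {poly K}) : ppoly (fun _ => p).
Proof. by move=> i; exact: polyfun_const. Qed.

Lemma ppolyD f h : ppoly f -> ppoly h -> ppoly (fun v => f v + h v).
Proof.
move=> hf hh i; apply: (@eq_polyfun K n _ (fun v => (f v)`_i + (h v)`_i)).
  by move=> v; rewrite coefD.
exact: polyfunD.
Qed.

Lemma ppolyM f h : ppoly f -> ppoly h -> ppoly (fun v => f v * h v).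
Proof.
move=> hf hh i.
apply: (@eq_polyfun K n _ (fun v => \sum_(j < i.+1) (f v)`_j * (h v)`_(i - j))).
  by move=> v; rewrite coefM.
by apply: polyfun_sum => j; apply: polyfunM.
Qed.

Lemma ppolyC a : polyfun a -> ppoly (fun v => (a v)%:P).
Proof.
move=> ha [|i]; first by apply: eq_polyfun ha => v; rewrite coefC.
by apply: (@eq_polyfun K n _ (fun=> 0)); [move=> v; rewrite coefC|exact: polyfun_const].
Qed.

Lemma ppolyZ a f : polyfun a -> ppoly f -> ppoly (fun v => a v *: f v).
Proof.
move=> ha hf; apply: (@eq_ppoly _ (fun v => (a v)%:P * f v)).
  by move=> v; rewrite mul_polyC.
by apply: ppolyM => //; exact: ppolyC.
Qed.

Lemma ppolyN f : ppoly f -> ppoly (fun v => - f v).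
Proof.
move=> hf; apply: (@eq_ppoly _ (fun v => -1 *: f v)); first by move=> v; rewrite scaleN1r.
by apply: ppolyZ => //; exact: polyfun_const.
Qed.

Lemma ppolyX f k : ppoly f -> ppoly (fun v => f v ^+ k).
Proof.
move=> hf; elim: k => [|k IH]; first exact: ppoly_const.
by apply: (@eq_ppoly _ (fun v => f v * f v ^+ k)); [move=> v; rewrite exprS|exact: ppolyM].
Qed.

Lemma ppoly_sum (I : Type) (r : seq I) (P : pred I) (F : I -> ('I_n -> K) -> {poly K}) :
  (forall i, ppoly (F i)) -> ppoly (fun v => \sum_(i <- r | P i) F i v).
Proof.
move=> hF i; apply: (@eq_polyfun K n _ (fun v => \sum_(j <- r | P j) (F j v)`_i)).
  by move=> v; rewrite coef_sum.
by apply: polyfun_sum => j; exact: hF.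
Qed.

Lemma polyfun_pair m f h : ppoly f -> ppoly h -> polyfun (fun v => pair m (f v) (h v)).
Proof.
move=> hf hh; apply: polyfun_sum => i; apply: polyfunM => //; apply: polyfunM => //.
exact: polyfun_const.
Qed.

Lemma ppoly_lform a b : polyfun a -> polyfun b -> ppoly (fun v => lform (a v) (b v)).
Proof.
move=> ha hb; apply: ppolyD; last exact: ppolyC.
by apply: ppolyZ => //; exact: ppoly_const.
Qed.

Lemma ppoly_hsub m f h k : ppoly f -> ppoly h -> ppoly k ->
  ppoly (fun v => hsub m (f v) (h v) (k v)).
Proof.
move=> hf hh hk; apply: ppoly_sum => i; apply: ppolyZ; first exact: hk.
by apply: ppolyM; apply: ppolyX.
Qed.

Definition coxpoly (g : ('I_n -> K) -> coxmap K) : Prop :=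
  [/\ polyfun (fun v => c11 (g v)), polyfun (fun v => c12 (g v)),
      polyfun (fun v => c21 (g v)) & polyfun (fun v => c22 (g v))] /\
  [/\ polyfun (fun v => cu (g v)), polyfun (fun v => cz (g v)),
      polyfun (fun v => cs (g v)) & polyfun (fun v => ct (g v))].

Lemma ppoly_fact b (g : ('I_n -> K) -> coxmap K) (F : ('I_n -> K) -> nat -> {poly K}) :
  coxpoly g -> (forall k, ppoly (fun v => F v k)) ->
  forall k, ppoly (fun v => fact b (g v) (F v) k).
Proof.
move=> [[g1 g2 g3 g4] [g5 g6 g7 g8]] hF k.
have hA := ppoly_lform g1 g2; have hB := ppoly_lform g3 g4; have hl := ppoly_lform g7 g8.
have hh i := ppoly_hsub (b + i) hA hB (hF i).
have hc (x : K) : polyfun (fun _ : 'I_n -> K => x) by exact: polyfun_const.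
case: k => [|[|[|[|k]]]] /=; last exact: ppoly_const.
- by apply: ppolyZ; [exact: polyfunX|exact: hh].
- apply: ppolyZ; first exact: polyfunX.
  apply: ppolyD; apply: ppolyZ => //; apply: ppolyM => //; exact: hh.
- apply: ppolyZ => //; apply: ppolyD; first apply: ppolyD.
  + by apply: ppolyZ; [exact: polyfunX|exact: hh].
  + by apply: ppolyZ; [exact: polyfunM|apply: ppolyM].
  + by apply: ppolyZ => //; apply: ppolyM => //; exact: ppolyX.
- apply: ppolyD; first (apply: ppolyD; first apply: ppolyD).
  + by apply: ppolyZ; [exact: polyfunX|exact: hh].
  + by apply: ppolyZ; [exact: polyfunX|apply: ppolyM].
  + by apply: ppolyZ => //; apply: ppolyM => //; exact: ppolyX.
  + by apply: ppolyM => //; exact: ppolyX.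
Qed.

End PolynomialForms.

(** * Polynomiality of the normal form and coordinates on the slice *)

Section Main.
Variables (K : closedFieldType) (b : nat).
Hypothesis natr_neq0 : forall k, k.+1%:R != 0 :> K.
Hypothesis b_ge2 : (2 <= b)%N.
Local Notation n := (h0 3 b).
Local Notation free := (@free_index b).
Local Notation r := #|free|.

Lemma ppoly_forms m (c : ('I_m -> K) -> 'I_n -> K) : (forall j, polyfun (fun v => c v j)) ->
  forall k, ppoly (fun v => forms (c v) k).
Proof.
move=> hc k; apply: ppoly_sum => j; apply: ppolyZ => //; exact: ppoly_const.
Qed.

Lemma polyfun_coords m (F : ('I_m -> K) -> nat -> {poly K}) :
  (forall k, ppoly (fun v => F v k)) -> forall j : 'I_n, polyfun (fun v => coords (F v) j).
Proof. by move=> hF j; exact: hF. Qed.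

Section Generic.
Variables (m : nat) (F : ('I_m -> K) -> nat -> {poly K}).
Hypothesis hF : forall k, ppoly (fun v => F v k).

Lemma ppolyMX (f : ('I_m -> K) -> {poly K}) : ppoly f -> ppoly (fun v => f v * 'X).
Proof. by move=> hf; apply: ppolyM => //; exact: ppoly_const. Qed.

Lemma polyfun_Ts k : polyfun (fun v => Ts b k (F v)).
Proof. by apply: polyfun_pair => //; exact: ppolyMX. Qed.

Lemma polyfun_Tt k : polyfun (fun v => Tt b k (F v)).
Proof. exact: polyfun_pair. Qed.

Lemma polyfunB (x y : ('I_m -> K) -> K) : polyfun x -> polyfun y -> polyfun (fun v => x v - y v).
Proof. by move=> hx hy; apply: polyfunD => //; exact: polyfunN. Qed.

Lemma polyfun_dl : polyfun (fun v => dl b (F v)).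
Proof.
by apply: polyfunB; apply: polyfunM; apply: polyfun_pair => //; exact: ppolyMX.
Qed.

Lemma coxpoly_gA : coxpoly (fun v => gA b (F v)).
Proof.
have hc (x : K) : polyfun (fun _ : 'I_m -> K => x) by exact: polyfun_const.
have hd := polyfun_dl; have h0 := hF 0%N; have hX := ppolyMX h0.
have hp (f h : ('I_m -> K) -> {poly K}) : ppoly f -> ppoly h -> polyfun (fun v => pair b.+1 (f v) (h v)).
  exact: polyfun_pair.
have hs := polyfun_Ts 0; have ht := polyfun_Tt 0.
split; split; try exact: hc; try exact: hd; apply: polyfunM => //; apply: polyfunN; apply: polyfunB; apply: polyfunM => //; exact: hp.
Qed.

End Generic.

Lemma ppoly_FA m (F : ('I_m -> K) -> nat -> {poly K}) : (forall k, ppoly (fun v => F v k)) ->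
  forall k, ppoly (fun v => FA b (F v) k).
Proof. by move=> hF; apply: ppoly_fact => //; exact: coxpoly_gA. Qed.

Lemma ppoly_FB m (F : ('I_m -> K) -> nat -> {poly K}) : (forall k, ppoly (fun v => F v k)) ->
  forall k, ppoly (fun v => FB b (F v) k).
Proof.
move=> hF; have hA := ppoly_FA hF; apply: ppoly_fact => //.
by split; split; try exact: polyfun_const; try exact: polyfun_Ts; exact: polyfun_Tt.
Qed.

Lemma polyfun_gen m (F : ('I_m -> K) -> nat -> {poly K}) : (forall k, ppoly (fun v => F v k)) ->
  polyfun (fun v => gen b (F v)).
Proof.
move=> hF; have hA := ppoly_FA hF; have hB := ppoly_FB hF.
apply: polyfunM; first apply: polyfunM.
- exact: polyfun_dl.
- by apply: polyfunB; apply: polyfunM; try exact: polyfun_Ts; exact: polyfun_Tt.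
- by apply: polyfunM; [apply: polyfunM|]; exact: hB.
Qed.

Lemma ppoly_solve m i k (f h : ('I_k -> K) -> {poly K}) : ppoly f -> ppoly h ->
  ppoly (fun v => solve m i (f v) (h v)).
Proof.
move=> hf hh; apply: ppolyD => //; apply: ppolyN; apply: ppolyZ; last exact: ppoly_const.
by apply: polyfunM; [exact: polyfun_pair|exact: polyfun_const].
Qed.

Lemma ppoly_fill m (F : ('I_m -> K) -> nat -> {poly K}) : (forall k, ppoly (fun v => F v k)) ->
  forall k, ppoly (fun v => fill b (F v) k).
Proof.
move=> hF; have hX k : ppoly (fun _ : 'I_m -> K => 'X^k : {poly K}) by exact: ppoly_const.
have f0 : ppoly (fun v => fill0 b (F v)) by apply: ppolyD.
have f1 : ppoly (fun v => fill1 b (F v)).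
  by apply: ppoly_solve; [exact: ppolyMX|apply: ppoly_solve => //; apply: ppolyD].
have f2 : ppoly (fun v => fill2 b (F v)) by apply: ppoly_solve => //; apply: ppolyD.
have f3 : ppoly (fun v => fill3 b (F v)) by apply: ppoly_solve => //; exact: ppolyMX.
by case=> [|[|[|[|k]]]] //=; exact: ppoly_const.
Qed.

Lemma gen_ext (F F' : nat -> {poly K}) : (forall k, (k < 4)%N -> F k = F' k) -> gen b F = gen b F'.
Proof.
move=> e; have eA : gA b F = gA b F' by rewrite /gA /dl /xs /xt /Ts /Tt !e.
have eFA k : (k < 4)%N -> FA b F k = FA b F' k.
  by move=> k4; rewrite /FA eA; exact: fact_ext.
have eB : gB b (FA b F) = gB b (FA b F') by rewrite /gB /Ts /Tt !eFA.
have eFB k : (k < 4)%N -> FB b F k = FB b F' k.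
  by move=> k4; rewrite /FB eB; apply: fact_ext.
have e0 : dl b F = dl b F' by rewrite /dl e.
have eD : detB b (FA b F) = detB b (FA b F') by rewrite /detB /Ts /Tt !eFA.
by rewrite /gen e0 eD /pp /rr /qq !eFB.
Qed.

Lemma slice_ext (F F' : nat -> {poly K}) : (forall k, (k < 4)%N -> F k = F' k) ->
  slice b F -> slice b F'.
Proof. by move=> e; rewrite /slice /pp /rr /qq /Ts /Tt !e. Qed.

(** Extension by zero from the free positions, written with Kronecker deltas so that it is visibly
    polynomial in [y]. *)
Definition place (y : 'I_r -> K) : 'I_n -> K := fun j => \sum_i (enum_val i == j)%:R * y i.

Lemma place_free y i : place y (enum_val i) = y i.
Proof.
rewrite /place (bigD1 i) //= eqxx mul1r big1 ?addr0 // => k ki.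
by rewrite (inj_eq enum_val_inj) (negbTE ki) mul0r.
Qed.

Lemma place_determined y j : ~~ free j -> place y j = 0.
Proof.
move=> nf; rewrite /place big1 // => i _; rewrite (_ : _ == _ = false) ?mul0r //.
apply: contraNF nf => /eqP <-; exact: (enum_valP i).
Qed.

Definition slice_point (y : 'I_r -> K) : 'I_n -> K := coords (fill b (forms (place y))).

Lemma forms_slice_point y k : (k < 4)%N -> forms (slice_point y) k = fill b (forms (place y)) k.
Proof. by apply: coordsK; apply: fsize_fill; exact: fsize_forms. Qed.

Lemma place_zero_off_free y : zero_off_free b (forms (place y)).
Proof.
move=> k i ki.
have [/andP[k4 ib]|] := boolP ((k < 4) && (i <= b + k))%N.
  have [j [ek ei]] := cidx_ex k4 ib; rewrite -ek -ei coef_forms place_determined //.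
  by rewrite /free_index ek ei ki.
rewrite negb_and -!leqNgt => /orP[k4|]; last first.
  by rewrite -ltnNge => ib; apply: (leq_sizeP _ _ (fsize_forms _ _)).
by rewrite /forms big1 ?coef0 // => j /eqP e; have := cdeg_lt j; rewrite e ltnNge k4.
Qed.

Lemma slice_slice_point y : slice b (forms (slice_point y)).
Proof.
apply: (@slice_ext (fill b (forms (place y)))).
  by move=> k k4; rewrite forms_slice_point.
apply: slice_fill => //; [exact: fsize_forms|exact: place_zero_off_free].
Qed.

Lemma slice_point_free y i : slice_point y (enum_val i) = y i.
Proof.
rewrite -coef_forms forms_slice_point ?cdeg_lt // coef_fill ?cdeg_lt //.
  by rewrite coef_forms place_free.
exact: (enum_valP i).
Qed.

(** By [slice_eq] a point of the slice is determined by its free coefficients; this identifies the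
    parametrization with normal forms obtained by transformation. *)
Lemma slice_pointE (F : nat -> {poly K}) y : fsize b F -> slice b F ->
  (forall i, y i = (F (cdeg (enum_val i)))`_(cexp (enum_val i))) ->
  slice_point y = coords F.
Proof.
move=> sF sl ey; rewrite -[slice_point y]formsK; apply: funext => j; rewrite /coords.
have -> // := slice_eq natr_neq0 (fsize_forms _) sF (slice_slice_point y) sl _ (cdeg_lt j).
move=> k i k4 ki.
have [ib|ib] := leqP i (b + k); last first.
  by rewrite !(leq_sizeP _ _ (leq_trans _ ib)) ?sF ?fsize_forms.
have [l [ek ei]] := cidx_ex k4 ib.
have fl : l \in free by rewrite unfold_in /free_index /= ek ei.
by rewrite -ek -ei coef_forms -(enum_rankK_in fl fl) slice_point_free ey enum_rankK_in.
Qed.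

End Main.

(** * Verification of the slice hypotheses *)

Section Rationality.
Variables (K : closedFieldType) (b : nat).
Hypothesis natr_neq0 : forall k, k.+1%:R != 0 :> K.
Hypothesis b_ge2 : (2 <= b)%N.
Local Notation n := (h0 3 b).
Local Notation r := #|@free_index b|.
Implicit Types (c v : 'I_n -> K).

(** With p, r, q for [pp], [rr], [qq] of [FB], these are numerator and denominator of a coefficient
    of the normal form, after writing out kC (p / r)^e (r / q)^(b + k - e) as one fraction. *)
Definition slice_num (i : 'I_r) v : K :=
  let F := FB b (forms v) in let k := cdeg (enum_val i) in let e := cexp (enum_val i) in
  (F k)`_e * pp b F ^+ e * rr b F ^+ b * rr b F ^+ (b + k - e).

Definition slice_den (i : 'I_r) v : K :=
  let F := FB b (forms v) in let k := cdeg (enum_val i) in let e := cexp (enum_val i) in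
  pp b F * pp b F ^+ b * rr b F ^+ e * qq b F ^+ (b + k - e).

Lemma ppoly_FB_forms k : ppoly (fun v => FB b (forms v) k).
Proof.
by apply: ppoly_FB => {}k; apply: ppoly_forms => j; exact: polyfun_coord.
Qed.

Lemma polyfun_slice_num i : polyfun (slice_num i).
Proof.
have h := ppoly_FB_forms.
by do 3![apply: polyfunM; last (apply: polyfunX; exact: h)]; exact: h.
Qed.

Lemma polyfun_slice_den i : polyfun (slice_den i).
Proof.
have h := ppoly_FB_forms.
by do 3![apply: polyfunM; last (apply: polyfunX; exact: h)]; exact: h.
Qed.

Lemma slice_den_neq0 i v : gen b (forms v) != 0 -> slice_den i v != 0.
Proof.
by move=> /genP[_ _ p0 r0 q0]; rewrite !mulf_neq0 ?expf_neq0.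
Qed.

Lemma quot_coordsE i v : gen b (forms v) != 0 -> quot_coords slice_num slice_den v i =
  (FC b (forms v) (cdeg (enum_val i)))`_(cexp (enum_val i)).
Proof.
move=> /genP[_ _ p0 r0 q0]; rewrite coef_FC ?cdeg_lt ?cexp_le //.
rewrite /quot_coords /slice_num /slice_den /kC.
move: (FB b (forms v)) p0 r0 q0 => F; move: (pp b F) (rr b F) (qq b F) => p q s p0 q0 s0.
rewrite !exprMn !exprVn; set m := (_ + _ - _)%N.
have := expf_neq0 b p0; have := expf_neq0 b q0; have := expf_neq0 (cexp (enum_val i)) q0.
have := expf_neq0 m s0.
move: (_ ^+ b) (_ ^+ b) (_ ^+ m) (_ ^+ m) (_ ^+ cexp _) (_ ^+ cexp _) (_`_ _).
by move=> x1 x2 x3 x4 x5 x6 x7 x10 x50 x20 x40; field; rewrite ?p0 ?x10 ?x20 ?x40 ?x50.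
Qed.

Lemma nonzero_gen v : gen b (forms v) != 0 -> nonzero_vec v.
Proof.
move=> /genP[d0 _ _ _ _]; apply: contrapT => nz.
have z j : v j = 0 by apply/eqP/negPn/negP => j0; apply: nz; exists j.
have f0 : forms v 0%N = 0 by rewrite /forms big1 // => j _; rewrite z scale0r.
by move: d0; rewrite /dl f0 /delta mul0r !pair0r !mul0r subr0 eqxx.
Qed.

Lemma forms_coords_ext (F : nat -> {poly K}) g k : fsize b F -> (k < 4)%N ->
  fact b g (forms (@coords K b F)) k = fact b g F k.
Proof. by move=> sF; apply: fact_ext => m m4; exact: coordsK. Qed.

Lemma linsys_coords g k (F F' : nat -> {poly K}) : fsize b F -> nonzero_vec (@coords K b F) ->
  cox_ok g -> k != 0 -> (forall m, (m < 4)%N -> F' m = k *: fact b g F m) ->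
  nonzero_vec (@coords K b F') /\ linsys_Aut (@coords K b F) (coords F').
Proof.
move=> sF nz ok k0 e.
have -> : coords F' = cscale k (cact g (@coords K b F)).
  apply: funext => j; rewrite /coords /cscale /cact e ?cdeg_lt // coefZ; congr (_ * _).
  by rewrite -/(coords F) /coords forms_coords_ext ?cdeg_lt.
by split; [exact: nonzero_cact|exact: linsys_cact].
Qed.

Lemma linsys_normal_form v : gen b (forms v) != 0 ->
  linsys_Aut v (coords (FC b (forms v))).
Proof.
move=> gv; have [d0 dB p0 r0 q0] := genP gv; have v0 := nonzero_gen gv.
have sv := fsize_forms v; have sA : fsize b (FA b (forms v)) by exact: fsize_fact.
have sB : fsize b (FB b (forms v)) by exact: fsize_fact.
have o1 := oner_neq0 K.
have [] := @linsys_coords (gA b (forms v)) 1 (forms v) (FA b (forms v)) sv.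
- by rewrite formsK.
- by split; rewrite //= mulr1 mulr0 subr0.
- by [].
- by move=> m _; rewrite scale1r.
rewrite formsK => nA oA.
have [] := @linsys_coords (gB b (FA b (forms v))) 1 (FA b (forms v)) (FB b (forms v)) sA.
- by [].
- by split.
- by [].
- by move=> m _; rewrite scale1r.
move=> nB oB.
have [] := @linsys_coords (gC b (FB b (forms v))) (kC b (FB b (forms v))) (FB b (forms v))
    (FC b (forms v)) sB.
- by [].
- by split; rewrite //= mulr0 subr0 !mulf_neq0 ?invr_eq0.
- by rewrite invr_eq0 mulf_neq0 ?expf_neq0 ?mulf_neq0 ?invr_eq0.
- by [].
move=> nC oC; apply: (linsys_trans v0 nB nC _ oC).
exact: (linsys_trans v0 nA nB oA oB).
Qed.

Lemma slice_point_FC v : gen b (forms v) != 0 ->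
  slice_point (quot_coords slice_num slice_den v) = coords (FC b (forms v)).
Proof.
move=> gv; have [sl _] := slice_FC natr_neq0 (fsize_forms v) gv.
apply: slice_pointE => //; first exact: fsize_FC.
by move=> i; exact: quot_coordsE.
Qed.

Lemma gen_slice_point v : gen b (forms v) != 0 ->
  gen b (forms (slice_point (quot_coords slice_num slice_den v))) != 0.
Proof.
move=> gv; have [_ gC] := slice_FC natr_neq0 (fsize_forms v) gv.
rewrite (slice_point_FC gv) (@gen_ext K b _ (FC b (forms v))) => [|k k4]; first exact: gC.
by apply: coordsK k4; exact: fsize_FC.
Qed.

Lemma nonzero_slice_point (y : 'I_r -> K) : nonzero_vec (slice_point y).
Proof.
have [[p1 _ _] _ _ _] := slice_slice_point natr_neq0 b_ge2 y.
have [j [ek ei]] := @cidx_ex b 0 b isT (leq_addr _ _).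
by exists j; rewrite -coef_forms ek ei -/(pp b _) p1 oner_neq0.
Qed.

Lemma gen_slice_point_ex : exists y : 'I_r -> K, gen b (forms (slice_point y)) != 0.
Proof.
exists (fun i => (witness K b (cdeg (enum_val i)))`_(cexp (enum_val i))).
set y := fun i => _.
have ep : place y = coords (witness K b).
  apply: funext => j; have [fj|nfj] := boolP (free_index j).
    have {}fj : j \in @free_index b by [].
    by rewrite -(enum_rankK_in fj fj) place_free.
  rewrite place_determined // /coords witness_zero_off_free //.
  by move: nfj; rewrite negbK.
rewrite (@gen_ext K b _ (fill b (witness K b))); first exact: gen_witness.
move=> k k4; rewrite forms_slice_point // ep.
have e m : (m < 4)%N -> forms (@coords K b (witness K b)) m = witness K b m.
  by move=> m4; apply: coordsK m4; exact: fsize_witness.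
case: k k4 => [|[|[|[|//]]]] _ /=; rewrite /fill3 /fill2 /fill1 /fill0 !e //.
Qed.

Lemma slice_point_inj (y y' : 'I_r -> K) : gen b (forms (slice_point y)) != 0 ->
  gen b (forms (slice_point y')) != 0 -> linsys_Aut (slice_point y) (slice_point y') -> y = y'.
Proof.
move=> gy gy' /(linsys_cactE (nonzero_slice_point y))[g [k [ok k0 e]]].
apply: funext => i; rewrite -(slice_point_free y) -(slice_point_free y') -!coef_forms.
congr ((polyseq _)`__); apply/esym.
have sl y0 := slice_slice_point natr_neq0 b_ge2 y0.
apply: (slice_unique natr_neq0 (fsize_forms _) (fsize_forms _) (sl y) (sl y') gy gy' ok k0
  _ (cdeg_lt _)) => m m4.
rewrite e -(forms_cact g _ m4) /forms scaler_sumr; apply: eq_bigr => j _.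
by rewrite scalerA.
Qed.

Lemma ppoly_cact (g : coxmap K) (k : K) j : polyfun (fun v => cscale k (cact g v) j).
Proof.
apply: polyfunM; first exact: polyfun_const.
apply: ppoly_fact => [|m]; first by split; split; exact: polyfun_const.
by apply: ppoly_forms => i; exact: polyfun_coord.
Qed.

(** For fixed [g] and [k] the action on coefficients is a linear map, and [coxinv g] with [k^-1]
    provides its inverse. *)
Lemma linsys_polymap c c' : nonzero_vec c -> nonzero_vec c' -> linsys_Aut c c' ->
  exists L L' : ('I_n -> K) -> 'I_n -> K,
  [/\ forall j, polyfun (fun v => L v j), forall j, polyfun (fun v => L' v j),
      forall v, L (L' v) = v, L c = c' &
      forall v, nonzero_vec v -> nonzero_vec (L v) /\ linsys_Aut v (L v)].
Proof.
move=> c0 _ /(linsys_cactE c0)[g [k [ok k0 e]]].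
exists (fun v => cscale k (cact g v)), (fun v => cscale k^-1 (cact (coxinv g) v)).
split=> //; try exact: ppoly_cact.
- move=> v; apply: sect_inj => w; rewrite sect_cscale sect_cact sect_cscale sect_cact.
  by rewrite mulVKf // coxinvK.
- by move=> v v0; split; [exact: nonzero_cact|exact: linsys_cact].
Qed.

Theorem linsys_rational : rational_quotient (@linsys_Aut K 3 b).
Proof.
apply: (@slice_rational K n r _ slice_num slice_den (@slice_point K b) (fun v => gen b (forms v))).
- exact: polyfun_slice_num.
- exact: polyfun_slice_den.
- apply: polyfun_coords; apply: ppoly_fill; apply: ppoly_forms => j.
  apply: polyfun_sum => i; apply: polyfunM; [exact: polyfun_const|exact: polyfun_coord].
- by apply: polyfun_gen; apply: ppoly_forms => j; exact: polyfun_coord.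
- exact: gen_slice_point_ex.
- exact: nonzero_slice_point.
- move=> v gv; split; [exact: nonzero_gen|by move=> i; exact: slice_den_neq0| |exact: gen_slice_point].
  by rewrite slice_point_FC //; exact: linsys_normal_form.
- exact: slice_point_inj.
- exact: linsys_sym.
- exact: linsys_trans.
- exact: linsys_scale.
- exact: linsys_polymap.
Qed.

End Rationality.

Theorem theorem1p2 (R : realType) (b : nat) (hb : (2 <= b)%N) :
  rational_quotient (@linsys_Aut R[i]%C 3 b).
Proof.
by apply: linsys_rational => // k; rewrite Num.Theory.pnatr_eq0.
Qed.
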